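(* Let $G:C^0_\pi(\mathbb{R}^{n_y})\times\mathbb{R}^{n_\mu}\to\mathbb{R}^{n_y}$ be mildly differentiable to order $\ell_{\max}\ge1$, and let $x^*=(v^*,\alpha^*,\mu^* )\in C^{0,1}_{\mathrm e}$ be a fixed point of $\Phi=\mathcal{L}\circ g$ such that $I-D\Phi(x^* )$ has a bounded inverse (equivalently, $I-D\Phi(x^* )$ is injective on $C^1_{\mathrm e}$). Then there exists a radius $r>0$ such that the discretized fixed point problem $x=\Phi_L(x)$, with $\Phi_L=\mathcal{L}\mathcal{P}_L g$ and $L$ polynomial pieces of degree $m$, has a unique solution $x^L$ in the ball $B^{0,1}_r(x^* )=\{x\in C^{0,1}_{\mathrm e}:\|x-x^*\|_{0,1}\le r\}$ for all sufficiently large $L$. The error $\delta^{x,L}=x^L-x^*$ satisfies $$\|\delta^{x,L}\|_{0,1}=O(L^{-\min\{\ell_{\max},m\}})\quad(L\to\infty).$$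
   Context: Spaces: $C^k_\pi$ is the space of $k$ times continuously differentiable $1$-periodic functions with norm $\|v\|_k=\max_{t\in[0,1],j\le k}|v^{(j)}(t)|$; $C^{k,1}_\pi=\{v\in C^k_\pi:\mathrm{Lip}\,v^{(k)}<\infty\}$ with norm $\|v\|_{k,1}=\max\{\|v\|_k,\mathrm{Lip}\,v^{(k)}\}$; $L^\infty_\pi$ is the space of $1$-periodic essentially bounded functions with norm $\|\cdot\|_\infty$. Extended spaces: $C^{k}_{\mathrm e}=C^{k}_\pi(\mathbb{R}^{n_y})\times\mathbb{R}^{n_y}\times\mathbb{R}^{n_\mu}$, and similarly $C^{k,1}_{\mathrm e}$, $L^\infty_{\mathrm e}$, normed by the maximum of the component norms. Write $v_t(s)=v(t+s)$. Mild differentiability: $G:C^0_\pi(\mathbb{R}^{n_y})\times\mathbb{R}^{n_\mu}\to\mathbb{R}^{n_y}$ is mildly differentiable to order $\ell_{\max}$ if, with $X^\ell:=C^\ell_\pi(\mathbb{R}^{n_y})\times\mathbb{R}^{n_\mu}$, (1) for every $0\le\ell\le\ell_{\max}$ the restriction $G|_{X^\ell}$ is $\ell$ times continuously differentiable (in particular $G$ is continuous), and (2) for every $1\le\ell\le\ell_{\max}$ the map $X^\ell\times X^\ell\ni(u,\delta^u)\mapsto D^\ell G(u)(\delta^u)^\ell$ has a continuous extension to $X^\ell\times X^{\ell-1}$, where $(\delta^u)^\ell=(\delta^u,\dots,\delta^u)$ ($\ell$ arguments of the multilinear map $D^\ell G(u)$). Operators: $R_{\mathrm{aff}}:C^0_\pi(\mathbb{R}^{n_y})\times\mathbb{R}^{n_\mu}\to\mathbb{R}^{n_\mu}$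 is a continuous affine map. Define $g:C^{0,1}_{\mathrm e}\to C^0_{\mathrm e}$ by $g(v,\alpha,\mu)=(t\mapsto G(v_t,\mu),\ \alpha,\ \mu+R_{\mathrm{aff}}[v,\mu])$ and the bounded linear map $\mathcal{L}:L^\infty_{\mathrm e}\to C^{0,1}_{\mathrm e}$ (also $C^\ell_{\mathrm e}\to C^{\ell+1}_{\mathrm e}$) by $$\mathcal{L}(w,\alpha,\nu)=\Big(t\mapsto\alpha+\int_0^t w(s)\,ds-t\int_0^1w(s)\,ds,\ \ \alpha+\int_0^1w(s)\,ds,\ \ \nu\Big)$$ (formula for $t\in[0,1]$, extended $1$-periodically). $\Phi=\mathcal{L}\circ g$. Fixed points $x^*$ of $\Phi$ lie in $C^{\ell_{\max}+1}_{\mathrm e}\subseteq C^2_{\mathrm e}$, so $Dg(x^* )$ and $D\Phi(x^* )=\mathcal{L}Dg(x^* )$ are defined on $C^1_{\mathrm e}$ and, by mild differentiability, extend uniquely to continuous linear operators on $C^0_{\mathrm e}$ (in particular they act on $C^{0,1}_{\mathrm e}$). Discretization: fix $m\ge1$, a constant $C_{\mathrm{msh}}$ and distinct points $t_{\mathrm c,1},\dots,t_{\mathrm c,m}\in(0,1)$ (the collocation points for a sequence of orthogonal polynomials, e.g. Gauss–Legendre or Chebyshev). For each $L$ a mesh $0=t_0<\dots<t_L=1$ with $\max_i(t_i-t_{i-1})\le C_{\mathrm{msh}}/L$ is given; $t_{i,j}=t_{i-1}+(t_i-t_{i-1})t_{\mathrm c,j}$. For $z\in C^0_\pi$, $P_Lz\in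 L^\infty_\pi$ is the ($1$-periodic, possibly discontinuous) piecewise polynomial that on each $(t_{i-1},t_i)$ is the polynomial of degree $\le m-1$ with $(P_Lz)(t_{i,j})=z(t_{i,j})$ for $j=1,\dots,m$. $\mathcal{P}_L:C^0_{\mathrm e}\to L^\infty_{\mathrm e}$, $\mathcal{P}_L(w,\alpha,\nu)=(P_Lw,\alpha,\nu)$. *)

(* Defs.v *)
From HB Require Import structures.
From mathcomp Require Import all_boot all_order all_algebra.
From mathcomp Require Import all_classical all_reals all_analysis.

Set Implicit Arguments.
Unset Strict Implicit.
Unset Printing Implicit Defensive.
Import Order.TTheory GRing.Theory Num.Theory.
Import numFieldNormedType.Exports.
Local Open Scope classical_set_scope.
Local Open Scope ring_scope.

(* The function spaces below are nested subspaces of one vector space, each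
   with its own norm, and a map is restricted to several of them in turn. A
   normed space is therefore given by an ambient vector space, the set of its
   members and a norm that is meaningful on the members only. *)
Record nspace (R : realType) := NSpace {
  vcar : lmodType R;
  vmem : set vcar;
  vnorm : vcar -> R }.

Arguments vmem {R} X _ : rename.
Arguments vnorm {R} X _ : rename.

Definition prod_ns (R : realType) (X Y : nspace R) : nspace R :=
  @NSpace R (vcar X * vcar Y)%type
    [set p | vmem X p.1 /\ vmem Y p.2]
    (fun p => Num.max (vnorm X p.1) (vnorm Y p.2)).

Definition euclid (R : realType) (n : nat) : nspace R :=
  @NSpace R 'rV[R]_n setT (fun a => `|a|).

Definition ns_ball (R : realType) (X : nspace R) (c : vcar X) (r : R) :
    set (vcar X) :=
  [set x | vmem X x /\ vnorm X (x - c) <= r].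

Section Maps.
Variables (R : realType) (X Y : nspace R).

Definition ns_continuous (F : vcar X -> vcar Y) : Prop :=
  (forall u, vmem X u -> vmem Y (F u)) /\
  forall u, vmem X u -> forall e : R, 0 < e -> exists2 d : R, 0 < d &
    forall u', vmem X u' -> vnorm X (u' - u) < d -> vnorm Y (F u' - F u) < e.

Definition ns_linear (A : vcar X -> vcar Y) : Prop :=
  forall (a : R) u v, vmem X u -> vmem X v -> A (a *: u + v) = a *: A u + A v.

Definition ns_affine (A : vcar X -> vcar Y) : Prop :=
  forall (a : R) u v, vmem X u -> vmem X v ->
    A (a *: u + (1 - a) *: v) = a *: A u + (1 - a) *: A v.

Definition is_frechet (F : vcar X -> vcar Y) (u : vcar X)
    (A : vcar X -> vcar Y) : Prop :=
  [/\ ns_linear A, ns_continuous A &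
   forall e : R, 0 < e -> exists2 d : R, 0 < d &
    forall h, vmem X h -> vnorm X h < d ->
      vnorm Y (F (u + h) - F u - A h) <= e * vnorm X h].

Definition update (T : Type) (j : nat) (w : 'I_j -> T) (i : 'I_j) (h : T) :
    'I_j -> T :=
  fun k => if k == i then h else w k.

Definition bounded_multilinear (j : nat) (A : ('I_j -> vcar X) -> vcar Y) :
    Prop :=
  [/\ forall w, (forall i, vmem X (w i)) -> vmem Y (A w),
   forall w (i : 'I_j) (a : R) h h', (forall i', vmem X (w i')) ->
     vmem X h -> vmem X h' ->
     A (update w i (a *: h + h')) =
     a *: A (update w i h) + A (update w i h') &
   exists M : R, forall w, (forall i, vmem X (w i)) ->
     vnorm Y (A w) <= M * \prod_(i < j) vnorm X (w i)].

Definition vcons (T : Type) (j : nat) (h : T) (w : 'I_j -> T) :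
    'I_j.+1 -> T :=
  fun i => if unlift ord0 i is Some i' then w i' else h.

(* D 0, ..., D l are the iterated Frechet derivatives of F on X and D l is
   continuous: L(X, L^j(X, Y)) is identified with the bounded (j+1)-linear
   maps, with the operator norm written out. *)
Definition is_Ck_family (F : vcar X -> vcar Y) (l : nat)
    (D : forall j, vcar X -> ('I_j -> vcar X) -> vcar Y) : Prop :=
  [/\ forall u w, vmem X u -> D 0%N u w = F u,
   forall j u, (j <= l)%N -> vmem X u -> bounded_multilinear (D j u),
   forall j u, (j < l)%N -> vmem X u ->
     forall e : R, 0 < e -> exists2 d : R, 0 < d &
     forall h w, vmem X h -> vnorm X h < d -> (forall i, vmem X (w i)) ->
       vnorm Y (D j (u + h) w - D j u w - D j.+1 u (vcons h w)) <=
       e * vnorm X h * \prod_(i < j) vnorm X (w i) &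
   forall u, vmem X u -> forall e : R, 0 < e -> exists2 d : R, 0 < d &
     forall u' w, vmem X u' -> vnorm X (u' - u) < d ->
       (forall i, vmem X (w i)) ->
       vnorm Y (D l u' w - D l u w) <= e * \prod_(i < l) vnorm X (w i)].

End Maps.

Definition has_bounded_inverse (R : realType) (X : nspace R)
    (A : vcar X -> vcar X) : Prop :=
  exists B : vcar X -> vcar X,
  [/\ forall y, vmem X y -> vmem X (B y) /\ A (B y) = y,
   forall x, vmem X x -> vmem X (A x) /\ B (A x) = x &
   exists M : R, forall y, vmem X y -> vnorm X (B y) <= M * vnorm X y].

Section PeriodicSpaces.
Variables (R : realType) (n : nat).
Implicit Types v : R -> 'rV[R]_n.

Definition Cper_mem (k : nat) : set (R -> 'rV[R]_n) :=
  [set v | [/\ forall t, v (t + 1) = v t,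
     forall j t, (j < k)%N -> derivable (derive1n j v) t 1 &
     continuous (derive1n k v : R -> 'rV[R]_n)]].

Definition Cper_norm (k : nat) v : R :=
  sup [set `|derive1n j v t| | j in [set j | (j <= k)%N] & t in `[0, 1]].

Definition Lip v : R :=
  sup [set y | exists s t : R, s != t /\ y = `|v s - v t| / `|s - t|].

Definition Cper (k : nat) : nspace R :=
  @NSpace R (R -> 'rV[R]_n) (Cper_mem k) (Cper_norm k).

Definition CperLip (k : nat) : nspace R :=
  @NSpace R (R -> 'rV[R]_n)
    [set v | Cper_mem k v /\ exists K : R, K.-lipschitz (derive1n k v)]
    (fun v => Num.max (Cper_norm k v) (Lip (derive1n k v))).

Definition shift_fun (t : R) v : R -> 'rV[R]_n := fun s => v (t + s).

End PeriodicSpaces.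

Section Operators.
Variables (R : realType) (ny nmu : nat).

Definition Xsp (l : nat) : nspace R := prod_ns (Cper R ny l) (euclid R nmu).

Definition extend_ns (S : nspace R) : nspace R :=
  prod_ns (prod_ns S (euclid R ny)) (euclid R nmu).

Definition Ce (k : nat) : nspace R := extend_ns (Cper R ny k).
Definition CeLip (k : nat) : nspace R := extend_ns (CperLip R ny k).

Notation fn := (R -> 'rV[R]_ny).
Notation ext := ((R -> 'rV[R]_ny) * 'rV[R]_ny * 'rV[R]_nmu)%type.

(* Only the values of G on C^0_pi x R^nmu matter. *)
Definition mildly_differentiable (lmax : nat)
    (G : fn * 'rV[R]_nmu -> 'rV[R]_ny) : Prop :=
  forall l, (l <= lmax)%N ->
  exists D : forall j, fn * 'rV[R]_nmu -> ('I_j -> fn * 'rV[R]_nmu) ->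
      'rV[R]_ny,
    @is_Ck_family R (Xsp l) (euclid R ny) G l D /\
    ((1 <= l)%N ->
     exists E : (fn * 'rV[R]_nmu) * (fn * 'rV[R]_nmu) -> 'rV[R]_ny,
       @ns_continuous R (prod_ns (Xsp l) (Xsp l.-1)) (euclid R ny) E /\
       forall u d, vmem (Xsp l) u -> vmem (Xsp l) d ->
         E (u, d) = D l u (fun _ => d)).

Definition gop (G : fn * 'rV[R]_nmu -> 'rV[R]_ny)
    (Raff : fn * 'rV[R]_nmu -> 'rV[R]_nmu) (x : ext) : ext :=
  let: (v, alpha, mu) := x in
  (fun t => G (shift_fun t v, mu), alpha, mu + Raff (v, mu)).

Definition fpart (t : R) : R := t - (Num.floor t)%:~R.

Definition vint (w : fn) (t : R) : 'rV[R]_ny :=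
  \row_i \int[lebesgue_measure]_(s in `[0, t]) (w s 0 i).

Definition Lop (x : ext) : ext :=
  let: (w, alpha, nu) := x in
  (fun t => alpha + vint w (fpart t) - fpart t *: vint w 1,
   alpha + vint w 1, nu).

Definition Phi G Raff (x : ext) : ext := Lop (gop G Raff x).

Definition is_ext_deriv (F : ext -> ext) (x : ext) (A : ext -> ext) : Prop :=
  [/\ @ns_linear R (Ce 0) (Ce 0) A, @ns_continuous R (Ce 0) (Ce 0) A &
   @is_frechet R (Ce 1) (Ce 0) F x A].

(* On C^0_e such an extension is unique, C^1_e being dense; its values outside
   C^0_e are irrelevant. *)
Definition ext_deriv (F : ext -> ext) (x : ext) : ext -> ext :=
  xget (fun=> 0) (is_ext_deriv F x).

Definition DPhi G Raff (x dx : ext) : ext := Lop (ext_deriv (gop G Raff) x dx).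

End Operators.

Section Collocation.
Variables (R : realType) (ny nmu m : nat) (tc : 'I_m -> R).

Definition lagrange_poly (j : 'I_m) : {poly R} :=
  \prod_(k < m | k != j) ((tc j - tc k)^-1 *: ('X - (tc k)%:P)).

Lemma size_lagrange_poly j : (size (lagrange_poly j) <= m)%N.
Proof.
apply: leq_trans (size_poly_prod_leq _ _) _.
have card_k : #|[pred k : 'I_m | k != j]| = m.-1 by rewrite cardC1 card_ord.
have m0 : (0 < m)%N by exact: leq_ltn_trans (ltn_ord j).
rewrite card_k leq_subLR.
have -> : (m.-1 + m = (m.-1 * 2).+1)%N.
  by case: (m) m0 => // k _; rewrite muln2 -addnn addnS.
rewrite ltnS -card_k -sum_nat_const; apply: leq_sum => k _.
by rewrite (leq_trans (size_scale_leq _ _)) ?size_XsubC.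
Qed.

Lemma lagrange_poly_node j k :
  injective tc -> (lagrange_poly j).[tc k] = (j == k)%:R.
Proof.
move=> tc_inj; rewrite horner_prod; case: eqVneq => [<-|jk].
  rewrite big1 // => i ij; rewrite hornerZ hornerXsubC mulVf //.
  by rewrite subr_eq0 inj_eq // eq_sym.
by rewrite (bigD1 k) 1?eq_sym //= hornerZ hornerXsubC subrr mulr0 mul0r.
Qed.

(* The mesh points are tm 0, ..., tm L. The values of the interpolant at the
   mesh points themselves are immaterial and set to 0. *)
Definition PL (L : nat) (tm : nat -> R) (z : R -> 'rV[R]_ny) :
    R -> 'rV[R]_ny :=
  fun t => \sum_(i < L) \sum_(j < m)
    (\1_(`]tm i, tm i.+1[) (fpart t) *
     (lagrange_poly j).[(fpart t - tm i) / (tm i.+1 - tm i)]) *: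
    z (tm i + (tm i.+1 - tm i) * tc j).

Definition PLe (L : nat) (tm : nat -> R)
    (x : (R -> 'rV[R]_ny) * 'rV[R]_ny * 'rV[R]_nmu) :=
  (PL L tm x.1.1, x.1.2, x.2).

Definition PhiL G Raff (L : nat) (tm : nat -> R)
    (x : (R -> 'rV[R]_ny) * 'rV[R]_ny * 'rV[R]_nmu) :
    (R -> 'rV[R]_ny) * 'rV[R]_ny * 'rV[R]_nmu :=
  Lop (PLe L tm (gop G Raff x)).

End Collocation.

Definition is_mesh (R : realType) (L : nat) (Cmsh : R) (tm : nat -> R) : Prop :=
  [/\ tm 0%N = 0, tm L = 1 &
   forall i, (i < L)%N -> tm i < tm i.+1 /\ tm i.+1 - tm i <= Cmsh / L%:R].

(* Main.v *)
(** Consistency. The extension of the l-th derivative of G accepts directions that are one order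
    less smooth than its base point, so w(t) = G(v_t, mu) has uniform Taylor expansions of
    order l whenever v is C^l and l <= lmax. A converse of Taylor's theorem makes w a C^l
    function, so xs is of class C^(lmax + 1); the expansions also give
    |P_L w - w| = O(L^-min(lmax, m)).

    Stability. Lop gains one derivative and C^{0,1} embeds compactly in C^0, so DPhi(xs) is a limit
    of finite-rank operators and I - DPhi(xs) obeys the Fredholm alternative. Continuity of the
    extended first derivative E(u, d) in (u, d) is uniform in d on the precompact unit ball of
    C^{0,1}. Hence Phi_L(x) - Phi_L(y) is close to DPhi(xs)(x - y) relative to |x - y|_{0,1} for
    x, y near xs and L large, and x |-> x - (I - DPhi(xs))^-1 (x - Phi_L x) is a
    1/2-contraction of a ball around xs whose displacement at xs is the consistency error. *)

Require Import Defs.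
From mathcomp Require Import all_boot all_order all_algebra.
From mathcomp Require Import all_classical all_reals all_analysis.
From mathcomp Require Import measurable_realfun ring lra.
Import Order.TTheory GRing.Theory Num.Theory.
Import numFieldNormedType.Exports.
Local Open Scope classical_set_scope.
Local Open Scope ring_scope.

Set Implicit Arguments.
Unset Strict Implicit.
Unset Printing Implicit Defensive.

(** * Calculus for vector-valued functions *)

(** The obstacle is that [gop] is not known to be differentiable where the discretization lives.
    Interpolants jump at the mesh points, so [PhiL] reaches no further than C^{0,1}, while
    derivatives of G are only given at C^1 base points. Moreover the curve t -> v_t is merely
    continuous in C^k when v is C^k, so the chain rule does not apply to G (v_t, mu).
    Differentiation in t is therefore traded for expansion: v_(t+s) - v_t is expanded in a space
    with fewer derivatives, which only the extended derivatives tolerate. Differentiation at C^{0,1}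
    points is traded for a two-point difference estimate around the smooth point xs, proved between
    C^1 points and carried over by averaging. All estimates must be uniform in the phase t; this
    comes from compactness of the circle. Compactness of the embedding enters through explicit
    finite-rank approximations, so no subsequence is ever extracted. The mesh points form a
    countable set, hence every integral bound below admits a countable exceptional set. *)

Section RowNorm.
Variables (R : realType) (n : nat).
Implicit Types v : 'rV[R]_n.

Lemma coord_le_norm v i : `|v 0 i| <= `|v|.
Proof.
by rewrite [leRHS]/Num.Def.normr/= mx_normrE; exact: (le_bigmax _ _ (ord0, i)).
Qed.

Lemma norm_le_coord v e : 0 <= e -> (forall i, `|v 0 i| <= e) -> `|v| <= e.
Proof.
move=> e0 h; rewrite [leLHS]/Num.Def.normr/= mx_normrE (bigmax_le _ e0)//.
by move=> [i j] _; rewrite /= (ord1 i).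
Qed.

End RowNorm.

Section Calculus.
Variables (R : realType).

Lemma ler_addgt0 (x y : R) : (forall e, 0 < e -> x <= y + e) -> x <= y.
Proof. by move=> h; apply/ler_addgt0Pr => e e0; exact: h. Qed.

(** Differentiability on the whole line with explicit moduli. The inequality is multiplied by [|h|],
    so it also makes sense at h = 0 and no quotient has to be formed. *)
Definition has_deriv (V : normedModType R) (f f' : R -> V) :=
  forall t (e : R), 0 < e -> exists2 d : R, 0 < d &
    forall h, `|h| < d -> `|f (t + h) - f t - h *: f' t| <= e * `|h|.

Lemma hasd_is_derive (V : normedModType R) (f f' : R -> V) :
  has_deriv f f' <-> forall t : R, is_derive t 1 f (f' t).
Proof.
have aux (h : R) (a b : V) : h != 0 ->
    `|b - h^-1 *: a| = `|h|^-1 * `|a - h *: b|.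
  move=> h0; rewrite -normfV -normrZ scalerBr scalerA mulVf// scale1r.
  by rewrite distrC.
split=> [H t|H t e e0].
- suff H1 : h^-1 *: ((f \o shift t) (h *: 1) - f t) @[h --> 0^'] --> f' t.
    apply: DeriveDef; first by apply/cvg_ex; exists (f' t).
    exact/cvg_lim.
  apply/cvgrPdist_le => e e0; have [d d0 Hd] := H t e e0.
  near=> h.
  have h0 : h != 0 by near: h; exact: nbhs_dnbhs_neq.
  have hd : `|h| < d by near: h; exact: dnbhs0_lt.
  rewrite /= aux// -ler_pdivlMl ?invr_gt0 ?normr_gt0// invrK.
  by rewrite [_%:A]mulr1 (addrC h t) mulrC; exact: Hd.
- have [/cvg_ex[l Hl] /= El] := H t.
  have {El} El : l = f' t by rewrite -El; apply/esym/cvg_lim.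
  move/cvgrPdist_le : Hl => /(_ _ e0); rewrite El => -[d /= d0 Hd].
  exists d => // h hd.
  have [->|h0] := eqVneq h 0.
    by rewrite addr0 subrr scale0r subr0 !normr0 mulr0.
  have := Hd h; rewrite /= sub0r normrN => /(_ hd h0).
  rewrite aux// -ler_pdivlMl ?invr_gt0 ?normr_gt0// invrK.
  by rewrite [_%:A]mulr1 (addrC h t) mulrC.
Unshelve. all: by end_near. Qed.

Lemma hasd_derive1 (V : normedModType R) (f f' : R -> V) :
  has_deriv f f' -> derive1 f = f'.
Proof.
move=> /hasd_is_derive h; apply/funext => t; rewrite derive1E.
by have [] := h t.
Qed.

Lemma hasd_derivable (V : normedModType R) (f : R -> V) :
  (forall t : R, derivable f t 1) <-> has_deriv f (derive1 f).
Proof.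
split=> [h|/hasd_is_derive h t]; last by have [] := h t.
by apply/hasd_is_derive => t; rewrite derive1E; apply: derivableP.
Qed.

Variable n : nat.
Implicit Types f g : R -> 'rV[R]_n.

Lemma hasd_coord f f' (i : 'I_n) : has_deriv f f' ->
  forall t : R, is_derive t 1 (fun t => f t 0 i : R) (f' t 0 i).
Proof.
move=> hf; apply/(hasd_is_derive (V := R^o)) => t e e0.
have [d d0 h] := hf t e e0; exists d => // s sd.
by apply: le_trans (h s sd); rewrite -[X in _ <= X]/(`|_|) ;
   have := coord_le_norm (f (t + s) - f t - s *: f' t) i; rewrite !mxE.
Qed.

(** In the maximum norm the scalar mean value theorem may be used coordinate by coordinate, each
    with its own intermediate point. The segment is parametrized by [0, 1] so that h may have either
    sign. *)
Lemma mvt_le f f' (s h : R) b e : has_deriv f f' -> 0 <= e ->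
  (forall x, 0 <= x <= 1 -> `|f' (s + x * h) - b| <= e) ->
  `|f (s + h) - f s - h *: b| <= e * `|h|.
Proof.
move=> hf e0 H; apply: norm_le_coord => [|i]; first by rewrite mulr_ge0.
have cf (a c : R) : {within `[a, c], continuous (fun t => f t 0 i : R)}.
  apply/continuous_subspaceT => t.
  by apply/differentiable_continuous/derivable1_diffP; have [] := hasd_coord i hf t.
rewrite !mxE.
have fin t : 0 <= (t - s) / h <= 1 -> h != 0 -> `|f' t 0 i - b 0 i| <= e.
  move=> /H /[swap] h0; rewrite divfK// (addrC s) subrK; apply: le_trans.
  by have := coord_le_norm (f' t - b) i; rewrite !mxE.
have [->|h0] := eqVneq h 0.
  by rewrite addr0 subrr mul0r subr0 normr0 mulr0.
have [hp|hn] := leP 0 h.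
  have {}hp : 0 < h by rewrite lt_def h0.
  have sh : s <= s + h by rewrite lerDl ltW.
  have [c] := MVT_segment sh (fun x _ => hasd_coord i hf x) (cf _ _).
  rewrite in_itv /= => /andP[c1 c2] ->.
  have -> : s + h - s = h by ring.
  rewrite mulrC -mulrBr normrM mulrC ler_wpM2r//; apply: fin => //.
  rewrite ler_pdivrMr// ler_pdivlMr//; apply/andP; split; lra.
have sh : s + h <= s by lra.
have [c] := MVT_segment sh (fun x _ => hasd_coord i hf x) (cf _ _).
rewrite in_itv /= => /andP[c1 c2] E.
have -> : f (s + h) 0 i + - f s 0 i + - (h * b 0 i) = h * (f' c 0 i - b 0 i).
  by move: E; rewrite /= => E; lra.
rewrite normrM mulrC ler_wpM2r//; apply: fin => //.
rewrite ler_ndivrMr// ler_ndivlMr//; apply/andP; split; lra.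
Qed.

End Calculus.

Section VectorCalculus.
Variables (R : realType) (n : nat).
Local Notation V := 'rV[R]_n.

Lemma hasd_ext (g g' f f' : R -> V) : has_deriv g g' ->
  (forall t, f t = g t) -> (forall t, f' t = g' t) -> has_deriv f f'.
Proof. by move=> h /funext -> /funext ->. Qed.

Lemma hasd_lin (f f' g g' : R -> V) (a : R) :
  has_deriv f f' -> has_deriv g g' ->
  has_deriv (fun t => a *: f t + g t) (fun t => a *: f' t + g' t).
Proof.
move=> hf hg t e e0.
have a1 : 0 < `|a| + 1 by rewrite ltr_pwDr.
have [d1 d10 h1] := hf t (e / 2 / (`|a| + 1)) ltac:(by rewrite !divr_gt0).
have [d2 d20 h2] := hg t (e / 2) ltac:(by rewrite divr_gt0).
exists (Num.min d1 d2); first by rewrite lt_min d10.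
move=> h; rewrite lt_min => /andP[/h1 k1 /h2 k2].
have -> : a *: f (t + h) + g (t + h) - (a *: f t + g t) - h *: (a *: f' t + g' t)
   = a *: (f (t + h) - f t - h *: f' t) + (g (t + h) - g t - h *: g' t).
  by apply/rowP => i; rewrite !mxE; ring.
apply: le_trans (ler_normD _ _) _; rewrite normrZ.
have : `|a| * `|f (t + h) - f t - h *: f' t| <= e / 2 * `|h|.
  apply: le_trans (ler_wpM2l _ k1) _ => //.
  rewrite mulrA ler_wpM2r// mulrA ler_pdivrMr// mulrC.
  by rewrite ler_pM2l ?divr_gt0// lerDl.
by lra.
Qed.

Lemma hasd_cst (b : V) : has_deriv (fun=> b) (fun=> 0).
Proof.
move=> t e e0; exists 1 => // h _.
by rewrite scaler0 subrr subr0 normr0 mulr_ge0// ltW.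
Qed.

Lemma hasd_sum (N : nat) (f f' : 'I_N -> R -> V) :
  (forall i, has_deriv (f i) (f' i)) ->
  has_deriv (fun t => \sum_(i < N) f i t) (fun t => \sum_(i < N) f' i t).
Proof.
elim: N f f' => [|N IH] f f' H.
  by apply: (hasd_ext (@hasd_cst 0)) => t; rewrite big_ord0.
have := hasd_lin 1 (H ord0) (IH (fun i => f (lift ord0 i)) (fun i => f' (lift ord0 i)) (fun i => H _)).
by move=> /hasd_ext; apply => t; rewrite big_ord_recl scale1r.
Qed.

Lemma hasd_scalev (g g' : R -> R) (b : V) :
  (forall t : R, is_derive t 1 g (g' t)) ->
  has_deriv (fun t => g t *: b) (fun t => g' t *: b).
Proof.
move=> /(hasd_is_derive (V := R^o)) H t e e0.
have b1 : 0 < `|b| + 1 by rewrite ltr_pwDr.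
have [d d0 h1] := H t (e / (`|b| + 1)) ltac:(by rewrite divr_gt0).
exists d => // h /h1 k1.
rewrite scalerA -!scalerBl normrZ.
apply: le_trans (ler_wpM2r _ k1) _ => //.
rewrite mulrAC ler_wpM2r// mulrAC ler_pdivrMr// ler_pM2l// lerDl //.
Qed.

Lemma hasd_monom (b : V) p :
  has_deriv (fun t => t ^+ p.+1 *: b) (fun t => (p.+1%:R * t ^+ p) *: b).
Proof.
apply: hasd_scalev => t.
have -> : (fun t : R => t ^+ p.+1) = id ^+ p.+1 by apply/funext => x; rewrite exprfctE.
have := @is_deriveX _ R id p.+1 t 1 1 (is_derive_id _ _).
by rewrite [X in is_derive _ _ _ X]mulr1.
Qed.

Lemma hasd_affine (f f' : R -> V) (a s : R) :
  has_deriv f f' -> has_deriv (fun x => f (a + x * s)) (fun x => s *: f' (a + x * s)).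
Proof.
move=> hf t e e0.
have s1 : 0 < `|s| + 1 by rewrite ltr_pwDr.
have [d d0 h1] := hf (a + t * s) (e / (`|s| + 1)) ltac:(by rewrite divr_gt0).
exists (d / (`|s| + 1)); first by rewrite divr_gt0.
move=> h; rewrite ltr_pdivlMr// => hd.
have /h1 : `|h * s| < d.
  rewrite normrM; apply: le_lt_trans hd; rewrite ler_wpM2l// lerDl//.
rewrite scalerA mulrDl addrA => /le_trans; apply.
rewrite normrM (_ : e / _ * _ = e * `|h| * (`|s| / (`|s| + 1))); last by ring.
by rewrite ler_piMr ?mulr_ge0 ?(ltW e0)// ler_pdivrMr// mul1r lerDl.
Qed.

Lemma hasd_cont (f f' : R -> V) : has_deriv f f' -> continuous f.
Proof.
move=> /hasd_is_derive H t.
by apply/differentiable_continuous/derivable1_diffP; have [] := H t.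
Qed.

Lemma continuous_epsP (f : R -> V) : continuous f <->
  forall t (e : R), 0 < e -> exists2 d : R, 0 < d &
    forall h, `|h| < d -> `|f (t + h) - f t| <= e.
Proof.
split=> [H t e e0|H t].
  have /cvgrPdist_le/(_ e e0)[d /= d0 Hd] := H t.
  exists d => // h hd; rewrite distrC; apply: Hd => /=.
  by rewrite opprD addNKr normrN.
apply/cvgrPdist_le => e e0; have [d d0 Hd] := H t e e0.
exists d => //= s /=; rewrite distrC => /Hd; rewrite distrC.
by rewrite (addrC t) subrK.
Qed.

(** Compactness of [0, 1] in the form used throughout: local moduli, valid for all nearby points and
    all smaller values, combine into one modulus. *)
Lemma unif01 (P : R -> R -> Prop) :
  (forall t, exists2 d : R, 0 < d & forall t' d', `|t' - t| < d ->
     0 < d' < d -> P d' t') ->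
  exists2 d : R, 0 < d & forall t, 0 <= t <= 1 -> P d t.
Proof.
move=> H.
have /compact_near_coveringP := @segment_compact R 0 1.
have C (x : R) : `[0, 1]%classic x -> \forall x' \near x & i \near (0 : R)^'+, P i x'.
  move=> _; have [d d0 Hd] := H x.
  exists ([set y | `|y - x| < d], [set i | 0 < i < d]) => /=; last first.
    by move=> [y i] /= [y1 i1]; exact: Hd.
  split.
    by exists d => //= y /=; rewrite distrC.
  exists d => //= y /=; rewrite sub0r normrN => yd y0.
  by rewrite y0; apply: le_lt_trans yd; exact: ler_norm.
move=> /(_ _ (0 : R)^'+ P _ C) [d /= d0 Hd].
exists (d / 2); first by rewrite divr_gt0.
move=> t t01; have d2 : 0 < d / 2 by rewrite divr_gt0.
have bd : `|0 - d / 2| < d by rewrite sub0r normrN gtr0_norm//; lra.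
by apply: (Hd (d / 2) bd d2); rewrite /= in_itv.
Qed.

(** The remainder is controlled by the oscillation of the last derivative, so no derivative of order
    N + 1 is needed. Induction on N: the derivative of the remainder of [D] is the remainder of the
    shifted family, and [mvt_le] integrates it. The gain 1 / N! is given away. *)
Lemma taylor_le N (D : nat -> R -> 'rV[R]_n) e x :
  (forall j, (j < N)%N -> has_deriv (D j) (D j.+1)) -> 0 <= x <= 1 ->
  (forall th, 0 <= th <= x -> `|D N th - D N 0| <= e) ->
  `|D 0%N x - \sum_(p < N.+1) (x ^+ p / p`!%:R) *: D p 0| <= e.
Proof.
elim: N D x => [|N IH] D x hD /andP[x0 x1] He.
  by rewrite big_ord_recr big_ord0 /= add0r expr0 fact0 divr1 scale1r He// x0 lexx.
pose f t := D 0%N t - \sum_(p < N.+2) (t ^+ p / p`!%:R) *: D p 0.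
pose f' t := D 1%N t - \sum_(p < N.+1) (t ^+ p / p`!%:R) *: D p.+1 0.
have e0 : 0 <= e.
  by have := He 0 ltac:(by rewrite lexx); rewrite subrr normr0.
have hf : has_deriv f f'.
  have h1 : has_deriv (fun t => \sum_(p < N.+2) (t ^+ p / p`!%:R) *: D p 0)
              (fun t => 0 + \sum_(p < N.+1) (t ^+ p / p`!%:R) *: D p.+1 0).
    have E t : \sum_(p < N.+2) (t ^+ p / p`!%:R) *: D p 0 =
       1 *: D 0%N 0 + \sum_(p < N.+1) (t ^+ p.+1 / p.+1`!%:R) *: D p.+1 0.
      by rewrite big_ord_recl expr0 fact0 divr1.
    apply: (hasd_ext (g := fun t => 1 *: D 0%N 0 + \sum_(p < N.+1) (t ^+ p.+1 / p.+1`!%:R) *: D p.+1 0)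
       (g' := fun t => 1 *: 0 + \sum_(p < N.+1) (t ^+ p / p`!%:R) *: D p.+1 0)) => //.
      apply: hasd_lin; first exact: hasd_cst.
      apply: hasd_sum => i.
      apply: (hasd_ext (hasd_monom (i.+1`!%:R^-1 *: D i.+1 0) i)) => t.
        by rewrite scalerA.
      rewrite scalerA; congr (_ *: _).
      rewrite factS natrM invfM.
      have ? : (i.+1%:R : R) != 0 by rewrite pnatr_eq0.
      have ? : (i`!%:R : R) != 0 by rewrite pnatr_eq0 -lt0n fact_gt0.
      by field; apply/andP.
    by move=> t; rewrite scaler0.
  have := hasd_lin (-1) h1 (hD 0%N isT).
  move=> /hasd_ext; apply => t; first by rewrite scaleN1r addrC.
  by rewrite scaleN1r add0r addrC.
have f0 : f 0 = 0.
  rewrite /f big_ord_recl /= expr0 fact0 divr1 scale1r big1 ?addr0 ?subrr// => i _.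
  by rewrite /= /bump add1n expr0n /= mul0r scale0r.
have := @mvt_le R n f f' 0 x 0 e hf e0.
rewrite add0r f0 scaler0 !subr0 => /(_ _)/le_trans -> //.
  move=> t /andP[t0 t1]; rewrite subr0 add0r; apply: (IH (fun j => D j.+1)).
  - by move=> j jN; apply: hD.
  - by rewrite mulr_ge0// mulr_ile1.
  - move=> th /andP[th0 thx]; apply: He; rewrite th0 (le_trans thx)//.
    by rewrite ler_piMl.
by rewrite ger0_norm// ler_piMr.
Qed.

End VectorCalculus.

(** * Lagrange interpolation and vector-valued polynomial functions *)

Section Interpolation.
Variables (R : realType) (n : nat) (tau : 'I_n -> R).
Hypothesis tau_inj : injective tau.

Lemma lagrange_interp (p : {poly R}) : (size p <= n)%N ->
  p = \sum_k p.[tau k] *: lagrange_poly tau k.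
Proof.
move=> sp; apply/eqP; rewrite -subr_eq0; apply/eqP.
apply: (@roots_geq_poly_eq0 _ _ [seq tau k | k <- enum 'I_n]).
- apply/allP => _ /mapP[k _ ->]; rewrite rootE hornerD hornerN horner_sum.
  rewrite (bigD1 k)//= hornerZ lagrange_poly_node// eqxx mulr1 big1 ?addr0 ?subrr//.
  by move=> i ik; rewrite hornerZ lagrange_poly_node// (negPf ik) mulr0.
- by rewrite map_inj_uniq ?enum_uniq.
- rewrite size_map size_enum_ord; apply: leq_trans (size_polyD _ _) _.
  rewrite geq_max sp size_polyN; apply: leq_trans (size_sum _ _ _) _.
  apply/bigmax_leqP => k _; apply: leq_trans (size_scale_leq _ _) _.
  exact: size_lagrange_poly.
Qed.

(** The inverse of the Vandermonde matrix: its entries are the coefficients of the Lagrange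
    polynomials, so it acts on coefficients from any module. *)
Lemma coef_interp (V : lmodType R) (c : nat -> V) q : (q < n)%N ->
  c q = \sum_k (lagrange_poly tau k)`_q *: \sum_(p < n) tau k ^+ p *: c p.
Proof.
move=> qn.
under eq_bigr do rewrite scaler_sumr.
rewrite exchange_big /= (bigD1 (Ordinal qn))//= [X in _ + X]big1.
  rewrite addr0; under eq_bigr do rewrite scalerA.
  rewrite -scaler_suml.
  have /(congr1 (fun p : {poly R} => p`_q)) := @lagrange_interp ('X^q) ltac:(by rewrite size_polyXn).
  rewrite coefXn eqxx coef_sum => E.
  rewrite -[LHS]scale1r -[1]/(true%:R) E; congr (_ *: _).
  by apply: eq_bigr => k _; rewrite coefZ hornerXn mulrC.
move=> p pq; under eq_bigr do rewrite scalerA.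
rewrite -scaler_suml.
have /(congr1 (fun p : {poly R} => p`_q)) := @lagrange_interp ('X^p) ltac:(by rewrite size_polyXn).
rewrite coefXn coef_sum => E.
have -> : \sum_k (lagrange_poly tau k)`_q * tau k ^+ p = (q == p)%:R.
  by rewrite E; apply: eq_bigr => k _; rewrite coefZ hornerXn mulrC.
have -> : (q == p) = false by apply: contraNF pq => /eqP E'; apply/eqP/val_inj.
by rewrite scale0r.
Qed.

(** Equivalence of norms on polynomials of degree less than n, with the sum of the absolute entries
    of the inverse Vandermonde matrix as constant. It turns bounds at finitely many nodes into
    bounds on coefficients. *)
Lemma coef_bound (d : nat) : exists2 C : R, 0 <= C &
  forall (c : nat -> 'rV[R]_d) eta,
    (forall k, `|\sum_(p < n) tau k ^+ p *: c p| <= eta) ->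
    forall q, (q < n)%N -> `|c q| <= C * eta.
Proof.
exists (\sum_(q < n) \sum_k `|(lagrange_poly tau k)`_q|).
  by apply: sumr_ge0 => q _; apply: sumr_ge0.
move=> c eta H q qn; rewrite (coef_interp c qn).
have eta0 : 0 <= eta.
  by apply: le_trans (H (Ordinal qn)).
apply: le_trans (ler_norm_sum _ _ _) _.
apply: (@le_trans _ _ (\sum_k `|(lagrange_poly tau k)`_q| * eta)).
  by apply: ler_sum => k _; rewrite normrZ ler_wpM2l.
rewrite -mulr_suml ler_wpM2r// [leRHS](bigD1 (Ordinal qn))//= lerDl.
by apply: sumr_ge0 => i _; apply: sumr_ge0.
Qed.

End Interpolation.

Section PolyFun.
Variables (R : realType) (d : nat).
Implicit Types f g : R -> 'rV[R]_d.

Definition polyfun n f := exists c : nat -> 'rV[R]_d,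
  forall s, f s = \sum_(q < n) s ^+ q *: c q.

Lemma natr_ord_inj n : injective (fun k : 'I_n => (k : nat)%:R : R).
Proof. by move=> i j /eqP; rewrite eqr_nat => /eqP/val_inj. Qed.

Lemma polyfun_lin n f g (a : R) : polyfun n f -> polyfun n g ->
  polyfun n (fun s => a *: f s + g s).
Proof.
move=> [c hc] [c' hc']; exists (fun q => a *: c q + c' q) => s.
rewrite hc hc' scaler_sumr -big_split /=; apply: eq_bigr => q _.
by rewrite scalerDr !scalerA mulrC.
Qed.

Lemma polyfun0 n : polyfun n (fun=> 0).
Proof. by exists (fun=> 0) => s; rewrite big1// => q _; rewrite scaler0. Qed.

Lemma polyfun_sum n N (f : 'I_N -> R -> 'rV[R]_d) : (forall i, polyfun n (f i)) ->
  polyfun n (fun s => \sum_(i < N) f i s).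
Proof.
elim: N f => [|N IH] f H.
  by rewrite (_ : (fun s => _) = fun=> 0); [exact: polyfun0|apply/funext => s; rewrite big_ord0].
rewrite (_ : (fun s => _) = fun s => 1 *: f ord0 s + \sum_(i < N) f (lift ord0 i) s).
  by apply: polyfun_lin => //; apply: IH => i; exact: H.
by apply/funext => s; rewrite big_ord_recl scale1r.
Qed.

Lemma polyfun_widen n m f : (n <= m)%N -> polyfun n f -> polyfun m f.
Proof.
move=> nm [c hc]; exists (fun q => if (q < n)%N then c q else 0) => s.
rewrite hc (big_ord_widen m (fun q => s ^+ q *: c q) nm) big_mkcond /=.
by apply: eq_bigr => q _; case: ifP => //; rewrite scaler0.
Qed.

Lemma polyfun_mul n p f : polyfun n f -> polyfun (n + p) (fun s => s ^+ p *: f s).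
Proof.
move=> [c hc]; exists (fun q => if (p <= q)%N then c (q - p)%N else 0) => s.
rewrite addnC big_split_ord /= big1 ?add0r.
  by rewrite hc scaler_sumr; apply: eq_bigr => q _;
    rewrite leq_addr addKn scalerA exprD.
by move=> q _; rewrite leqNgt ltn_ord /= scaler0.
Qed.

(** The only candidate is the polynomial interpolating f at 0, ..., n - 1. It agrees with f at any
    further s because the approximants are determined by their values at these nodes. *)
Lemma polyfun_lim n f :
  (forall (S : seq R) (e : R), 0 < e -> exists2 g, polyfun n g &
     forall s, s \in S -> `|f s - g s| <= e) -> polyfun n f.
Proof.
move=> H.
pose tau (k : 'I_n) : R := (k : nat)%:R.
exists (fun q => \sum_k (lagrange_poly tau k)`_q *: f (tau k)) => s.
apply/eqP; rewrite -subr_eq0 -normr_le0; apply/ler_addgt0 => e e0; rewrite add0r.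
pose K := \sum_k \sum_(q < n) `|s ^+ q * (lagrange_poly tau k)`_q|.
have K0 : 0 <= K by apply: sumr_ge0 => k _; apply: sumr_ge0.
have e1 : 0 < e / (K + 1) by rewrite divr_gt0// ltr_pwDr.
(* The approximant is chosen after s: it only has to be close to f at s and at the nodes. *)
have [g [c hc] hg] := H (s :: [seq tau k | k <- enum 'I_n]) _ e1.
have -> : f s - \sum_(q < n) s ^+ q *: \sum_k (lagrange_poly tau k)`_q *: f (tau k)
  = (f s - g s) - \sum_(q < n) \sum_k (s ^+ q * (lagrange_poly tau k)`_q) *: (f (tau k) - g (tau k)).
  have -> : g s = \sum_(q < n) \sum_k (s ^+ q * (lagrange_poly tau k)`_q) *: g (tau k).
    rewrite hc; apply: eq_bigr => q _.
    rewrite (coef_interp (@natr_ord_inj n) c (ltn_ord q)) scaler_sumr; apply: eq_bigr => k _.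
    by rewrite scalerA hc.
  rewrite -addrA -opprD -big_split /=; congr (_ - _); apply: eq_bigr => q _.
  rewrite -big_split scaler_sumr /=; apply: eq_bigr => k _.
  by rewrite scalerA -scalerDr addrC subrK.
apply: le_trans (ler_normB _ _) _.
apply: (@le_trans _ _ (e / (K + 1) + K * (e / (K + 1)))).
  rewrite lerD ?hg ?mem_head//.
  rewrite exchange_big /= /K mulr_suml; apply: le_trans (ler_norm_sum _ _ _) _.
  apply: ler_sum => k _; rewrite mulr_suml; apply: le_trans (ler_norm_sum _ _ _) _.
  apply: ler_sum => q _; rewrite normrZ ler_wpM2l// hg//.
  by rewrite inE; apply/orP; right; apply: map_f; rewrite mem_enum.
have -> : e / (K + 1) + K * (e / (K + 1)) = e * ((K + 1) / (K + 1)) by ring.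
by rewrite divff ?mulr1// gt_eqF// ltr_pwDr.
Qed.

End PolyFun.

(** * Normed subspaces, contractions and the Fredholm alternative *)

Record normed (R : realType) (X : nspace R) : Prop := Normed {
  mem0 : vmem X 0;
  mem_lin : forall (a : R) u v, vmem X u -> vmem X v -> vmem X (a *: u + v);
  nsZ : forall (a : R) u, vmem X u -> vnorm X (a *: u) = `|a| * vnorm X u;
  nsD : forall u v, vmem X u -> vmem X v ->
    vnorm X (u + v) <= vnorm X u + vnorm X v;
  ns_eq0 : forall u, vmem X u -> vnorm X u = 0 -> u = 0 }.

Section NormedSpaces.
Variables (R : realType) (X : nspace R).
Hypothesis hX : normed X.
Implicit Types u v : vcar X.

Lemma memD u v : vmem X u -> vmem X v -> vmem X (u + v).
Proof. by move=> mu mv; rewrite -(scale1r u); exact: mem_lin. Qed.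

Lemma memZ a u : vmem X u -> vmem X (a *: u).
Proof. by move=> mu; rewrite -(addr0 (a *: u)); apply: mem_lin => //; exact: mem0. Qed.

Lemma memN u : vmem X u -> vmem X (- u).
Proof. by move=> mu; rewrite -scaleN1r; exact: memZ. Qed.

Lemma memB u v : vmem X u -> vmem X v -> vmem X (u - v).
Proof. by move=> mu mv; apply: memD => //; exact: memN. Qed.

Lemma mem_sum (I : finType) (f : I -> vcar X) : (forall i, vmem X (f i)) ->
  vmem X (\sum_i f i).
Proof. by move=> H; apply: big_ind => // [|u v]; [exact: mem0|exact: memD]. Qed.

Lemma ns0 : vnorm X 0 = 0.
Proof. by rewrite -(scaler0 _ 0) (nsZ hX)// ?normr0 ?mul0r//; exact: mem0. Qed.

Lemma nsN u : vmem X u -> vnorm X (- u) = vnorm X u.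
Proof. by move=> mu; rewrite -scaleN1r (nsZ hX)// normrN1 mul1r. Qed.

Lemma ns_ge0 u : vmem X u -> 0 <= vnorm X u.
Proof.
move=> mu; have := nsD hX mu (memN mu).
rewrite subrr ns0 nsN//; lra.
Qed.

Lemma ns_distC u v : vmem X u -> vmem X v -> vnorm X (u - v) = vnorm X (v - u).
Proof. by move=> mu mv; rewrite -(opprB v u) nsN//; exact: memB. Qed.

Lemma ns_dist_trans w u v : vmem X u -> vmem X v -> vmem X w ->
  vnorm X (u - v) <= vnorm X (u - w) + vnorm X (w - v).
Proof.
by move=> mu mv mw; rewrite -{1}(subrK w u) -addrA; apply: nsD => //; exact: memB.
Qed.

Lemma ns_sum (I : finType) (f : I -> vcar X) : (forall i, vmem X (f i)) ->
  vnorm X (\sum_i f i) <= \sum_i vnorm X (f i).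
Proof.
move=> H; suff [] : vmem X (\sum_i f i) /\ vnorm X (\sum_i f i) <= \sum_i vnorm X (f i) by [].
elim/big_rec2 : _ => [|i x y _ [m1 h1]]; first by rewrite ns0; split => //; exact: mem0.
split; first by apply: memD.
by apply: le_trans (nsD hX _ _) _ => //; rewrite lerD2l.
Qed.

Lemma ns_dist_le0 u v : vmem X u -> vmem X v ->
  (forall e, 0 < e -> vnorm X (u - v) <= e) -> u = v.
Proof.
move=> mu mv H; apply/eqP; rewrite -subr_eq0; apply/eqP/(ns_eq0 hX); first exact: memB.
apply/eqP; rewrite eq_le ns_ge0 ?andbT; last exact: memB.
by apply/ler_addgt0 => e /H; rewrite add0r.
Qed.

End NormedSpaces.

Section LinearMaps.
Variables (R : realType) (X Y : nspace R) (A : vcar X -> vcar Y).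
Hypotheses (hX : normed X) (hY : normed Y) (hA : ns_linear A).
Implicit Types u v : vcar X.

Lemma lin0 : A 0 = 0.
Proof.
have m0 := mem0 hX; have := hA 1 m0 m0; rewrite !scale1r addr0 => /eqP.
by rewrite -subr_eq0 opprD addrA subrr sub0r oppr_eq0 => /eqP.
Qed.

Lemma linD u v : vmem X u -> vmem X v -> A (u + v) = A u + A v.
Proof. by move=> mu mv; rewrite -{1}(scale1r u) hA// scale1r. Qed.

Lemma linZ a u : vmem X u -> A (a *: u) = a *: A u.
Proof. by move=> mu; have m0 := mem0 hX; rewrite -{1}(addr0 (a *: u)) hA// lin0 addr0. Qed.

Lemma linN u : vmem X u -> A (- u) = - A u.
Proof. by move=> mu; rewrite -scaleN1r linZ// scaleN1r. Qed.

Lemma linB u v : vmem X u -> vmem X v -> A (u - v) = A u - A v.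
Proof. by move=> mu mv; rewrite linD ?linN//; exact: memN. Qed.

Lemma lin_sum (I : finType) (f : I -> vcar X) : (forall i, vmem X (f i)) ->
  A (\sum_i f i) = \sum_i A (f i).
Proof.
move=> H; suff [] : vmem X (\sum_i f i) /\ A (\sum_i f i) = \sum_i A (f i) by [].
elim/big_rec2 : _ => [|i x y _ [m1 <-]]; first by rewrite lin0; split => //; exact: mem0.
by split; [exact: memD|rewrite linD].
Qed.

Lemma lin_bounded : ns_continuous A ->
  exists2 M, 0 <= M & forall u, vmem X u -> vnorm Y (A u) <= M * vnorm X u.
Proof.
move=> [mA cA]; have [d d0 Hd] := cA 0 (mem0 hX) 1 ltr01.
exists (2 / d) => [|u mu]; first by rewrite divr_ge0// ltW.
have [u0|u0] := eqVneq (vnorm X u) 0.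
  by rewrite (ns_eq0 hX mu u0) lin0 (ns0 hX) (ns0 hY) mulr0.
have up : 0 < vnorm X u by rewrite lt_def u0 (ns_ge0 hX).
pose k := d / 2 / vnorm X u.
have k0 : 0 < k by rewrite !divr_gt0.
have kN : k * vnorm X u = d / 2 by rewrite divfK.
have := Hd (k *: u) (memZ hX _ mu).
rewrite subr0 (nsZ hX)// gtr0_norm// kN lin0 subr0 linZ//.
rewrite (nsZ hY); last exact: mA.
rewrite gtr0_norm//.
have dd : d / 2 < d by lra.
move=> /(_ dd)/ltW h; rewrite -(ler_pM2l k0) (le_trans h)//.
rewrite mulrCA kN (_ : 2 / d * (d / 2) = 1)//.
by field; rewrite gt_eqF.
Qed.

End LinearMaps.

Section Products.
Variables (R : realType).

Lemma normed_euclid n : normed (euclid R n).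
Proof.
split=> //= [a u _|u v _ _|u _]; [exact: normrZ|exact: ler_normD|].
by move/eqP; rewrite normr_eq0 => /eqP.
Qed.

Lemma normed_prod (X Y : nspace R) : normed X -> normed Y -> normed (prod_ns X Y).
Proof.
move=> hX hY; split.
- by split; exact: mem0.
- by move=> a u v [mu1 mu2] [mv1 mv2]; split; exact: mem_lin.
- by move=> a u [mu1 mu2]; rewrite /= (nsZ hX)// (nsZ hY)// maxr_pMr.
- move=> u v [mu1 mu2] [mv1 mv2] /=; rewrite ge_max; apply/andP; split.
    by apply: le_trans (nsD hX mu1 mv1) _; rewrite lerD// le_max lexx.
  by apply: le_trans (nsD hY mu2 mv2) _; rewrite lerD// le_max lexx orbT.
- move=> [u1 u2] [/= mu1 mu2] h.
  have h1 : vnorm X u1 <= 0 by rewrite -h le_max lexx.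
  have h2 : vnorm Y u2 <= 0 by rewrite -h le_max lexx orbT.
  have E1 : u1 = 0.
    by apply: (ns_eq0 hX mu1); apply/eqP; rewrite eq_le h1 (ns_ge0 hX).
  have E2 : u2 = 0.
    by apply: (ns_eq0 hY mu2); apply/eqP; rewrite eq_le h2 (ns_ge0 hY).
  by move: mu1 mu2 h h1 h2; rewrite E1 E2.
Qed.

End Products.

(** Completeness for geometrically convergent sequences, which is what a contraction with factor 1/2
    produces. The limit comes with the tail bound 2 C / 2^k of the geometric series. *)
Definition ns_complete (R : realType) (X : nspace R) :=
  forall (x : nat -> vcar X) (C : R), (forall k, vmem X (x k)) ->
  (forall k, vnorm X (x k.+1 - x k) <= C / 2 ^+ k) ->
  exists2 y, vmem X y & forall k, vnorm X (x k - y) <= 2 * C / 2 ^+ k.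

Lemma exp2_small (R : realType) (C e : R) : 0 < e ->
  exists k : nat, C / 2 ^+ k <= e.
Proof.
move=> e0; have [k hk] : exists k : nat, C / e < k%:R.
  by exists (Num.truncn `|C / e|).+1; apply: le_lt_trans (ler_norm _) (truncnS_gt _).
exists k; rewrite ler_pdivrMr ?exprn_gt0// mulrC -ler_pdivrMr//.
apply: le_trans (ltW hk) _.
by rewrite -natrX ler_nat ltnW// ltn_expl.
Qed.

Section Contraction.
Variables (R : realType) (X : nspace R).
Hypotheses (hX : normed X) (cX : ns_complete X).

(** Banach's theorem in a closed ball. A displacement of at most r/2 together with the factor 1/2
    makes the ball invariant; the bound on the distance from c will turn a residual into an error
    estimate. *)
Lemma ns_contraction (F : vcar X -> vcar X) c (r : R) : vmem X c ->
  (forall x, ns_ball c r x -> vmem X (F x)) ->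
  (forall x y, ns_ball c r x -> ns_ball c r y ->
     vnorm X (F x - F y) <= 2^-1 * vnorm X (x - y)) ->
  0 <= r -> vnorm X (F c - c) <= r / 2 ->
  exists x, [/\ ns_ball c r x, F x = x,
    vnorm X (x - c) <= 2 * vnorm X (F c - c) &
    forall y, ns_ball c r y -> F y = y -> x = y].
Proof.
move=> mc mF cF r0 Fc.
have bc : ns_ball c r c by split => //; rewrite subrr (ns0 hX).
pose x k := iter k F c.
have Fr y : ns_ball c r y -> ns_ball c r (F y).
  move=> by_; split; first exact: mF.
  have [my yr] := by_.
  apply: le_trans (ns_dist_trans hX (w := F c) _ _ _) _ => //; try exact: mF.
  apply: le_trans (lerD (cF _ _ by_ bc) Fc) _.
  lra.
have bx k : ns_ball c r (x k) by elim: k => [|k IH] //=; exact: Fr.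
have mx k : vmem X (x k) by have [] := bx k.
set eta := vnorm X (F c - c).
have xx k : vnorm X (x k.+1 - x k) <= eta / 2 ^+ k.
  elim: k => [|k IH]; first by rewrite expr0 divr1.
  apply: le_trans (cF _ _ (bx k.+1) (bx k)) _.
  rewrite exprS invfM mulrCA ler_pM2l ?invr_gt0//.
have [y my hy] := cX mx xx.
have yc : vnorm X (y - c) <= 2 * eta.
  by have := hy 0%N; rewrite expr0 divr1 (ns_distC hX) //.
have by_ : ns_ball c r y by split => //; apply: le_trans yc _; rewrite /eta; lra.
have Fy : F y = y.
  apply: (ns_dist_le0 hX) => //; first exact: mF.
  move=> e e0; have [k hk] := exp2_small (2 * eta) e0.
  apply: le_trans hk; apply: le_trans (ns_dist_trans hX (w := x k.+1) _ _ _) _ => //.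
    exact: mF.
  apply: le_trans (lerD (cF _ _ by_ (bx k)) (hy k.+1)) _.
  have := hy k; rewrite (ns_distC hX)// exprS invfM => h.
  have := h; have -> : 2 * eta * (2^-1 / 2 ^+ k) = 2^-1 * (2 * eta / 2 ^+ k) by rewrite mulrCA.
  move: (vnorm X (y - x k)) (2 * eta / 2 ^+ k); move=> a b; lra.
exists y; split => // z bz Fz; have [mz _] := bz.
apply: (ns_dist_le0 hX) => // e e0; apply: le_trans (ltW e0).
have := cF _ _ by_ bz; rewrite Fy Fz; lra.
Qed.

End Contraction.

(* K is the contractive part of T and J inverts I - K, so x = y + T x reduces to a linear system
   with matrix 1 - N for the coefficients f q x. *)
Section Fredholm.
Variables (R : realType) (X : nspace R).
Hypotheses (hX : normed X) (cX : ns_complete X).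
Variables (T : vcar X -> vcar X) (n : nat) (f : 'I_n -> vcar X -> R)
  (e : 'I_n -> vcar X) (Cf : R).
Hypotheses (mT : forall x, vmem X x -> vmem X (T x)) (lT : ns_linear T).
Hypotheses (me : forall q, vmem X (e q))
  (lf : forall q a u v, vmem X u -> vmem X v -> f q (a *: u + v) = a * f q u + f q v)
  (bf : forall q u, vmem X u -> `|f q u| <= Cf * vnorm X u).
Hypothesis small : forall x, vmem X x ->
  vnorm X (T x - \sum_q f q x *: e q) <= 2^-1 * vnorm X x.
Hypothesis injT : forall x, vmem X x -> x - T x = 0 -> x = 0.

Let K x := T x - \sum_q f q x *: e q.

Let mF x : vmem X (\sum_q f q x *: e q).
Proof. by apply: mem_sum => // q; exact: memZ. Qed.

Let mK x : vmem X x -> vmem X (K x).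
Proof. by move=> mx; apply: memB => //; exact: mT. Qed.

Let lK : @ns_linear R X X K.
Proof.
move=> a u v mu mv; rewrite /K lT// scalerBr addrACA; congr (_ + _).
rewrite scaler_sumr -!sumrN -big_split /=; apply: eq_bigr => q _.
by rewrite lf// scalerDl scalerA opprD.
Qed.

(** The Neumann series, summed by the contraction x -> y + K x. The displacement of 0 is y, whence
    the radius 2 |y| + 1. *)
Let neumann y : vmem X y -> exists x, vmem X x /\ x = y + K x.
Proof.
move=> my; pose r := 2 * vnorm X y + 1.
have y0 := ns_ge0 hX my.
have [||||x [[mx _] Fx _ _]] := @ns_contraction R X hX cX (fun x => y + K x) 0 r (mem0 hX).
- by move=> x [mx _]; apply: memD => //; exact: mK.
- move=> x z [mx _] [mz _].
  rewrite opprD addrACA subrr add0r -(linB hX lK)//; apply: small.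
  exact: memB.
- by rewrite /r; lra.
- by rewrite (lin0 hX lK) addr0 subr0 /r; lra.
by exists x; split.
Qed.

Let J y : vcar X := xget 0 [set x | vmem X x /\ x = y + K x].

Let JP y : vmem X y -> vmem X (J y) /\ J y = y + K (J y).
Proof. by move=> my; have [x hx] := neumann my; apply: (@xgetPex _ _ [set x | vmem X x /\ x = y + K x]); exists x. Qed.

Let Juniq x y : vmem X x -> vmem X y -> x = y + K x -> x = J y.
Proof.
move=> mx my E; have [mJ EJ] := JP my.
apply: (ns_dist_le0 hX) => // d d0; apply: le_trans (ltW d0).
have : x - J y = K (x - J y).
  by rewrite (linB hX lK)// {1}E {1}EJ opprD addrACA subrr add0r.
move=> /(congr1 (vnorm X)) E'.
have := small (memB hX mx mJ); rewrite -/(K _) -E'; lra.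
Qed.

Let lJ : @ns_linear R X X J.
Proof.
move=> a u v mu mv; have [mJu Eu] := JP mu; have [mJv Ev] := JP mv.
apply/esym/Juniq; try exact: mem_lin.
by rewrite lK// {1}Eu {1}Ev scalerDr addrACA.
Qed.

Let bJ y : vmem X y -> vnorm X (J y) <= 2 * vnorm X y.
Proof.
move=> my; have [mJ EJ] := JP my.
have := nsD hX my (mK mJ); rewrite -EJ.
have := small mJ; rewrite -/(K _); lra.
Qed.

Let f0 q : f q 0 = 0.
Proof. by have := lf q 1 (mem0 hX) (mem0 hX); rewrite scale1r addr0 mul1r; lra. Qed.

Let fD q u v : vmem X u -> vmem X v -> f q (u + v) = f q u + f q v.
Proof. by move=> mu mv; rewrite -{1}(scale1r u) lf// mul1r. Qed.

Let fZ q a u : vmem X u -> f q (a *: u) = a * f q u.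
Proof. by move=> mu; rewrite -{1}(addr0 (a *: u)) lf ?f0 ?addr0//; exact: mem0. Qed.

Let f_sum q N (g : 'I_N -> vcar X) : (forall i, vmem X (g i)) ->
  f q (\sum_(i < N) g i) = \sum_(i < N) f q (g i).
Proof.
elim: N g => [|N IH] g H; first by rewrite !big_ord0 f0.
by rewrite !big_ord_recl fD ?IH//; apply: mem_sum.
Qed.

Let N : 'M[R]_n := \matrix_(p, q) f q (J (e p)).

Let mJe p : vmem X (J (e p)).
Proof. by have [] := JP (me p). Qed.

Let comb (c : 'rV[R]_n) := \sum_p c 0 p *: J (e p).

Let mcomb c : vmem X (comb c).
Proof. by apply: mem_sum => // p; exact: memZ. Qed.

Let fcomb c q : f q (comb c) = (c *m N) 0 q.
Proof.
rewrite /comb f_sum; last by move=> p; exact: memZ.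
by rewrite mxE; apply: eq_bigr => p _; rewrite fZ// mxE.
Qed.

Let combE c : comb c - K (comb c) = \sum_p c 0 p *: e p.
Proof.
rewrite /comb (lin_sum hX lK); last by move=> p; exact: memZ.
rewrite -sumrB; apply: eq_bigr => p _; rewrite (linZ hX lK)// -scalerBr.
by have [_ {1}->] := JP (me p); rewrite addrK.
Qed.

(** A row c with c = c N makes [comb c] a solution of x = T x. Injectivity gives [comb c] = 0, and
    then c vanishes because its entries are the values of the functionals [f q] at [comb c]. *)
Let Nunit : (1%:M - N) \in unitmx.
Proof.
rewrite -row_free_unit -kermx_eq0; apply/rowV0P => c /sub_kermxP.
rewrite mulmxBr mulmx1 => /eqP; rewrite subr_eq0 => /eqP cN.
have x0 : comb c = 0.
  apply: injT => //.
  have -> : T (comb c) = K (comb c) + \sum_q f q (comb c) *: e q by rewrite /K subrK.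
  under eq_bigr do rewrite fcomb -cN.
  by rewrite opprD addrA combE subrr.
by apply/rowP => q; rewrite mxE cN -fcomb x0 f0.
Qed.

(** Rewriting x = y + T x as x = J y + sum_q f_q(x) J(e_q) shows that the row c of the numbers
    f_q(x) must satisfy c = f(J y) + c N. Solving for c defines the inverse [B]. *)
Lemma fredholm : @has_bounded_inverse R X (fun x => x - T x).
Proof.
pose fv x : 'rV[R]_n := \row_q f q x.
pose c y := fv (J y) *m invmx (1%:M - N).
pose B y := J y + comb (c y).
have mB y : vmem X y -> vmem X (B y).
  by move=> my; apply: memD => //; have [] := JP my.
have cE y : c y = fv (J y) + c y *m N.
  apply/eqP; rewrite -subr_eq; apply/eqP.
  rewrite -[X in X - _](mulmx1 (c y)) -mulmxBr /c -mulmxA mulVmx ?mulmx1//.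
have AB y : vmem X y -> B y - T (B y) = y.
  move=> my; have [mJ EJ] := JP my.
  have fB q : f q (B y) = c y 0 q.
    by rewrite fD// fcomb {2}cE !mxE.
  have -> : T (B y) = K (B y) + \sum_q f q (B y) *: e q by rewrite /K subrK.
  under eq_bigr do rewrite fB.
  rewrite /B (linD lK)// -combE -(addrA (K _)) (addrC (K (comb _))) subrK.
  by rewrite opprD addrACA subrr addr0 {1}EJ addrK.
exists B; split.
- by move=> y my; split; [exact: mB|exact: AB].
- move=> x mx.
  have mA : vmem X (x - T x) by apply: memB => //; exact: mT.
  (* That the right inverse is also a left inverse follows from injectivity, since both sides have
     the same image. *)
  split => //; apply/eqP; rewrite -subr_eq0; apply/eqP; apply: injT.
    by apply: memB => //; exact: mB.
  have mz := mB _ mA.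
  rewrite (linB hX lT)//.
  have -> : B (x - T x) - x - (T (B (x - T x)) - T x) = B (x - T x) - T (B (x - T x)) - (x - T x).
    by rewrite !opprD addrACA.
  by rewrite AB// subrr.
- pose D := \sum_p \sum_q `|invmx (1%:M - N) q p|.
  exists (2 + \sum_p (\sum_q `|invmx (1%:M - N) q p| * (`|Cf| * 2)) * vnorm X (J (e p))) => y my.
  have [mJ _] := JP my.
  apply: le_trans (nsD hX mJ (mcomb _)) _.
  rewrite mulrDl lerD ?bJ// mulr_suml.
  apply: le_trans (ns_sum hX _) _; first by move=> p; exact: memZ.
  apply: ler_sum => p _; rewrite (nsZ hX)// mulrAC ler_wpM2r ?(ns_ge0 hX)//.
  rewrite mxE; apply: le_trans (ler_norm_sum _ _ _) _.
  rewrite mulr_suml; apply: ler_sum => q _; rewrite normrM mulrC -mulrA ler_wpM2l// mxE.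
  apply: le_trans (bf _ mJ) _; rewrite -mulrA.
  apply: (@le_trans _ _ (`|Cf| * vnorm X (J y))).
    by rewrite ler_wpM2r ?(ns_ge0 hX)// ler_norm.
  by rewrite ler_wpM2l// bJ.
Qed.

End Fredholm.

Lemma half_gt0 (R : realType) (e : R) : 0 < e -> 0 < e / 2.
Proof. by move=> e0; rewrite divr_gt0. Qed.

(** * Periodic function spaces *)

Section Periodic.
Variables (R : realType).

Lemma fpart_ge0 (t : R) : 0 <= fpart t.
Proof. by rewrite subr_ge0 floor_le. Qed.

Lemma fpart_lt1 (t : R) : fpart t < 1.
Proof. by rewrite ltrBlDl -[X in _ + X]/(1%:~R) -intrD floorD1_gt. Qed.

Definition periodic1 (T : Type) (v : R -> T) := forall t, v (t + 1) = v t.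

Lemma periodic_int (T : Type) (v : R -> T) : periodic1 v ->
  forall (k : int) t, v (t + k%:~R) = v t.
Proof.
move=> pv.
have pn (k : nat) t : v (t + k%:R) = v t.
  by elim: k t => [|k IH] t; rewrite ?addr0// -natr1 addrA pv IH.
by move=> [k|k] t; rewrite ?NegzE ?mulrNz -?pmulrn// -(pn k.+1 (t - k.+1%:R)) subrK.
Qed.

Lemma periodic_fpart (T : Type) (v : R -> T) t : periodic1 v -> v (fpart t) = v t.
Proof. by move=> pv; rewrite /fpart -mulrNz; exact: periodic_int. Qed.

Lemma unif_per (P : R -> R -> Prop) : (forall d, periodic1 (P d)) ->
  (forall t, exists2 d : R, 0 < d & forall t' d', `|t' - t| < d ->
     0 < d' < d -> P d' t') ->
  exists2 d : R, 0 < d & forall t, P d t.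
Proof.
move=> pP /unif01[d d0 H]; exists d => // t.
by rewrite -(periodic_fpart t (pP d)); apply: H; rewrite fpart_ge0 ltW// fpart_lt1.
Qed.

End Periodic.

Section CperSpaces.
Variables (R : realType) (n : nat).
Local Notation V := 'rV[R]_n.
Implicit Types v : R -> V.

Lemma derive1_shift v s : derive1 (shift_fun s v) = shift_fun s (derive1 v).
Proof.
apply/funext => t; rewrite /derive1 /shift_fun.
by under eq_fun do rewrite addrCA.
Qed.

Lemma derive1n_shift v s j : derive1n j (shift_fun s v) = shift_fun s (derive1n j v).
Proof.
elim: j => [|j IH]; first by rewrite !derive1n0.
by rewrite !derive1nS IH derive1_shift.
Qed.

Lemma periodic1P v : periodic1 v <-> shift_fun 1 v = v.
Proof.
split=> [h|h t]; first by apply/funext => t; rewrite /shift_fun addrC h.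
by rewrite -[in RHS]h /shift_fun addrC.
Qed.

Lemma derive1n_per v j : periodic1 v -> periodic1 (derive1n j v).
Proof. by move=> /periodic1P pv; apply/periodic1P; rewrite -derive1n_shift pv. Qed.

(** The standard way to prove membership below: a candidate list of derivatives is checked with
    [has_deriv], and [derive1n] is identified at the same time. *)
Lemma Cper_introP k v (D : nat -> R -> V) : D 0%N = v -> periodic1 v ->
  (forall j, (j < k)%N -> has_deriv (D j) (D j.+1)) -> continuous (D k) ->
  Cper_mem k v /\ forall j, (j <= k)%N -> derive1n j v = D j.
Proof.
move=> D0 pv hD cD.
have E j : (j <= k)%N -> derive1n j v = D j.
  elim: j => [|j IH] jk; first by rewrite derive1n0.
  by rewrite derive1nS IH ?(ltnW jk)//; apply/hasd_derive1/hD.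
split => //; split => //.
  by move=> j t jk; rewrite (E _ (ltnW jk)); have /hasd_is_derive/(_ t)[] := hD _ jk.
by rewrite E.
Qed.

Lemma Cper_hasd k v j : Cper_mem k v -> (j < k)%N ->
  has_deriv (derive1n j v) (derive1n j.+1 v).
Proof. by move=> [_ h _] jk; rewrite derive1nS; apply/hasd_derivable => t; exact: h. Qed.

Lemma Cper_continuous k v j : Cper_mem k v -> (j <= k)%N -> continuous (derive1n j v).
Proof.
move=> mv; rewrite leq_eqVlt => /predU1P[->|jk]; first by have [] := mv.
by apply: hasd_cont; exact: Cper_hasd mv jk.
Qed.

Lemma Cper_periodic k v : Cper_mem k v -> periodic1 v.
Proof. by case. Qed.

Lemma Cper_le k j v : (j <= k)%N -> Cper_mem k v -> Cper_mem j v.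
Proof.
move=> jk mv.
refine (proj1 (@Cper_introP j v (fun i => derive1n i v) erefl (Cper_periodic mv) _ _)).
  by move=> i ij; apply: Cper_hasd mv _; exact: leq_trans jk.
exact: Cper_continuous mv jk.
Qed.

Lemma periodic_bounded v : periodic1 v -> continuous v ->
  exists2 M : R, 0 <= M & forall t, `|v t| <= M.
Proof.
move=> pv /continuous_epsP cv.
(* Boundedness is phrased as a uniform modulus: a valid d yields the bound 1/d. *)
have [||d d0 H] := @unif_per R (fun d t => `|v t| <= d^-1).
- by move=> d t; rewrite pv.
- move=> t; have [d d0 Hd] := cv t 1 ltr01.
  have N0 : 0 < `|v t| + 1 by rewrite ltr_pwDr.
  exists (Num.min d (`|v t| + 1)^-1); first by rewrite lt_min d0 invr_gt0.
  move=> t' d'; rewrite !lt_min => /andP[td _] /and3P[d'0 d1 d2].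
  rewrite -(subrK (v t) (v t')); apply: le_trans (ler_normD _ _) _.
  apply: le_trans (_ : `|v t| + 1 <= _).
    by rewrite addrC lerD2l; have := Hd _ td; rewrite (addrC t) subrK.
  by rewrite -[leLHS]invrK lef_pV2 ?posrE ?invr_gt0// ltW.
by exists d^-1 => //; rewrite invr_ge0 ltW.
Qed.

Lemma periodic_unif v : periodic1 v -> continuous v ->
  forall e, 0 < e -> exists2 d : R, 0 < d & forall t h, `|h| < d -> `|v (t + h) - v t| <= e.
Proof.
move=> pv /continuous_epsP cv e e0.
have [||d d0 H] := @unif_per R (fun d t => forall h, `|h| < d -> `|v (t + h) - v t| <= e).
- by move=> d t; apply/propext; split => H h /H; rewrite addrAC !pv.
- move=> t; have [d d0 Hd] := cv t (e / 2) (half_gt0 e0).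
  exists (d / 2); first by rewrite divr_gt0.
  move=> t' d' td /andP[d'0 d'd] h hd.
  have -> : v (t' + h) - v t' = (v (t + (t' - t + h)) - v t) - (v (t + (t' - t)) - v t).
    by rewrite addrA !(addrC t) !subrK opprB addrA subrK.
  apply: le_trans (ler_normB _ _) _; rewrite [e]splitr lerD// Hd//; last by lra.
  by apply: le_lt_trans (ler_normD _ _) _; lra.
by exists d.
Qed.

Lemma Cper_bounded k v : Cper_mem k v ->
  exists2 M, 0 <= M & forall j t, (j <= k)%N -> `|derive1n j v t| <= M.
Proof.
move=> mv.
have /choice[M HM] : forall j : 'I_k.+1, exists M : R, 0 <= M /\ forall t, `|derive1n j v t| <= M.
  move=> j; have [|M M0 H] := periodic_bounded (derive1n_per j (Cper_periodic mv)) _.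
    by apply: Cper_continuous mv _; rewrite -ltnS.
  by exists M.
exists (\sum_j M j); first by apply: sumr_ge0 => j _; have [] := HM j.
move=> j t jk; rewrite -ltnS in jk; rewrite (bigD1 (Ordinal jk))//=.
apply: le_trans ((HM (Ordinal jk)).2 t) _; rewrite lerDl.
by apply: sumr_ge0 => i _; have [] := HM i.
Qed.

Lemma le_Cper_norm k v j t : Cper_mem k v -> (j <= k)%N ->
  `|derive1n j v t| <= Cper_norm k v.
Proof.
move=> mv jk; rewrite -(periodic_fpart t (derive1n_per j (Cper_periodic mv))).
have [M _ HM] := Cper_bounded mv.
apply: ub_le_sup; first by exists M => _ [i ik [s _ <-]]; exact: HM.
by exists j => //; exists (fpart t) => //=; rewrite in_itv /= fpart_ge0 ltW// fpart_lt1.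
Qed.

Lemma Cper_norm_le k v M :
  (forall j t, (j <= k)%N -> `|derive1n j v t| <= M) -> Cper_norm k v <= M.
Proof.
move=> H; apply: ge_sup => [|_ [j jk [t _ <-]]]; last exact: H.
exists `|derive1n 0 v 0|; exists 0%N => //; exists 0 => //.
by rewrite /= in_itv /= lexx ler01.
Qed.

Lemma Cper_linP k (a : R) u v : Cper_mem k u -> Cper_mem k v ->
  Cper_mem k (a *: u + v) /\ forall j, (j <= k)%N ->
    derive1n j (a *: u + v) = a *: derive1n j u + derive1n j v.
Proof.
move=> mu mv; apply: (Cper_introP (D := fun j => a *: derive1n j u + derive1n j v)) => //.
- move=> t; rewrite !fctE /= (Cper_periodic mu) (Cper_periodic mv)//.
- by move=> j jk; apply: hasd_lin; [exact: Cper_hasd mu jk|exact: Cper_hasd mv jk].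
- move=> t; apply: cvgD; first by apply: cvgZr; exact: (Cper_continuous mu (leqnn k)).
  exact: (Cper_continuous mv (leqnn k)).
Qed.

Lemma derive1n_cst (b : V) j : derive1n j.+1 (cst b : R -> V) = 0.
Proof.
elim: j => [|j IH]; last by rewrite derive1nS IH; apply/hasd_derive1/(hasd_cst 0).
by rewrite derive1n1; apply/hasd_derive1/hasd_cst.
Qed.

Lemma Cper_cst k (b : V) : Cper_mem k (cst b).
Proof.
refine (proj1 (@Cper_introP k (cst b) (fun j => if j is 0%N then cst b else 0) erefl _ _ _)) => //.
  by move=> [|j] _; exact: hasd_cst.
by case: k => [|k]; exact: cst_continuous.
Qed.

Lemma Cper_shift k v s : Cper_mem k v -> Cper_mem k (shift_fun s v).
Proof.
move=> mv.
refine (proj1 (@Cper_introP k (shift_fun s v) (fun j => shift_fun s (derive1n j v)) erefl _ _ _)).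
- by move=> t; rewrite /shift_fun addrA (Cper_periodic mv).
- move=> j jk t e e0; have [d d0 Hd] := Cper_hasd mv jk (s + t) e0.
  by exists d => // h hd; rewrite /shift_fun addrA; exact: Hd.
- apply/continuous_epsP => t e e0.
  have [d d0 Hd] := (continuous_epsP _).1 (Cper_continuous mv (leqnn k)) (s + t) e e0.
  by exists d => // h hd; rewrite /shift_fun addrA; exact: Hd.
Qed.

Lemma Cper_norm_shift k v s : Cper_mem k v -> Cper_norm k (shift_fun s v) = Cper_norm k v.
Proof.
have H s' v' : Cper_mem k v' -> Cper_norm k (shift_fun s' v') <= Cper_norm k v'.
  move=> mv; apply: Cper_norm_le => j t jk; rewrite derive1n_shift.
  exact: le_Cper_norm.
move=> mv; apply/eqP; rewrite eq_le H//=.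
have {1}-> : v = shift_fun (- s) (shift_fun s v).
  by apply/funext => t; rewrite /shift_fun addNKr.
by apply: H; exact: Cper_shift.
Qed.

Lemma normed_Cper k : normed (Cper R n k).
Proof.
split.
- exact: (Cper_cst k 0).
- by move=> a u v mu mv; have [] := Cper_linP a mu mv.
- move=> a u mu /=.
  (* One inequality is enough: applied to a^-1 and a *: u it gives the converse. *)
  have H (b : R) (u' : R -> V) : Cper_mem k u' -> Cper_norm k (b *: u') <= `|b| * Cper_norm k u'.
    move=> mu'; apply: Cper_norm_le => j t jk.
    have [_ /(_ j jk)] := Cper_linP b mu' (Cper_cst k 0).
    rewrite addr0 => ->; rewrite !fctE.
    have -> : derive1n j (cst (0 : V)) t = 0.
      by case: j jk => // j _; rewrite derive1n_cst.
    by rewrite addr0 normrZ ler_wpM2l// le_Cper_norm.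
  apply/eqP; rewrite eq_le H//=.
  have [->|a0] := eqVneq a 0.
    rewrite normr0 mul0r scale0r.
    by apply: le_trans (le_Cper_norm 0 (Cper_cst k 0) (leq0n k)); rewrite normr_ge0.
  have {1}-> : u = a^-1 *: (a *: u) by rewrite scalerA mulVf// scale1r.
  have [mau _] := Cper_linP a mu (Cper_cst k 0); rewrite addr0 in mau.
  rewrite -ler_pdivlMl ?normr_gt0//; apply: le_trans (H _ _ mau) _.
  by rewrite normfV.
- move=> u v mu mv /=; apply: Cper_norm_le => j t jk.
  have [_ /(_ j jk)] := Cper_linP 1 mu mv; rewrite !scale1r => ->; rewrite !fctE.
  exact: (le_trans (ler_normD (derive1n j u t) (derive1n j v t))
    (lerD (le_Cper_norm t mu jk) (le_Cper_norm t mv jk))).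
- move=> u mu /= u0; apply/funext => t; apply/eqP; rewrite -normr_le0 -u0.
  exact: (le_Cper_norm t mu (leq0n k)).
Qed.

Lemma Cper_derive k j i v : (i + j <= k)%N -> Cper_mem k v -> Cper_mem i (derive1n j v) /\
  forall i', derive1n i' (derive1n j v) = derive1n (i' + j) v.
Proof.
move=> ijk mv.
have E i' : derive1n i' (derive1n j v) = derive1n (i' + j) v.
  by rewrite /derive1n iterD.
split => //; refine (proj1 (@Cper_introP i (derive1n j v) (fun i' => derive1n (i' + j) v) erefl _ _ _)).
- by apply: derive1n_per; exact: Cper_periodic mv.
- by move=> i' ii; apply: (Cper_hasd mv); apply: leq_trans ijk; rewrite ltn_add2r.
- exact: (Cper_continuous mv ijk).
Qed.

(** Each derivative up to order k is uniformly continuous. Strong continuity of translations is all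
    the regularity that t -> v_t has in C^k. *)
Lemma Cper_shift_cont k v : Cper_mem k v -> forall e, 0 < e ->
  exists2 d : R, 0 < d & forall t h, `|h| < d ->
    Cper_norm k (shift_fun (t + h) v - shift_fun t v) <= e.
Proof.
move=> mv e e0.
have /choice[d Hd] : forall j : 'I_k.+1, exists d : R, 0 < d /\
    forall t h, `|h| < d -> `|derive1n j v (t + h) - derive1n j v t| <= e.
  move=> j; have jk : (j <= k)%N by rewrite -ltnS.
  have [d d0 H] := periodic_unif (derive1n_per j (Cper_periodic mv)) (Cper_continuous mv jk) e0.
  by exists d.
exists (\big[Num.min/1]_j d j).
  by apply: lt_bigmin => // j _; have [] := Hd j.
move=> t h hd; apply: Cper_norm_le => j s jk.
have -> : shift_fun (t + h) v - shift_fun t v = (-1) *: shift_fun t v + shift_fun (t + h) v.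
  by rewrite scaleN1r addrC.
have [_ ->//] := Cper_linP (-1) (Cper_shift t mv) (Cper_shift (t + h) mv).
rewrite !derive1n_shift !fctE scaleN1r addrC /shift_fun.
rewrite addrAC; rewrite -ltnS in jk; apply: ((Hd (Ordinal jk)).2 (t + s) h).
apply: lt_le_trans hd _; exact: bigmin_le.
Qed.

Lemma Cper_taylor k v : Cper_mem k v -> forall e, 0 < e ->
  exists2 d : R, 0 < d & forall t s, `|s| < d ->
    `|v (t + s) - \sum_(p < k.+1) (s ^+ p / p`!%:R) *: derive1n p v t| <= e * `|s| ^+ k.
Proof.
move=> mv e e0.
have [d d0 Hd] := periodic_unif (derive1n_per k (Cper_periodic mv)) (Cper_continuous mv (leqnn k)) e0.
exists d => // t s sd.
(* The segment from t to t + s is rescaled to [0, 1]; the factors s^j come from the chain rule, and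
   both signs of s are treated at once. *)
pose D j x := s ^+ j *: derive1n j v (t + x * s).
have E0 : v (t + s) = D 0%N 1 by rewrite /D expr0 scale1r mul1r.
have -> : \sum_(p < k.+1) (s ^+ p / p`!%:R) *: derive1n p v t =
   \sum_(p < k.+1) (1 ^+ p / p`!%:R) *: D p 0.
  by apply: eq_bigr => p _; rewrite scalerA expr1n mul1r mul0r addr0 mulrC.
rewrite E0; apply: taylor_le.
- move=> j jk.
  have /(hasd_affine t s) h := Cper_hasd mv jk.
  have := hasd_lin (s ^+ j) h (@hasd_cst R n 0).
  move=> /hasd_ext; apply => x; first by rewrite addr0.
  by rewrite addr0 scalerA -exprSr.
- by rewrite ler01 lexx.
- move=> x /andP[x0 x1]; rewrite -scalerBr normrZ normrX mulrC ler_wpM2r ?exprn_ge0//.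
  rewrite mul0r addr0; apply: Hd; apply: le_lt_trans sd.
  by rewrite normrM (ger0_norm x0) ler_piMl.
Qed.

End CperSpaces.

(** * Completeness, and the space C^{0,1} *)

Section Completeness.
Variables (R : realType).

Lemma small_tail n (z : 'rV[R]_n) (C : R) : (forall k, `|z| <= C / 2 ^+ k) -> z = 0.
Proof.
move=> H; apply/eqP; rewrite -normr_le0; apply/ler_addgt0 => e e0; rewrite add0r.
by have [k hk] := exp2_small C e0; apply: le_trans (H k) hk.
Qed.

Lemma complete_row n (x : nat -> 'rV[R]_n) (C : R) :
  (forall k, `|x k.+1 - x k| <= C / 2 ^+ k) ->
  exists y, forall k, `|x k - y| <= 2 * C / 2 ^+ k.
Proof.
move=> H.
have C0 : 0 <= C by have := H 0%N; rewrite expr0 divr1; apply: le_trans.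
(* The subtracted term makes the geometric tail bound strong enough for induction on j. *)
have T k j : `|x (k + j)%N - x k| <= 2 * C / 2 ^+ k - 2 * C / 2 ^+ (k + j).
  elim: j => [|j IH]; first by rewrite addn0 !subrr normr0.
  rewrite addnS -(subrK (x (k + j)%N) (x (k + j).+1)) -addrA.
  apply: le_trans (ler_normD _ _) _.
  have := H (k + j)%N; rewrite exprS invfM => h.
  have -> : 2 * C / 2 ^+ k - 2 * C * (2^-1 / 2 ^+ (k + j)) =
    C / 2 ^+ (k + j) + (2 * C / 2 ^+ k - 2 * C / 2 ^+ (k + j)).
    by move: (2 ^+ (k + j))^-1 (2 ^+ k)^-1 => a b; field.
  exact: lerD.
have T' k j : `|x (k + j)%N - x k| <= 2 * C / 2 ^+ k.
  by apply: le_trans (T k j) _; rewrite lerBlDr lerDl divr_ge0 ?mulr_ge0// exprn_ge0.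
have : cvg (x @ \oo).
  apply: cauchy_cvg; apply: cauchy_exP => e e0.
  have [k hk] := exp2_small (2 * C) (half_gt0 e0).
  exists (x k); exists k => // j /= kj.
  rewrite -ball_normE /ball_ /= distrC -(subnKC kj).
  by apply: le_lt_trans (T' _ _) _; apply: le_lt_trans hk _; lra.
move=> /cvgrPdist_le hy; set y := lim (x @ \oo) in hy.
exists y => k; apply/ler_addgt0 => e e0.
have [N _ HN] := hy e e0.
have := HN (k + N)%N (leq_addl _ _) => /= h.
rewrite -(subrK (x (k + N)%N) (x k)) -addrA.
apply: le_trans (ler_normD _ _) _; rewrite lerD//; first by rewrite distrC T'.
by rewrite distrC.
Qed.

Lemma complete_euclid n : ns_complete (euclid R n).
Proof. by move=> x C _ /complete_row[y hy]; exists y. Qed.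

Lemma complete_prod (X Y : nspace R) : ns_complete X -> ns_complete Y ->
  ns_complete (prod_ns X Y).
Proof.
move=> cX cY x C mx H.
have [|k|y1 m1 h1] := cX (fun k => (x k).1) C.
- by move=> k; have [] := mx k.
- by apply: le_trans (H k); rewrite /= le_max lexx.
have [|k|y2 m2 h2] := cY (fun k => (x k).2) C.
- by move=> k; have [] := mx k.
- by apply: le_trans (H k); rewrite /= le_max lexx orbT.
exists (y1, y2); first by split.
by move=> k; rewrite /= ge_max h1 h2.
Qed.

End Completeness.

Section LipSpace.
Variables (R : realType) (n : nat).
Local Notation V := 'rV[R]_n.
Implicit Types v : R -> V.
Local Notation CL := (CperLip R n 0).

Lemma lip_memP v : vmem CL v <->
  periodic1 v /\ exists K : R, forall s t, `|v s - v t| <= K * `|s - t|.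
Proof.
split=> [[[pv _ _] [K HK]]|[pv [K HK]]].
  split => //; exists K => s t; exact: (HK (s, t)).
split; last by exists K => -[s t] _ /=; exact: HK.
split => //; apply/continuous_epsP => t e e0.
have K0 : 0 < `|K| + 1 by rewrite ltr_pwDr.
exists (e / (`|K| + 1)); first by rewrite divr_gt0.
move=> h; rewrite ltr_pdivlMr// => hd; apply: le_trans (HK _ _) _.
rewrite addrC addKr; apply: le_trans (ltW hd); rewrite mulrC ler_wpM2l//.
by apply: le_trans (ler_norm _) _; rewrite lerDl.
Qed.

Lemma Lip_bounded v : vmem CL v -> forall s t, `|v s - v t| <= Lip v * `|s - t|.
Proof.
move=> /lip_memP[_ [K HK]] s t.
have [->|st] := eqVneq s t; first by rewrite !subrr !normr0 mulr0.
have st0 : 0 < `|s - t| by rewrite normr_gt0 subr_eq0.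
rewrite -ler_pdivrMr//; apply: ub_le_sup; last by exists s, t.
by exists K => _ [s' [t' [st' ->]]]; rewrite ler_pdivrMr ?HK// normr_gt0 subr_eq0.
Qed.

Lemma lip_norm1 v t : vmem CL v -> `|v t| <= vnorm CL v.
Proof.
move=> [mv _]; rewrite /= le_max; apply/orP; left.
exact: (le_Cper_norm t mv (leqnn 0)).
Qed.

Lemma lip_norm2 v s t : vmem CL v -> `|v s - v t| <= vnorm CL v * `|s - t|.
Proof.
move=> mv; apply: le_trans (Lip_bounded mv s t) _.
by rewrite ler_wpM2r//= le_max lexx orbT.
Qed.

Lemma lip_norm_le v M : (forall t, `|v t| <= M) ->
  (forall s t, `|v s - v t| <= M * `|s - t|) -> vnorm CL v <= M.
Proof.
move=> h1 h2; rewrite /= ge_max; apply/andP; split.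
  by apply: Cper_norm_le => j t; rewrite leqn0 => /eqP ->.
apply: ge_sup; first by exists (`|v 1 - v 0| / `|1 - 0|); exists 1, 0; rewrite oner_neq0.
by move=> _ [s [t [st ->]]]; rewrite ler_pdivrMr ?h2// normr_gt0 subr_eq0.
Qed.

Lemma normed_CperLip : normed CL.
Proof.
split.
- apply/lip_memP; split => //; exists 0 => s t.
  by rewrite subrr normr0 mul0r.
- move=> a u v /lip_memP[pu [K HK]] /lip_memP[pv [L HL]]; apply/lip_memP; split.
    by move=> t; rewrite !fctE /= pu pv.
  exists (`|a| * K + L) => s t; rewrite !fctE.
  have -> : a *: u s + v s - (a *: u t + v t) = a *: (u s - u t) + (v s - v t).
    by apply/rowP => i; rewrite !mxE; ring.
  by apply: le_trans (ler_normD _ _) _; rewrite normrZ mulrDl lerD// -mulrA ler_wpM2l.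
- move=> a u mu.
  have H (b : R) (u' : R -> V) : vmem CL u' -> vnorm CL (b *: u') <= `|b| * vnorm CL u'.
    move=> mu'; apply: lip_norm_le => [t|s t]; rewrite !fctE.
      by rewrite normrZ ler_wpM2l// lip_norm1.
    by rewrite -scalerBr normrZ -mulrA ler_wpM2l// lip_norm2.
  apply/eqP; rewrite eq_le H//=.
  have [->|a0] := eqVneq a 0.
    by rewrite normr0 mul0r scale0r; apply: le_trans (@lip_norm1 0 0 _) => //;
      apply/lip_memP; split => //; exists 0 => s t; rewrite subrr normr0 mul0r.
  rewrite -[X in _ * X]/(vnorm CL u) -[leRHS]/(vnorm CL (a *: u)).
  have {1}-> : u = a^-1 *: (a *: u) by rewrite scalerA mulVf// scale1r.
  rewrite -ler_pdivlMl ?normr_gt0// -normfV; apply: H.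
  move: mu => /lip_memP[pu [K HK]]; apply/lip_memP; split.
    by move=> t; rewrite !fctE /= pu.
  exists (`|a| * K) => s t; rewrite !fctE -scalerBr normrZ -mulrA ler_wpM2l//.
- move=> u v mu mv; apply: lip_norm_le => [t|s t]; rewrite !fctE.
    by apply: (le_trans (ler_normD (u t) (v t))); apply: lerD; exact: lip_norm1.
  rewrite opprD addrACA mulrDl.
  by apply: (le_trans (ler_normD (u s - u t) (v s - v t))); apply: lerD; exact: lip_norm2.
- move=> u mu u0; apply/funext => t; apply/eqP; rewrite -normr_le0 -u0.
  exact: lip_norm1.
Qed.

(** The pointwise limit does not control Lipschitz constants by itself. The differences x_j(s) -
    x_j(t) converge at the rate C |s - t| / 2^j, so completeness of the value space is applied a
    second time, to them. *)
Lemma complete_CperLip : ns_complete CL.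
Proof.
move=> x C mx H.
have mxx k : vmem CL (x k.+1 - x k) by apply: memB => //; exact: normed_CperLip.
have /choice[y Hy] : forall t, exists y : V, forall k, `|x k t - y| <= 2 * C / 2 ^+ k.
  move=> t; apply: (@complete_row R n (fun k => x k t) C) => k.
  exact: (le_trans (lip_norm1 t (mxx k)) (H k)).
have L s t k : `|(x k - y) s - (x k - y) t| <= (2 * C / 2 ^+ k) * `|s - t|.
  have [j|z hz] := @complete_row R n (fun j => x j s - x j t) (C * `|s - t|).
    have -> : x j.+1 s - x j.+1 t - (x j s - x j t) = (x j.+1 - x j) s - (x j.+1 - x j) t.
      by apply/rowP => i; rewrite !fctE !mxE; ring.
    apply: le_trans (lip_norm2 s t (mxx j)) _.
    by rewrite mulrAC ler_wpM2r.
  have zE : y s - y t - z = 0.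
    apply: (@small_tail _ _ _ (4 * C + 2 * (C * `|s - t|))) => j.
    have -> : y s - y t - z = (x j s - x j t - z) - (x j s - y s) + (x j t - y t).
      by apply/rowP => i; rewrite !mxE; ring.
    apply: le_trans (ler_normD _ _) _.
    have h1 := ler_normB (x j s - x j t - z) (x j s - y s).
    have := hz j; have := Hy s j; have := Hy t j; rewrite /= -!mulrA !(mulrA _ _ (2 ^+ j)^-1).
    move: (2 ^+ j)^-1 => a; rewrite /= => b1 b2 b3; lra.
  have := hz k; rewrite !fctE /=.
  have -> : x k s - y s - (x k t - y t) = x k s - x k t - z.
    by rewrite -(subr0_eq zE); apply/rowP => i; rewrite !mxE; ring.
  by move=> /le_trans; apply; rewrite mulrA mulrAC.
have my : vmem CL y.
  apply/lip_memP; split.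
    move=> t; apply/eqP; rewrite -subr_eq0; apply/eqP; apply: (@small_tail _ _ _ (4 * C)) => k.
    have := Hy (t + 1) k; have := Hy t k.
    have /lip_memP[-> _] := mx k => b1 b2.
    have -> : y (t + 1) - y t = (x k t - y t) - (x k t - y (t + 1)).
      by apply/rowP => i; rewrite !mxE; ring.
    apply: le_trans (ler_normB _ _) _.
    move: b1 b2; move: (2 ^+ k)^-1 => a; lra.
  exists (vnorm CL (x 0%N) + 2 * C) => s t.
  have -> : y s - y t = (x 0%N s - x 0%N t) - ((x 0%N - y) s - (x 0%N - y) t).
    by apply/rowP => i; rewrite !fctE !mxE; ring.
  apply: le_trans (ler_normB _ _) _; rewrite mulrDl lerD ?lip_norm2//.
  by have := L s t 0%N; rewrite expr0 divr1.
exists y => // k; apply: lip_norm_le => [t|s t]; last exact: L.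
exact: Hy.
Qed.

End LipSpace.

Section ExtendedSpaces.
Variables (R : realType) (ny nmu : nat).

Lemma normed_Xsp l : normed (Xsp R ny nmu l).
Proof. by apply: normed_prod; [exact: normed_Cper|exact: normed_euclid]. Qed.

Lemma normed_Ce k : normed (Ce R ny nmu k).
Proof.
by do 2?[apply: normed_prod; last exact: normed_euclid]; exact: normed_Cper.
Qed.

Lemma normed_CeLip : normed (CeLip R ny nmu 0).
Proof.
by do 2?[apply: normed_prod; last exact: normed_euclid]; exact: normed_CperLip.
Qed.

Lemma complete_CeLip : ns_complete (CeLip R ny nmu 0).
Proof.
by do 2?[apply: complete_prod; last exact: complete_euclid]; exact: complete_CperLip.
Qed.

End ExtendedSpaces.

(** * The integral operator *)

Section Integral.
Variables (R : realType) (n : nat).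
Local Notation V := 'rV[R]_n.
Local Notation mu := (@lebesgue_measure R).
Implicit Types w : R -> V.

Definition vintegrable w :=
  forall i, mu.-integrable `[0, 1] (EFin \o (fun s => w s 0 i)).

Lemma vintegrable_sub w t i : vintegrable w -> t <= 1 ->
  mu.-integrable `[0, t] (EFin \o (fun s => w s 0 i)).
Proof.
move=> hw t1; apply: integrableS (hw i) => //.
by apply: subset_itvl; rewrite bnd_simp.
Qed.

Lemma itv_integrable_cst (s t c : R) (N : set R) : measurable N ->
  mu.-integrable (`]s, t] `\` N) (EFin \o (fun=> c : R)).
Proof.
move=> mN; apply: measurable_bounded_integrable => //.
- exact: measurableD.
- apply: le_lt_trans (_ : mu `]s, t] < +oo)%E.
    by apply: le_measure; rewrite ?inE//; (exact: measurableD || exact: subDsetl).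
  by rewrite lebesgue_measure_itv /=; case: ifPn => _; rewrite ?ltry// -EFinB ltry.
- by exists `|c|; split; [exact: num_real|move=> x cx y _ /=; exact: ltW].
Qed.

Lemma vint_lin a u w t : vintegrable u -> vintegrable w -> t <= 1 ->
  vint (fun s => a *: u s + w s) t = a *: vint u t + vint w t.
Proof.
move=> hu hw t1; apply/rowP => i; rewrite !mxE.
under eq_Rintegral do rewrite !mxE.
have iu := vintegrable_sub i hu t1; have iw := vintegrable_sub i hw t1.
rewrite RintegralD ?RintegralZl//.
pose f s : R := u s 0 i.
have : mu.-integrable `[0, t] (fun s => a%:E * (EFin \o f) s)%E by exact: integrableZl.
by [].
Qed.

Lemma vintegrable_lin a u w : vintegrable u -> vintegrable w ->
  vintegrable (fun s => a *: u s + w s).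
Proof.
move=> hu hw i.
pose f s : R := u s 0 i; pose g s : R := w s 0 i.
have h1 : mu.-integrable `[0, 1] (fun s => a%:E * (EFin \o f) s)%E.
  by apply: integrableZl => //; exact: hu.
have : mu.-integrable `[0, 1] ((fun s => a%:E * (EFin \o f) s) \+ (EFin \o g))%E.
  by apply: integrableD => //; exact: hw.
by apply: eq_integrable => // s _; rewrite /= !mxE.
Qed.

Lemma vint0 w : vint w 0 = 0.
Proof. by apply/rowP => i; rewrite !mxE set_itv1 Rintegral_set1. Qed.

(** The integral of w - b is taken off the null set N. In the applications N contains the mesh
    points, where an interpolant takes an arbitrary value. *)
Lemma vint_incr w s t b e (N : set R) : vintegrable w -> 0 <= s -> s <= t ->
  t <= 1 -> 0 <= e -> countable N ->
  (forall x, s <= x <= t -> ~ N x -> `|w x - b| <= e) ->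
  `|vint w t - vint w s - (t - s) *: b| <= e * (t - s).
Proof.
move=> hw s0 st t1 e0 cN H; apply: norm_le_coord => [|i].
  by rewrite mulr_ge0// subr_ge0.
have mN : measurable N by exact: countable_measurable.
have N0 : mu N = 0%E by exact: countable_lebesgue_measure0.
have int_st : mu.-integrable `]s, t] (EFin \o (fun s => w s 0 i)).
  apply: integrableS (hw i) => //.
  by move=> x; rewrite /= !in_itv /= => /andP[x1 x2]; apply/andP; split; lra.
have cst_int c : mu.-integrable `]s, t] (EFin \o (fun=> c : R)).
  by have := @itv_integrable_cst s t c set0 measurable0; rewrite setD0.
have mst : fine (mu `]s, t]) = t - s.
  rewrite lebesgue_measure_itv /= lte_fin; case: ltP => // ts.
  by rewrite [t](_ : _ = s) ?subrr//; apply/eqP; rewrite eq_le st ts.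
rewrite !mxE Rintegral_itvB ?bnd_simp//; last exact: vintegrable_sub.
have -> : (t - s) * b 0 i = \int[mu]_(x in `]s, t]) (b 0 i).
  by rewrite Rintegral_cst// mst mulrC.
rewrite -RintegralB//.
have gint : mu.-integrable `]s, t] (EFin \o (fun x => w x 0 i - b 0 i)).
  pose f x : R := w x 0 i; pose g (x : R) : R := b 0 i.
  have : mu.-integrable `]s, t] ((EFin \o f) \- (EFin \o g))%E.
    by apply: integrableB => //; exact: cst_int.
  by [].
apply: le_trans (le_normr_Rintegral _ gint) _ => //.
have agint : mu.-integrable `]s, t] (EFin \o (fun x => `|w x 0 i - b 0 i|)).
  exact: (integrable_abse gint).
have -> : \int[mu]_(x in `]s, t]) `|w x 0 i - b 0 i| =
    \int[mu]_(x in `]s, t] `\` N) `|w x 0 i - b 0 i|.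
  by rewrite /Rintegral; congr fine; exact: negligible_integral.
have mD : measurable (`]s, t] `\` N) by exact: measurableD.
apply: (@le_trans _ _ (\int[mu]_(x in `]s, t] `\` N) e)).
  apply: le_Rintegral => //.
  - by apply: integrableS agint => //; exact: subDsetl.
  - exact: itv_integrable_cst.
  - move=> x [/=]; rewrite in_itv /= => /andP[x1 x2] Nx.
    have := coord_le_norm (w x - b) i; rewrite !mxE => /le_trans; apply; apply: H => //.
    by rewrite (ltW x1).
rewrite Rintegral_cst// ler_wpM2l// -mst fine_le//.
- rewrite ge0_fin_numE//; apply: le_lt_trans (_ : mu `]s, t] < +oo)%E.
    by apply: le_measure; rewrite ?inE//; (exact: measurableD || exact: subDsetl).
  by rewrite lebesgue_measure_itv /=; case: ifPn => _; rewrite ?ltry// -EFinB ltry.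
- by rewrite lebesgue_measure_itv /=; case: ifPn => _ //; rewrite -EFinB.
- by apply: le_measure; rewrite ?inE//; (exact: measurableD || exact: subDsetl).
Qed.

Lemma vintegrable_bounded w M : (forall t, 0 <= t <= 1 -> `|w t| <= M) ->
  (forall i, measurable_fun (`[0, 1]%classic : set R) (fun s : R => w s 0 i : R)) -> vintegrable w.
Proof.
move=> H mw i; apply: measurable_bounded_integrable => //.
- by rewrite /= lebesgue_measure_itv /= lte_fin ltr01 -EFinB ltry.
- exact: mw.
exists M; split; first exact: num_real.
move=> x Mx y /=; rewrite in_itv /= => y01.
by apply: le_trans (ltW Mx); apply: le_trans (coord_le_norm _ _) (H _ y01).
Qed.

Lemma cont_coord w i : continuous w -> continuous (fun s => w s 0 i : R).
Proof.
move=> cw t; apply: (continuous_comp (f := w) (g := fun M : V => M 0 i)); first exact: cw.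
exact: coord_continuous.
Qed.

Lemma vintegrable_cont w : periodic1 w -> continuous w -> vintegrable w.
Proof.
move=> pw cw; have [M M0 HM] := periodic_bounded pw cw.
apply: (@vintegrable_bounded w M) => // i.
apply: measurable_funTS; apply: continuous_measurable_fun; exact: cont_coord.
Qed.

End Integral.

Section PeriodicPrimitive.
Variables (R : realType) (n : nat).
Local Notation V := 'rV[R]_n.
Implicit Types w v : R -> V.

(** The periodic primitive of w minus its mean that vanishes at 0; it is the part of [Lop] that
    depends on the function alone. *)
Definition per_prim w t := vint w (fpart t) - fpart t *: vint w 1.

Lemma fpart_int (t : R) (k : int) : 0 <= t < 1 -> fpart (t + k%:~R) = t.
Proof.
move=> /andP[t0 t1]; rewrite /fpart.
rewrite (@floor_def _ _ k) ?addrK//.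
by rewrite lerDr t0 intrD1 [t + _]addrC ltrD2l.
Qed.

Lemma fpart_id (t : R) : 0 <= t < 1 -> fpart t = t.
Proof. by move=> h; have := fpart_int 0 h; rewrite addr0. Qed.

Lemma per_prim_per w : periodic1 (per_prim w).
Proof.
move=> t; rewrite /per_prim.
suff -> : fpart (t + 1) = fpart t by [].
have -> : t + 1 = fpart t + (Num.floor t + 1)%:~R by rewrite /fpart intrD addrA subrK.
by rewrite fpart_int// fpart_ge0 fpart_lt1.
Qed.

Lemma per_prim01 w t : 0 <= t <= 1 -> per_prim w t = vint w t - t *: vint w 1.
Proof.
move=> /andP[t0]; rewrite le_eqVlt => /predU1P[->|t1]; last first.
  by rewrite /per_prim fpart_id// t0.
have -> : per_prim w 1 = per_prim w 0 by have := per_prim_per w 0; rewrite add0r.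
have f0 : fpart (0 : R) = 0 by rewrite fpart_id// lexx ltr01.
by rewrite /per_prim f0 vint0 scale0r scale1r !subrr.
Qed.

Lemma per_prim_incr w s t b e (N : set R) : vintegrable w -> s <= t < s + 1 ->
  0 <= e -> countable N ->
  (forall x, s <= x <= t -> ~ N (fpart x) -> `|w (fpart x) - b| <= e) ->
  `|per_prim w t - per_prim w s - (t - s) *: (b - vint w 1)| <= e * (t - s).
Proof.
(* The point 1 joins the exceptional set: its fractional part is 0, so the hypothesis says nothing
   about w 1. *)
move=> hw /andP[st ts] e0 cN H.
have cN1 : countable (N `|` [set 1]).
  by rewrite -bigcup2E; apply: bigcup_countable => // -[|[|i]] _ //=; exact: countable1.
have piece (k : int) (x y : R) : 0 <= x -> x <= y -> y <= 1 -> s <= x + k%:~R ->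
    y + k%:~R <= t ->
    `|per_prim w (y + k%:~R) - per_prim w (x + k%:~R) - (y - x) *: (b - vint w 1)|
      <= e * (y - x).
  move=> x0 xy y1 sx yt; rewrite !(periodic_int (per_prim_per w)).
  rewrite !per_prim01 ?x0 ?y1 ?(le_trans x0 xy) ?(le_trans xy y1)//.
  have -> : vint w y - y *: vint w 1 - (vint w x - x *: vint w 1) - (y - x) *: (b - vint w 1)
     = vint w y - vint w x - (y - x) *: b by apply/rowP => i; rewrite !mxE; ring.
  apply: (vint_incr hw x0 xy y1 e0 cN1) => z /andP[xz zy] nz.
  have z01 : 0 <= z < 1.
    rewrite (le_trans x0 xz) lt_neqAle (le_trans zy y1) andbT.
    by apply/eqP => z1; apply: nz; right.
  have := H (z + k%:~R); rewrite fpart_int//; apply.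
    by apply/andP; split; [apply: le_trans sx _|apply: le_trans yt]; rewrite lerD2r.
  by move=> Nz; apply: nz; left.
have s1 := floor_le s; have s2 := floorD1_gt s.
pose k := Num.floor s.
rewrite -/k intrD in s1 s2.
have [tk|kt] := leP t (k%:~R + 1).
  have := piece k (s - k%:~R) (t - k%:~R); rewrite !subrK.
  have -> : t - k%:~R - (s - k%:~R) = t - s by ring.
  apply => //; lra.
have h1 := piece k (s - k%:~R) 1; rewrite subrK in h1.
have h2 := piece (k + 1) 0 (t - (k%:~R + 1)); rewrite intrD subrK add0r in h2.
move: (s1) (s2) (st) (ts) (kt); clear H piece => ? ? ? ? ?.
have {}h1 : `|per_prim w (1 + k%:~R) - per_prim w s - (1 - (s - k%:~R)) *: (b - vint w 1)| <= e * (1 - (s - k%:~R)).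
  by apply: h1; lra.
have {}h2 : `|per_prim w t - per_prim w (k%:~R + 1) - (t - (k%:~R + 1) - 0) *: (b - vint w 1)| <= e * (t - (k%:~R + 1) - 0).
  by apply: h2; lra.
rewrite (addrC 1) in h1.
move: (per_prim w (k%:~R + 1)) h1 h2 => q h1 h2.
have -> : per_prim w t - per_prim w s - (t - s) *: (b - vint w 1) =
   (per_prim w t - q - (t - (k%:~R + 1) - 0) *: (b - vint w 1)) +
   (q - per_prim w s - (1 - (s - k%:~R)) *: (b - vint w 1)).
  move: (b - vint w 1) (k%:~R : R) => c r.
  by apply/rowP => i; rewrite !mxE; ring.
apply: le_trans (ler_normD _ _) _; lra.
Qed.

Lemma vint1_le w M (N : set R) : vintegrable w -> 0 <= M -> countable N ->
  (forall t, 0 <= t <= 1 -> ~ N t -> `|w t| <= M) -> `|vint w 1| <= M.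
Proof.
move=> hw M0 cN H; have := @vint_incr R n w 0 1 0 M N hw (lexx _) ler01 (lexx _) M0 cN.
rewrite vint0 scaler0 !subr0 mulr1; apply => x x01 Nx.
by rewrite subr0; exact: H.
Qed.

(** Moving t back by whole periods leaves w t unchanged and only shortens t - s. *)
Lemma per_lip w K : periodic1 w -> (forall s t, s <= t < s + 1 -> `|w t - w s| <= K * (t - s)) ->
  0 <= K -> forall s t, `|w s - w t| <= K * `|s - t|.
Proof.
move=> pw H K0.
have H' s t : s <= t -> `|w t - w s| <= K * (t - s).
  move=> st; have := H s (s + fpart (t - s)).
  rewrite lerDl fpart_ge0 ltrD2l fpart_lt1 => /(_ isT).
  have -> : s + fpart (t - s) = t + (- Num.floor (t - s))%:~R.
    by rewrite /fpart mulrNz; ring.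
  rewrite (periodic_int pw) => /le_trans; apply; rewrite ler_wpM2l//.
  rewrite mulrNz; have : 0 <= (Num.floor (t - s))%:~R :> R.
    by rewrite ler0z floor_ge0 subr_ge0.
  lra.
move=> s t; have [st|ts] := leP s t.
  by rewrite distrC [X in _ <= _ * X]distrC ger0_norm ?subr_ge0// H'.
by rewrite ger0_norm ?subr_ge0 ?H' ?ltW.
Qed.

(** The factor 2 is the bound 2 M for w minus its mean. The sup bound follows from the Lipschitz
    bound because [per_prim] vanishes at 0. *)
Lemma per_prim_bound w M (N : set R) : vintegrable w -> 0 <= M -> countable N ->
  (forall t, 0 <= t <= 1 -> ~ N t -> `|w t| <= M) ->
  (forall t, `|per_prim w t| <= 2 * M) /\ (forall s t, `|per_prim w s - per_prim w t| <= 2 * M * `|s - t|).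
Proof.
move=> hw M0 cN H.
have L s t : `|per_prim w s - per_prim w t| <= 2 * M * `|s - t|.
  apply: per_lip; [exact: per_prim_per| |by rewrite mulr_ge0] => {}s {}t st.
  have := @per_prim_incr w s t 0 M N hw st M0 cN.
  move=> /(_ _)-h.
  have {}h : `|per_prim w t - per_prim w s - (t - s) *: (0 - vint w 1)| <= M * (t - s).
    apply: h => x _ Nx; rewrite subr0; apply: H => //.
    by rewrite fpart_ge0 ltW// fpart_lt1.
  have st0 : 0 <= t - s by move/andP: st => []; lra.
  have c1 := vint1_le hw M0 cN H.
  rewrite -[per_prim w t - _](subrK ((t - s) *: (0 - vint w 1))).
  apply: le_trans (ler_normD _ _) _.
  have -> : 2 * M * (t - s) = M * (t - s) + M * (t - s) by ring.
  rewrite lerD// normrZ sub0r normrN (ger0_norm st0) mulrC ler_wpM2r//.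
split => // t.
rewrite -(periodic_fpart t (per_prim_per w)).
have := L (fpart t) 0.
have -> : per_prim w 0 = 0 by rewrite per_prim01 ?lexx ?ler01// vint0 scale0r subr0.
rewrite !subr0 => /le_trans; apply.
by rewrite ger0_norm ?fpart_ge0// ler_piMr ?mulr_ge0// ltW// fpart_lt1.
Qed.

Lemma per_prim_hasd w : periodic1 w -> continuous w ->
  has_deriv (per_prim w) (fun t => w t - vint w 1).
Proof.
move=> pw cw; have hw := vintegrable_cont pw cw.
move=> t e e0; have [d d0 Hd] := (continuous_epsP _).1 cw t e e0.
exists (Num.min d 1); first by rewrite lt_min d0 ltr01.
move=> h; rewrite lt_min => /andP[hd h1].
have [h0|h0] := leP 0 h.
  have := @per_prim_incr w t (t + h) (w t) e set0 hw.
  have -> : t + h - t = h by ring.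
  rewrite (ger0_norm h0); apply => //.
  - rewrite lerDl h0 ltrD2l; move: h1; rewrite ger0_norm//.
  - exact: ltW.
  - move=> x /andP[x1 x2] _; rewrite (periodic_fpart x pw).
    have := Hd (x - t); rewrite (addrC t) subrK; apply.
    apply: le_lt_trans hd; rewrite !ger0_norm// ; lra.
have := @per_prim_incr w (t + h) t (w t) e set0 hw.
have -> : t - (t + h) = - h by ring.
have -> : per_prim w (t + h) - per_prim w t - h *: (w t - vint w 1) =
   - (per_prim w t - per_prim w (t + h) - (- h) *: (w t - vint w 1)).
  by apply/rowP => i; rewrite !mxE; ring.
rewrite (ltr0_norm h0) normrN; apply => //.
- move: h1; rewrite ltr0_norm//; lra.
- exact: ltW.
- move=> x /andP[x1 x2] _; rewrite (periodic_fpart x pw).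
  have := Hd (x - t); rewrite (addrC t) subrK; apply.
  apply: le_lt_trans hd; rewrite !ler0_norm//; lra.
Qed.

Lemma per_prim_Cper k w : Cper_mem k w -> Cper_mem k.+1 (per_prim w).
Proof.
move=> mw; have pw := Cper_periodic mw; have cw := Cper_continuous mw (leq0n k).
have mwc : Cper_mem k (w - cst (vint w 1)) :=
  @memB R (Cper R n k) (normed_Cper R n k) w _ mw (Cper_cst k (vint w 1)).
refine (proj1 (@Cper_introP _ _ k.+1 (per_prim w)
  (fun j => if j is j'.+1 then derive1n j' (w - cst (vint w 1)) else per_prim w) erefl _ _ _)).
- exact: per_prim_per.
- by move=> [|j] jk; [exact: per_prim_hasd|exact: (Cper_hasd mwc)].
- exact: (Cper_continuous mwc (leqnn k)).
Qed.

Lemma vint_lin1 a u v : vintegrable u -> vintegrable v ->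
  vint (a *: u + v) 1 = a *: vint u 1 + vint v 1.
Proof. by move=> hu hv; exact: vint_lin. Qed.

Lemma per_prim_lin a u v t : vintegrable u -> vintegrable v ->
  per_prim (a *: u + v) t = a *: per_prim u t + per_prim v t.
Proof.
move=> hu hv; rewrite /per_prim vint_lin1// (vint_lin a hu hv) ?(ltW (fpart_lt1 _))//.
by apply/rowP => i; rewrite !mxE; ring.
Qed.

End PeriodicPrimitive.

(** * Steklov averages *)

Section Steklov.
Variables (R : realType) (n : nat).
Local Notation V := 'rV[R]_n.
Implicit Types v : R -> V.

(** Adding the mean back gives an antiderivative of v itself. It is not periodic, but its increments
    over a fixed step h are. *)
Definition prim v t := per_prim v t + t *: vint v 1.

(** The integral mean of v over [t, t + h]. *)
Definition steklov (h : R) v t := h^-1 *: (prim v (t + h) - prim v t).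

Lemma prim_hasd v : Cper_mem 0 v -> has_deriv (prim v) v.
Proof.
move=> mv; have hp := per_prim_hasd (Cper_periodic mv) (Cper_continuous mv (leqnn 0)).
have hl := hasd_scalev (vint v 1) (g := id) (g' := fun=> 1) (fun t => is_derive_id _ _).
have := hasd_lin 1 hl hp; move=> /hasd_ext; apply => t.
  by rewrite scale1r addrC.
by rewrite !scale1r addrC subrK.
Qed.

Lemma prim_lin a u v t : Cper_mem 0 u -> Cper_mem 0 v ->
  prim (a *: u + v) t = a *: prim u t + prim v t.
Proof.
move=> mu mv.
have iu := vintegrable_cont (Cper_periodic mu) (Cper_continuous mu (leqnn 0)).
have iv := vintegrable_cont (Cper_periodic mv) (Cper_continuous mv (leqnn 0)).
rewrite /prim per_prim_lin// vint_lin1//.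
move: (vint u 1) (vint v 1) (per_prim u t) (per_prim v t) => A B C D.
by apply/rowP => i; rewrite !mxE; ring.
Qed.

Lemma steklov_lin h a u v : Cper_mem 0 u -> Cper_mem 0 v ->
  steklov h (a *: u + v) = a *: steklov h u + steklov h v.
Proof.
move=> mu mv; apply/funext => t; rewrite !fctE /steklov !prim_lin//.
move: (prim u t) (prim v t) (prim u (t + h)) (prim v (t + h)) => A B C D.
by apply/rowP => i; rewrite !mxE; ring.
Qed.

Lemma Cper_antiderivative (F z : R -> V) k : periodic1 F -> has_deriv F z -> Cper_mem k z ->
  Cper_mem k.+1 F /\ forall j, (j <= k)%N -> derive1n j.+1 F = derive1n j z.
Proof.
move=> pF hF mz.
have [|[|j] jk||mF E] := @Cper_introP _ _ k.+1 F
  (fun j => if j is j'.+1 then derive1n j' z else F) erefl => //.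
- exact: (Cper_hasd mz).
- exact: (Cper_continuous mz (leqnn k)).
by split=> // j jk; rewrite E.
Qed.

Lemma Cper_incr h k v : Cper_mem k v ->
  Cper_mem k (h^-1 *: (shift_fun h v - v)) /\
  forall j, (j <= k)%N -> derive1n j (h^-1 *: (shift_fun h v - v)) =
     fun t => h^-1 *: (derive1n j v (t + h) - derive1n j v t).
Proof.
move=> mv.
have [m1 E1] := Cper_linP (-1) mv (Cper_shift h mv).
have [m2 E2] := Cper_linP h^-1 m1 (Cper_cst k 0).
have <- : h^-1 *: (-1 *: v + shift_fun h v) + cst 0 = h^-1 *: (shift_fun h v - v).
  by apply/funext => t; rewrite !fctE addr0 scaleN1r addrC.
split=> // j jk; rewrite E2// E1// derive1n_shift; apply/funext => t.
rewrite !fctE (_ : derive1n j (cst 0) t = (0 : V)); last first.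
  by case: (j) => // j'; rewrite derive1n_cst.
by rewrite addr0 scaleN1r addrC /shift_fun (addrC h).
Qed.

Lemma prim_per v h t : prim v (t + 1 + h) - prim v (t + 1) = prim v (t + h) - prim v t.
Proof.
rewrite /prim (_ : t + 1 + h = t + h + 1) ?(per_prim_per v)//; last by ring.
move: (per_prim v (t + h)) (per_prim v t) (vint v 1) => A B C.
by apply/rowP => i; rewrite !mxE; ring.
Qed.

Lemma steklov_Cper h k v : Cper_mem k v ->
  Cper_mem k.+1 (steklov h v) /\
  forall j, (j <= k)%N -> derive1n j.+1 (steklov h v) =
     fun t => h^-1 *: (derive1n j v (t + h) - derive1n j v t).
Proof.
move=> mv; have mv0 := Cper_le (leq0n k) mv.
have [mz Ez] := Cper_incr h mv.
have pS : periodic1 (steklov h v) by move=> t; rewrite /steklov prim_per.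
have hS : has_deriv (steklov h v) (h^-1 *: (shift_fun h v - v)).
  have hf := prim_hasd mv0.
  have hs : has_deriv (fun t => prim v (t + h)) (fun t => v (t + h)).
    apply: (hasd_ext (hasd_affine h 1 hf)) => t; rewrite mulr1 addrC//.
    by rewrite scale1r addrC.
  have := hasd_lin h^-1 (hasd_lin (-1) hf hs) (@hasd_cst R n 0).
  move=> /hasd_ext; apply => t; rewrite scaleN1r addr0 [in RHS]addrC//.
  by rewrite !fctE /shift_fun (addrC h).
have [mS ES] := Cper_antiderivative pS hS mz.
by split=> // j jk; rewrite ES// Ez.
Qed.

(** The j-th derivative of the average is a difference quotient of some F with derivative v^(j): F
    is [prim v] for j = 0 and v^(j-1) otherwise. The mean value inequality compares it with v^(j)
    itself. *)
Lemma steklov_close k v : Cper_mem k v -> forall e, 0 < e ->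
  exists2 d : R, 0 < d & forall h, 0 < h < d -> Cper_norm k (steklov h v - v) <= e.
Proof.
move=> mv e e0; have mv0 := Cper_le (leq0n k) mv.
have [d d0 Hd] := Cper_shift_cont mv e0.
exists d => // h /andP[h0 hd].
have [mS ES] := steklov_Cper h mv.
have mSk : Cper_mem k (steklov h v) by exact: Cper_le mS.
apply: Cper_norm_le => j t jk.
have -> : steklov h v - v = -1 *: v + steklov h v by rewrite scaleN1r addrC.
have [_ ->//] := Cper_linP (-1) mv mSk; rewrite !fctE scaleN1r addrC.
have K (F : R -> V) : has_deriv F (derive1n j v) ->
    `|h^-1 *: (F (t + h) - F t) - derive1n j v t| <= e.
  move=> hF; have := @mvt_le R n F _ t h (derive1n j v t) e hF (ltW e0).
  move=> /(_ _)-H; have {}H : `|F (t + h) - F t - h *: derive1n j v t| <= e * `|h|.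
    apply: H => x /andP[x0 x1].
    have xh : `|x * h| < d.
      have xh0 : 0 <= x * h by apply: mulr_ge0 => //; exact: ltW.
      by rewrite ger0_norm//; apply: le_lt_trans hd; rewrite ler_piMl// ltW.
    have mB : Cper_mem k (shift_fun (t + x * h) v - shift_fun t v).
      have [m1 _] := Cper_linP (-1) (Cper_shift t mv) (Cper_shift (t + x * h) mv).
      by rewrite scaleN1r addrC in m1.
    apply: le_trans (Hd t _ xh); apply: le_trans (le_Cper_norm 0 mB jk).
    have -> : shift_fun (t + x * h) v - shift_fun t v =
      -1 *: shift_fun t v + shift_fun (t + x * h) v by rewrite scaleN1r addrC.
    have [_ ->//] := Cper_linP (-1) (Cper_shift t mv) (Cper_shift (t + x * h) mv).
    by rewrite !derive1n_shift !fctE /shift_fun !addr0 scaleN1r addrC.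
  have -> : h^-1 *: (F (t + h) - F t) - derive1n j v t = h^-1 *: (F (t + h) - F t - h *: derive1n j v t).
    by rewrite [RHS]scalerBr scalerA mulVf ?scale1r// gt_eqF.
  rewrite normrZ normfV (gtr0_norm h0) ler_pdivrMl// mulrC.
  by rewrite (gtr0_norm h0) in H.
case: j jk K => [|j] jk K; first by apply: K; exact: prim_hasd.
by rewrite ES ?(ltnW jk)//; apply: K; exact: Cper_hasd mv jk.
Qed.

(** The derivative of the average is a difference quotient of v, so the Lipschitz constant of v
    bounds it. *)
Lemma steklov_lip v h : 0 < h -> vmem (CperLip R n 0) v ->
  Cper_norm 1 (steklov h v) <= vnorm (CperLip R n 0) v.
Proof.
move=> h0 mv; have mv0 : Cper_mem 0 v by case: mv.
have [mS ES] := steklov_Cper h mv0.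
have hi0 : 0 <= h^-1 by rewrite invr_ge0 ltW.
apply: Cper_norm_le => -[|[|j]] t // _.
  have N0 : 0 <= vnorm (CperLip R n 0) v by apply: le_trans (lip_norm1 0 mv).
  have := @mvt_le R n (prim v) v t h 0 _ (prim_hasd mv0) N0.
  rewrite scaler0 subr0 => /(_ _)-H; rewrite derive1n0 /steklov normrZ ger0_norm//.
  rewrite ler_pdivrMl// mulrC; apply: le_trans (H _) _; last by rewrite gtr0_norm.
  by move=> x _; rewrite subr0; exact: lip_norm1.
rewrite ES// !derive1n0 normrZ ger0_norm// ler_pdivrMl// mulrC.
apply: le_trans (lip_norm2 _ _ mv) _.
by rewrite (_ : t + h - t = h) ?gtr0_norm//; ring.
Qed.

End Steklov.

Section IntegralOperator.
Variables (R : realType) (ny nmu : nat).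
Local Notation ext := ((R -> 'rV[R]_ny) * 'rV[R]_ny * 'rV[R]_nmu)%type.
Implicit Types x y : ext.

Lemma LopE x : Lop x = (cst x.1.2 + per_prim x.1.1, x.1.2 + vint x.1.1 1, x.2).
Proof.
case: x => [[w a] nu] /=; congr (_, _, _).
by apply/funext => t; rewrite !fctE addrA.
Qed.

Lemma Lop_lin c x y : vintegrable x.1.1 -> vintegrable y.1.1 ->
  Lop (c *: x + y) = c *: Lop x + Lop y.
Proof.
move=> hx hy; rewrite !LopE.
have E1 : cst (c *: x + y).1.2 + per_prim (c *: x + y).1.1 =
   c *: (cst x.1.2 + per_prim x.1.1) + (cst y.1.2 + per_prim y.1.1).
  apply/funext => t; rewrite !fctE per_prim_lin//.
  move: (per_prim _ t) (per_prim _ t) => A B.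
  by apply/rowP => i; rewrite !mxE; ring.
have E2 : (c *: x + y).1.2 + vint (c *: x + y).1.1 1 =
  c *: (x.1.2 + vint x.1.1 1) + (y.1.2 + vint y.1.1 1).
  rewrite vint_lin1//; move: (vint _ 1) (vint _ 1) => A B.
  by apply/rowP => i; rewrite !mxE; ring.
by rewrite E1 E2.
Qed.

Lemma Lop_Ce k x : vmem (Ce R ny nmu k) x -> vmem (Ce R ny nmu k.+1) (Lop x).
Proof.
move=> [[mw _] _]; rewrite LopE; do 2!split => //=.
exact: (@memD R (Cper R ny k.+1) (normed_Cper R ny k.+1) _ _ (Cper_cst k.+1 _) (per_prim_Cper mw)).
Qed.

Lemma Ce_vintegrable x : vmem (Ce R ny nmu 0) x -> vintegrable x.1.1.
Proof.
move=> [[mw _] _].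
exact: (vintegrable_cont (Cper_periodic mw) (Cper_continuous mw (leqnn 0))).
Qed.

(** Boundedness from L^infinity to C^{0,1}. The constant is 3 = 1 + 2, one for the vector component
    and two for the periodic primitive. *)
Lemma Lop_bound x M (N : set R) : vintegrable x.1.1 -> 0 <= M -> countable N ->
  (forall t, 0 <= t <= 1 -> ~ N t -> `|x.1.1 t| <= M) -> `|x.1.2| <= M -> `|x.2| <= M ->
  vmem (CeLip R ny nmu 0) (Lop x) /\ vnorm (CeLip R ny nmu 0) (Lop x) <= 3 * M.
Proof.
move=> hx M0 cN H h1 h2; rewrite LopE.
have [b1 b2] := per_prim_bound hx M0 cN H.
have c1 := vint1_le hx M0 cN H.
have L s t : `|(cst x.1.2 + per_prim x.1.1) s - (cst x.1.2 + per_prim x.1.1) t| <= 2 * M * `|s - t|.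
  rewrite !fctE; have -> : x.1.2 + per_prim x.1.1 s - (x.1.2 + per_prim x.1.1 t) =
    per_prim x.1.1 s - per_prim x.1.1 t.
    by rewrite opprD addrACA subrr add0r.
  exact: b2.
have M3 : 2 * M <= 3 * M by rewrite ler_wpM2r// ler_nat.
split.
  split=> //; split=> //; apply/lip_memP; split; last by exists (2 * M).
  by move=> t; rewrite /= !fctE (per_prim_per x.1.1).
rewrite /= ge_max; apply/andP; split; last by lra.
rewrite ge_max; apply/andP; split; last first.
  apply: le_trans (ler_normD _ _) _; lra.
apply: lip_norm_le => [t|s t]; last by apply: le_trans (L s t) _; rewrite ler_wpM2r.
rewrite !fctE; apply: le_trans (ler_normD _ _) _.
have := b1 t; lra.
Qed.

Lemma Ce_norm1 k x : vmem (Ce R ny nmu k) x ->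
  [/\ forall t, `|x.1.1 t| <= vnorm (Ce R ny nmu k) x,
      `|x.1.2| <= vnorm (Ce R ny nmu k) x & `|x.2| <= vnorm (Ce R ny nmu k) x].
Proof.
move=> [[mw _] _]; split=> [t||]; rewrite /= !le_max ?lexx ?orbT//.
by rewrite (le_Cper_norm t mw (leq0n k)).
Qed.

Lemma Lop_Ce_bound x : vmem (Ce R ny nmu 0) x ->
  vmem (CeLip R ny nmu 0) (Lop x) /\
  vnorm (CeLip R ny nmu 0) (Lop x) <= 3 * vnorm (Ce R ny nmu 0) x.
Proof.
move=> mx; have [h1 h2 h3] := Ce_norm1 mx.
apply: (Lop_bound (N := set0)) => //; first exact: Ce_vintegrable.
exact: (ns_ge0 (normed_Ce R ny nmu 0)).
Qed.

Lemma CeLip_Ce0 x : vmem (CeLip R ny nmu 0) x -> vmem (Ce R ny nmu 0) x /\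
  vnorm (Ce R ny nmu 0) x <= vnorm (CeLip R ny nmu 0) x.
Proof.
move=> [[[mw K] _] _]; split; first by [].
by rewrite /= !ge_max !le_max !lexx ?orbT.
Qed.

Lemma Cper1_lip (v : R -> 'rV[R]_ny) : Cper_mem 1 v ->
  vmem (CperLip R ny 0) v /\ vnorm (CperLip R ny 0) v <= Cper_norm 1 v.
Proof.
move=> mv; have hv := Cper_hasd mv (ltn0Sn 0).
have N0 : 0 <= Cper_norm 1 v by apply: le_trans (le_Cper_norm 0 mv (leq0n 1)).
have L s t : `|v s - v t| <= Cper_norm 1 v * `|s - t|.
  have := @mvt_le R ny v _ t (s - t) 0 _ hv N0.
  rewrite scaler0 subr0 (addrC t) subrK; apply => x _.
  by rewrite subr0 le_Cper_norm.
split; last by apply: lip_norm_le => // t; exact: (le_Cper_norm t mv (leq0n 1)).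
by apply/lip_memP; split; [exact: Cper_periodic mv|exists (Cper_norm 1 v)].
Qed.

Lemma Ce1_CeLip x : vmem (Ce R ny nmu 1) x -> vmem (CeLip R ny nmu 0) x /\
  vnorm (CeLip R ny nmu 0) x <= vnorm (Ce R ny nmu 1) x.
Proof.
move=> [[mw _] _]; have [ml nl] := Cper1_lip mw; split; first by do 2!split.
have M (a b c d : R) : a <= b -> Num.max (Num.max a c) d <= Num.max (Num.max b c) d.
  by move=> ab; rewrite !ge_max !le_max ab !lexx ?orbT.
exact: M nl.
Qed.

End IntegralOperator.

(** * Finite-rank approximation *)

(* Stands in for compactness of i: it is what the Fredholm argument and the uniformity of
   continuity on a ball need. *)
Definition fin_approx (R : realType) (X Y : nspace R) (i : vcar X -> vcar Y) :=
  forall eta : R, 0 < eta -> exists (I : finType) (f : I -> vcar X -> R) (e : I -> vcar Y),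
  [/\ forall q, vmem Y (e q),
      forall q a u v, vmem X u -> vmem X v -> f q (a *: u + v) = a * f q u + f q v,
      forall q u, vmem X u -> `|f q u| <= vnorm X u &
      forall u, vmem X u -> vnorm Y (i u - \sum_q f q u *: e q) <= eta * vnorm X u].

Lemma pair_lin (R : realType) (U W : lmodType R) (a : R) (x x' : U) (y y' : W) :
  a *: (x, y) + (x', y') = (a *: x + x', a *: y + y').
Proof. by []. Qed.

Lemma pairB (R : realType) (U W : lmodType R) (x x' : U) (y y' : W) :
  (x, y) - (x', y') = (x - x', y - y').
Proof. by []. Qed.

Section FiniteApprox.
Variables (R : realType).

Lemma fin_approx_euclid n : @fin_approx R (euclid R n) (euclid R n) id.
Proof.
move=> eta eta0; exists 'I_n, (fun i (a : 'rV[R]_n) => a 0 i), (fun i => delta_mx 0 i).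
split=> //= [q a u v _ _|q u _|u _]; first by rewrite !mxE.
  exact: coord_le_norm.
by rewrite -row_sum_delta subrr normr0 mulr_ge0// ltW.
Qed.

Lemma fin_approx_prod (X Y X' Y' : nspace R) (i : vcar X -> vcar Y) (i' : vcar X' -> vcar Y') :
  normed X -> normed X' -> normed Y -> normed Y' ->
  fin_approx i -> fin_approx i' ->
  @fin_approx R (prod_ns X X') (prod_ns Y Y') (fun u => (i u.1, i' u.2)).
Proof.
move=> nX nX' nY nY' hi hi' eta eta0.
have [I [f [e [me lf bf ef]]]] := hi _ eta0.
have [I' [f' [e' [me' lf' bf' ef']]]] := hi' _ eta0.
exists (I + I')%type,
  (fun q u => match q with inl q => f q u.1 | inr q => f' q u.2 end),
  (fun q => match q with inl q => (e q, 0) | inr q => (0, e' q) end).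
split=> /=.
- by move=> [q|q]; split => //=; exact: mem0.
- by move=> [q|q] a u v [m1 m2] [m3 m4] /=; [rewrite lf|rewrite lf'].
- move=> [q|q] u [m1 m2] /=; rewrite le_max; apply/orP; [left; exact: bf|right; exact: bf'].
- move=> u [m1 m2]; rewrite big_sumType /=.
  have -> : \sum_q f q u.1 *: (e q, 0 : vcar Y') = (\sum_q f q u.1 *: e q, 0).
    by elim/big_rec2: _ => // q x y _ ->; rewrite pair_lin scaler0 add0r.
  have -> : \sum_q f' q u.2 *: (0 : vcar Y, e' q) = (0, \sum_q f' q u.2 *: e' q).
    by elim/big_rec2: _ => // q x y _ ->; rewrite pair_lin scaler0 add0r.
  rewrite /= addr0 add0r ge_max; apply/andP; split.
    by apply: le_trans (ef _ m1) _; rewrite ler_wpM2l ?(ltW eta0)// le_max lexx.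
  by apply: le_trans (ef' _ m2) _; rewrite ler_wpM2l ?(ltW eta0)// le_max lexx orbT.
Qed.

Definition dist_int (t : R) : R := Num.min (fpart t) (1 - fpart t).

Lemma dist_int_le t (k : int) : dist_int t <= `|t - k%:~R|.
Proof.
rewrite ge_min /fpart; have [kt|tk] := leP k (Num.floor t).
  have : (k%:~R : R) <= (Num.floor t)%:~R by rewrite ler_int.
  have := floor_le t => h1 h2; apply/orP; left; rewrite ger0_norm; lra.
have : ((Num.floor t + 1)%:~R : R) <= k%:~R by rewrite ler_int -ltzD1 ltrD2r.
have := floorD1_gt t; rewrite intrD => h1 h2; apply/orP; right.
by rewrite distrC ger0_norm; lra.
Qed.

Lemma dist_intE t : exists k : int, dist_int t = `|t - k%:~R|.
Proof.
have h1 := floor_le t; have h2 := floorD1_gt t.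
rewrite /dist_int /fpart; case: leP => _; first by exists (Num.floor t); rewrite ger0_norm ?subr_ge0.
exists (Num.floor t + 1); rewrite distrC ger0_norm ?subr_ge0 ?ltW//.
rewrite intrD; ring.
Qed.

Lemma dist_int_lip s t : dist_int t <= dist_int s + `|t - s|.
Proof.
have [k ->] := dist_intE s; apply: le_trans (dist_int_le t k) _.
by rewrite [leRHS]addrC; apply: ler_distD.
Qed.

Lemma dist_int_per : periodic1 dist_int.
Proof.
move=> t; apply/eqP; rewrite eq_le; apply/andP; split.
  have [k ->] := dist_intE t; apply: le_trans (dist_int_le _ (k + 1)) _.
  by rewrite intrD opprD addrACA subrr addr0.
have [k ->] := dist_intE (t + 1); apply: le_trans (dist_int_le _ (k - 1)) _.
by rewrite intrD mulrNz opprD opprK addrA addrAC.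
Qed.

(** The tent of half-width 1/N around k/N on the circle. Only its support and its positivity matter,
    since a partition of unity is obtained by dividing by the sum of the tents. *)
Definition hat (N k : nat) (t : R) : R := Num.max 0 (N%:R^-1 - dist_int (t - k%:R / N%:R)).

Lemma hat_ge0 N k t : 0 <= hat N k t.
Proof. by rewrite le_max lexx. Qed.

Lemma hat_per N k : periodic1 (hat N k).
Proof. by move=> t; rewrite /hat addrAC dist_int_per. Qed.

Lemma hat_continuous N k : continuous (hat N k).
Proof.
move=> t; apply/cvgrPdist_le => e e0; exists e => // s /= ts.
apply: le_trans (ltW ts); rewrite /hat.
have h1 := dist_int_lip (t - k%:R / N%:R) (s - k%:R / N%:R).
have h2 := dist_int_lip (s - k%:R / N%:R) (t - k%:R / N%:R).
have E1 : t - k%:R / N%:R - (s - k%:R / N%:R) = t - s by ring.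
have E2 : s - k%:R / N%:R - (t - k%:R / N%:R) = - (t - s) by ring.
rewrite E2 normrN in h1; rewrite E1 in h2.
have := normr_ge0 (t - s).
move: h1 h2; move: (dist_int _) (dist_int _) (`|t - s|) => a b c h1 h2 h3.
by rewrite ler_norml; case: (leP 0 (N%:R^-1 - b)) => ?; case: (leP 0 (N%:R^-1 - a)) => ?;
  apply/andP; split; lra.
Qed.

Lemma hat_pos N t : (0 < N)%N -> exists k : 'I_N, 0 < hat N k t.
Proof.
move=> N0; have N0' : 0 < N%:R :> R by rewrite ltr0n.
have h0 : 0 <= N%:R * fpart t by rewrite mulr_ge0// fpart_ge0.
set k := Num.truncn (N%:R * fpart t).
have /andP[k1 k2] := truncn_itv h0.
rewrite -/k in k1 k2.
have kN : (k < N)%N.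
  rewrite -(ltr_nat R); apply: le_lt_trans k1 _.
  by rewrite -[ltRHS]mulr1 ltr_pM2l// fpart_lt1.
exists (Ordinal kN); rewrite /hat lt_max ltxx /= subr_gt0.
apply: le_lt_trans (dist_int_le _ (Num.floor t)) _.
have -> : t - k%:R / N%:R - (Num.floor t)%:~R = fpart t - k%:R / N%:R by rewrite /fpart; ring.
rewrite ger0_norm ?subr_ge0 ?ler_pdivrMr// 1?mulrC//.
have : fpart t < (k%:R + 1) / N%:R by rewrite ltr_pdivlMr// mulrC natr1.
by rewrite mulrDl mul1r; lra.
Qed.

Lemma hat_near n (v : R -> 'rV[R]_n) N k t : (0 < N)%N -> vmem (CperLip R n 0) v ->
  0 < hat N k t -> `|v t - v (k%:R / N%:R)| <= N%:R^-1 * vnorm (CperLip R n 0) v.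
Proof.
move=> N0 mv; rewrite lt_max ltxx /= subr_gt0.
have [j ->] := dist_intE (t - k%:R / N%:R) => h.
have /lip_memP[pv _] := mv.
rewrite -(periodic_int pv j (k%:R / N%:R)); apply: le_trans (lip_norm2 _ _ mv) _.
rewrite mulrC ler_wpM2r//; last by rewrite opprD addrA ltW.
exact: (ns_ge0 (normed_CperLip R n)).
Qed.

(** The approximant is sum_k psi_k(t) u(k/N) with a partition of unity psi. Where psi_k is nonzero,
    t lies within 1/N of k/N, so the error is at most the Lipschitz norm of u divided by N. The
    functionals are the coordinates of point values. *)
Lemma fin_approx_lip n : @fin_approx R (CperLip R n 0) (Cper R n 0) id.
Proof.
move=> eta eta0.
pose N := (Num.truncn eta^-1).+1.
have N0 : (0 < N)%N by [].
have Neta : N%:R^-1 <= eta.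
  rewrite -[leRHS]invrK lef_pV2 ?posrE ?invr_gt0 ?ltr0n//.
  by apply: ltW; apply: truncnS_gt.
pose S t := \sum_(k < N) hat N k t.
have S0 t : 0 < S t.
  have [k hk] := hat_pos t N0; rewrite /S (bigD1 k)//= ltr_pwDl//.
  by apply: sumr_ge0 => i _; exact: hat_ge0.
pose psi (k : 'I_N) t := hat N k t / S t.
have psi0 k t : 0 <= psi k t by rewrite divr_ge0 ?hat_ge0 ?ltW.
have psi1 t : \sum_k psi k t = 1 by rewrite /psi -mulr_suml -/(S t) divff// gt_eqF.
exists ('I_N * 'I_n)%type,
  (fun (q : 'I_N * 'I_n) (v : R -> 'rV[R]_n) => v ((q.1 : nat)%:R / N%:R) 0 q.2),
  (fun (q : 'I_N * 'I_n) t => psi q.1 t *: delta_mx 0 q.2).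
split.
- move=> [k i] /=; split => //.
    by move=> t; rewrite /psi hat_per (_ : S (t + 1) = S t)//; apply: eq_bigr => j _; rewrite hat_per.
  rewrite derive1n0 => t.
  have Sc : {for t, continuous S}.
    rewrite /S; elim: (index_enum _) => [|j r IH].
      by rewrite (_ : (fun t => _) = fun=> 0); [exact: cvg_cst|apply/funext => x; rewrite big_nil].
    rewrite (_ : (fun t => _) = fun t => hat N j t + \sum_(k <- r) hat N k t).
      by apply: cvgD; [exact: hat_continuous|exact: IH].
    by apply/funext => x; rewrite big_cons.
  apply: cvgZ; last exact: cvg_cst.
  apply: cvgM; first exact: hat_continuous.
  by apply: cvgV => //; rewrite gt_eqF.
- by move=> q a u v _ _; rewrite !fctE !mxE.
- by move=> q u mu; apply: le_trans (coord_le_norm _ _) (lip_norm1 _ mu).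
- move=> u mu; apply: Cper_norm_le => j t; rewrite leqn0 => /eqP ->.
  rewrite derive1n0.
  have -> : (u - \sum_(q : 'I_N * 'I_n) u ((q.1 : nat)%:R / N%:R) 0 q.2 *: (fun t => psi q.1 t *: delta_mx 0 q.2)) t =
     \sum_(k < N) psi k t *: (u t - u ((k : nat)%:R / N%:R)).
    rewrite !fctE.
    have -> : (\sum_(q : 'I_N * 'I_n) u ((q.1 : nat)%:R / N%:R) 0 q.2 *: (fun t => psi q.1 t *: delta_mx 0 q.2)) t =
        \sum_(k < N) psi k t *: u ((k : nat)%:R / N%:R).
      rewrite fct_sumE; rewrite -(pair_bigA _ (fun (k : 'I_N) (i : 'I_n) => (u ((k : nat)%:R / N%:R) 0 i *: (fun t => psi k t *: delta_mx 0 i)) t)) /=.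
      apply: eq_bigr => k _; rewrite [in RHS](row_sum_delta (u ((k : nat)%:R / N%:R))) scaler_sumr.
      by apply: eq_bigr => i _; rewrite !fctE !scalerA mulrC.
    under [RHS]eq_bigr do rewrite scalerBr.
    by rewrite sumrB -scaler_suml psi1 scale1r.
  apply: le_trans (ler_norm_sum _ _ _) _.
  apply: (@le_trans _ _ (\sum_k psi k t * (eta * vnorm (CperLip R n 0) u))).
    apply: ler_sum => k _; rewrite normrZ (ger0_norm (psi0 _ _)).
    have [h0|] := ltP 0 (hat N k t).
      rewrite ler_wpM2l//; apply: le_trans (hat_near N0 mu h0) _.
      rewrite ler_wpM2r//; exact: (ns_ge0 (normed_CperLip R n)).
    move=> h; have -> : psi k t = 0.
      by rewrite /psi (_ : hat N k t = 0) ?mul0r//; apply/eqP; rewrite eq_le h hat_ge0.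
    by rewrite !mul0r.
  by rewrite -mulr_suml psi1 mul1r.
Qed.

End FiniteApprox.

(** * Piecewise interpolation *)

Section Mesh.
Variables (R : realType) (L : nat) (Cmsh : R) (tm : nat -> R).
Hypothesis mesh : is_mesh L Cmsh tm.

Lemma mesh_le i j : (i <= j)%N -> (j <= L)%N -> tm i <= tm j.
Proof.
have [_ _ h] := mesh; elim: j => [|j IH]; first by rewrite leqn0 => /eqP ->.
rewrite leq_eqVlt => /predU1P[->//|ij] jL.
by apply: le_trans (IH ij (ltnW jL)) _; have [/ltW] := h j jL.
Qed.

Lemma mesh01 i : (i <= L)%N -> 0 <= tm i <= 1.
Proof.
by move=> iL; have [<- <- _] := mesh; rewrite !mesh_le.
Qed.

Lemma mesh_cover t : 0 <= t <= 1 -> ~ range tm t ->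
  exists2 i : 'I_L, tm i < t < tm i.+1 & 0 <= t < 1.
Proof.
move=> /andP[t0 t1] nt; have [m0 mL h] := mesh.
have ne i : tm i != t by apply/eqP => E; apply: nt; exists i.
have t1' : t < 1 by rewrite lt_neqAle t1 andbT eq_sym -mL.
have [i iL it] : exists2 i, (i < L)%N & tm i < t < tm i.+1.
  suff H k : (k <= L)%N -> t < tm k -> exists2 i, (i < L)%N & tm i < t < tm i.+1.
    by apply: (H L) => //; rewrite mL.
  elim: k => [_|k IH kL tk]; first by rewrite m0; lra.
  have [kt|tk'] := ltP (tm k) t; first by exists k => //; rewrite kt.
  by apply: IH; [exact: ltnW|rewrite lt_neqAle eq_sym ne].
by exists (Ordinal iL) => //; rewrite t0.
Qed.

End Mesh.

Section Interpolant.
Variables (R : realType) (ny m : nat) (tc : 'I_m -> R).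
Hypotheses (tc_inj : injective tc) (tc01 : forall j, 0 < tc j < 1).
Local Notation V := 'rV[R]_ny.
Implicit Types z : R -> V.

(* An upper bound of the Lebesgue constant of the nodes tc. *)
Definition lebesgue_cst : R := \sum_j \sum_(q < m) `|(lagrange_poly tc j)`_q|.

Lemma lebesgue_cst_ge0 : 0 <= lebesgue_cst.
Proof. by do 2!apply: sumr_ge0 => ? _. Qed.

Lemma horner_le (p : {poly R}) (x : R) : (size p <= m)%N -> 0 <= x <= 1 ->
  `|p.[x]| <= \sum_(q < m) `|p`_q|.
Proof.
move=> sp /andP[x0 x1]; rewrite (horner_coef_wide x sp).
apply: le_trans (ler_norm_sum _ _ _) _; apply: ler_sum => q _.
by rewrite normrM ler_piMr// normrX exprn_ile1// ger0_norm.
Qed.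

Lemma lagrange_sum_le x (y : 'I_m -> V) M : 0 <= x <= 1 -> (forall j, `|y j| <= M) ->
  `|\sum_j (lagrange_poly tc j).[x] *: y j| <= lebesgue_cst * M.
Proof.
move=> x01 H; apply: le_trans (ler_norm_sum _ _ _) _.
rewrite /lebesgue_cst mulr_suml; apply: ler_sum => j _; rewrite normrZ.
by apply: ler_pM => //; apply: horner_le => //; exact: size_lagrange_poly.
Qed.

Lemma lagrange_reproduce (c : nat -> V) x :
  \sum_j (lagrange_poly tc j).[x] *: \sum_(p < m) tc j ^+ p *: c p =
  \sum_(p < m) x ^+ p *: c p.
Proof.
under [RHS]eq_bigr => p _ do rewrite (coef_interp tc_inj c (ltn_ord p)) scaler_sumr.
rewrite exchange_big /=; apply: eq_bigr => j _.
rewrite (horner_coef_wide x (size_lagrange_poly tc j)) scaler_suml.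
by apply: eq_bigr => p _; rewrite scalerA mulrC.
Qed.

Variables (L : nat) (Cmsh : R) (tm : nat -> R).
Hypothesis mesh : is_mesh L Cmsh tm.

Lemma PL_at z t (i : 'I_L) : 0 <= t < 1 -> tm i < t < tm i.+1 ->
  PL tc L tm z t = \sum_j (lagrange_poly tc j).[(t - tm i) / (tm i.+1 - tm i)] *:
    z (tm i + (tm i.+1 - tm i) * tc j).
Proof.
move=> t01 /andP[it ti]; rewrite /PL fpart_id// (bigD1 i)//= [X in _ + X]big1 ?addr0.
  apply: eq_bigr => j _; rewrite indicE mem_set ?mul1r//=.
  by rewrite in_itv /= it ti.
move=> k ki; apply: big1 => j _; rewrite indicE memNset ?mul0r ?scale0r//=.
rewrite in_itv /= => /andP[kt tk].
have [ik|ki'] := ltnP i k.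
  by have := mesh_le mesh ik (ltnW (ltn_ord k)); lra.
have {}ki' : (k < i)%N by rewrite ltn_neqAle ki' andbT.
by have := mesh_le mesh ki' (ltnW (ltn_ord i)); lra.
Qed.

Lemma PL_lin (a : R) y z : PL tc L tm (a *: y + z) = a *: PL tc L tm y + PL tc L tm z.
Proof.
apply/funext => t; rewrite !fctE /PL scaler_sumr -big_split /=; apply: eq_bigr => i _.
rewrite scaler_sumr -big_split /=; apply: eq_bigr => j _.
by rewrite scalerDr !scalerA mulrC.
Qed.

Lemma mesh_ratio t (i : 'I_L) : tm i < t < tm i.+1 ->
  0 <= (t - tm i) / (tm i.+1 - tm i) <= 1.
Proof.
move=> /andP[it ti]; have h0 : 0 < tm i.+1 - tm i by lra.
by rewrite divr_ge0 ?ler_pdivrMr//; lra.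
Qed.

Lemma PL_bound z M t : 0 <= t <= 1 -> ~ range tm t -> (forall s, `|z s| <= M) ->
  `|PL tc L tm z t| <= lebesgue_cst * M.
Proof.
move=> t01 nt H; have [i it t01'] := mesh_cover mesh t01 nt.
by rewrite (PL_at z t01' it); apply: lagrange_sum_le => //; exact: mesh_ratio.
Qed.

(** A polynomial p of degree less than m is reproduced on each mesh interval, so the error there
    equals the interpolant of z - p minus z - p. The polynomial may change from one interval to the
    next. *)
Lemma PL_error z eps t : 0 <= t <= 1 -> ~ range tm t ->
  (forall i, (i < L)%N -> exists c : nat -> V, forall s, 0 <= s <= tm i.+1 - tm i ->
     `|z (tm i + s) - \sum_(p < m) s ^+ p *: c p| <= eps) ->
  `|PL tc L tm z t - z t| <= (lebesgue_cst + 1) * eps.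
Proof.
move=> t01 nt H; have [i it t01'] := mesh_cover mesh t01 nt.
have [c hc] := H i (ltn_ord i).
have x01 := mesh_ratio it.
rewrite (PL_at z t01' it).
set h := tm i.+1 - tm i in hc x01 *; set x := (t - tm i) / h in x01 *.
have h0 : 0 < h by rewrite /h; move/andP: it => []; lra.
have -> : \sum_j (lagrange_poly tc j).[x] *: z (tm i + h * tc j) - z t =
  \sum_j (lagrange_poly tc j).[x] *: (z (tm i + h * tc j) - \sum_(p < m) (h * tc j) ^+ p *: c p)
  - (z (tm i + (t - tm i)) - \sum_(p < m) (t - tm i) ^+ p *: c p).
  under [in RHS]eq_bigr do rewrite scalerBr.
  rewrite sumrB.
  have -> : \sum_j (lagrange_poly tc j).[x] *: \sum_(p < m) (h * tc j) ^+ p *: c p =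
     \sum_(p < m) (t - tm i) ^+ p *: c p.
    have -> : t - tm i = h * x by rewrite /x mulrC divfK// gt_eqF.
    (* Passing to the unit interval rescales the coefficients by h^p. *)
    have E y : \sum_(p < m) (h * y) ^+ p *: c p = \sum_(p < m) y ^+ p *: (h ^+ p *: c p).
      by apply: eq_bigr => p _; rewrite scalerA exprMn mulrC.
    rewrite E -(lagrange_reproduce (fun p => h ^+ p *: c p)).
    by apply: eq_bigr => j _; rewrite E.
  by rewrite (addrC (tm i)) subrK opprB [in RHS]addrA subrK.
rewrite mulrDl mul1r; apply: le_trans (ler_normB _ _) _; apply: lerD.
  apply: lagrange_sum_le => // j; apply: hc.
  have /andP[j0 j1] := tc01 j.
  apply/andP; split; first by apply: mulr_ge0; exact: ltW.
  by apply: ler_piMr; exact: ltW.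
by apply: hc; move/andP: it => []; rewrite /h; lra.
Qed.

Lemma PL_vintegrable z : vintegrable (PL tc L tm z).
Proof.
have [M M0 HM] : exists2 M : R, 0 <= M &
    forall (i : 'I_L) (j : 'I_m), `|z (tm i + (tm i.+1 - tm i) * tc j)| <= M.
  exists (\sum_(i < L) \sum_(j < m) `|z (tm i + (tm i.+1 - tm i) * tc j)|).
    by apply: sumr_ge0 => i _; apply: sumr_ge0.
  move=> i j; rewrite (bigD1 i)//= (bigD1 j)//= -addrA lerDl addr_ge0//.
    by apply: sumr_ge0.
  by apply: sumr_ge0 => k _; apply: sumr_ge0.
have [m0 mL _] := mesh.
apply: (@vintegrable_bounded _ _ _ (lebesgue_cst * M)) => [t t01|k].
  have [[i it]|nt] := pselect (exists i : 'I_L, tm i < fpart t < tm i.+1).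
    have f01 : 0 <= fpart t < 1 by rewrite fpart_ge0 fpart_lt1.
    have -> : PL tc L tm z t = PL tc L tm z (fpart t) by rewrite /PL (fpart_id f01).
    rewrite (PL_at z f01 it); apply: lagrange_sum_le => //.
    exact: mesh_ratio.
  rewrite /PL big1 ?normr0 ?mulr_ge0 ?lebesgue_cst_ge0// => i _.
  rewrite big1// => j _; rewrite indicE memNset ?mul0r ?scale0r//= in_itv /= => it.
  by apply: nt; exists i.
(* [F] replaces [fpart t] by t, which makes measurability elementary. On [0, 1] this changes
   nothing: at t = 1 both versions vanish, as neither 0 nor 1 lies in an open mesh interval. *)
pose F (t : R) : R := \sum_(i < L) \sum_(j < m) ((\1_(`]tm i, tm i.+1[) t *
   (lagrange_poly tc j).[(t - tm i) / (tm i.+1 - tm i)]) *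
   z (tm i + (tm i.+1 - tm i) * tc j) 0 k).
apply: (eq_measurable_fun F).
  move=> t; rewrite inE /= in_itv /= => /andP[t0 t1].
  rewrite /F /PL summxE; apply: eq_bigr => i _; rewrite summxE; apply: eq_bigr => j _.
  rewrite !mxE; congr (_ * _).
  have [t1'|] := ltP t 1; first by rewrite fpart_id// t0.
  move=> t1'; have {t0 t1 t1'}-> : t = 1 by apply/eqP; rewrite eq_le t1 t1'.
  have f1 : fpart (1 : R) = 0.
    by have := @fpart_int R 0 1; rewrite add0r; apply; rewrite lexx ltr01.
  rewrite f1 !indicE !memNset ?mul0r//= in_itv /=.
    have /andP[i0 _] := mesh01 mesh (ltnW (ltn_ord i)); rewrite ltNge i0//.
  have /andP[_ i1] := mesh01 mesh (ltn_ord i).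
  by rewrite [1 < _]ltNge i1 andbF.
apply: measurable_sum => i; apply: measurable_sum => j.
apply: measurable_funM; last exact: measurable_cst.
apply: measurable_funM; first exact: measurable_indic.
apply: measurable_funTS; apply: continuous_measurable_fun => t.
apply: (continuous_comp (f := fun t => (t - tm i) / (tm i.+1 - tm i))
  (g := horner (lagrange_poly tc j))); last exact: continuous_horner.
apply: cvgM; last exact: cvg_cst.
by apply: cvgB; [exact: cvg_id|exact: cvg_cst].
Qed.

End Interpolant.

(** Pointwise convergence is uniform on finite sets, which is all that [polyfun_lim] asks for. *)
Lemma polyfun_cvg (R : realType) d n (f : R -> 'rV[R]_d) (g : R -> R -> 'rV[R]_d) :
  (forall eta, 0 < eta -> polyfun n (g eta)) ->
  (forall s (e : R), 0 < e -> exists2 eta0 : R, 0 < eta0 &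
     forall eta, 0 < eta <= eta0 -> `|f s - g eta s| <= e) ->
  polyfun n f.
Proof.
move=> pg H; apply: polyfun_lim => S e e0.
suff [eta eta0 Heta] : exists2 eta0 : R, 0 < eta0 &
    forall eta, 0 < eta <= eta0 -> forall s, s \in S -> `|f s - g eta s| <= e.
  exists (g eta); first exact: pg.
  by apply: Heta; rewrite eta0 lexx.
elim: S => [|s S [eta1 eta10 IH]]; first by exists 1.
have [eta2 eta20 H2] := H s e e0.
exists (Num.min eta1 eta2); first by rewrite lt_min eta10.
move=> eta; rewrite le_min => /and3P[p0 p1 p2] x; rewrite inE => /predU1P[->|xS].
  by apply: H2; rewrite p0.
by apply: IH => //; rewrite p0.
Qed.

(** * The extended derivatives *)

Section Multilinear.
Variables (R : realType) (X : nspace R) (m : nat) (j : nat).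
Variable A : ('I_j -> vcar X) -> 'rV[R]_m.
Hypotheses (hX : normed X) (hA : @bounded_multilinear R X (euclid R m) j A).

Lemma update_linear w i : (forall i', vmem X (w i')) ->
  @ns_linear R X (euclid R m) (fun h => A (update w i h)).
Proof. by move=> mw a u v mu mv; have [_ -> //] := hA. Qed.

Lemma update_mem (w : 'I_j -> vcar X) i h : (forall i', vmem X (w i')) -> vmem X h ->
  forall i', vmem X (update w i h i').
Proof. by move=> mw mh i'; rewrite /update; case: ifP. Qed.

(** The arguments are replaced one at a time by the polynomial curve. Expanding the k-th argument by
    linearity multiplies by powers of s up to n, so the degree grows by n at each step. *)
Lemma multilinear_poly n (a : nat -> vcar X) : (forall p, vmem X (a p)) ->
  polyfun (j * n).+1 (fun s => A (fun=> \sum_(p < n.+1) s ^+ p *: a p)).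
Proof.
move=> ma; pose c s := \sum_(p < n.+1) s ^+ p *: a p.
have mc s : vmem X (c s) by apply: mem_sum => // p; exact: memZ.
suff H k : (k <= j)%N -> forall w, (forall i, vmem X (w i)) ->
    polyfun (k * n).+1 (fun s => A (fun i : 'I_j => if (i < k)%N then c s else w i)).
  have := H j (leqnn j) (fun=> 0) (fun=> mem0 hX).
  by congr polyfun; apply/funext => s; congr A; apply/funext => i; rewrite ltn_ord.
elim: k => [_ w mw|k IH kj w mw].
  by exists (fun=> A w) => s; rewrite mul0n big_ord1 expr0 scale1r.
pose i0 := Ordinal kj.
have E s : A (fun i : 'I_j => if (i < k.+1)%N then c s else w i) =
    \sum_(p < n.+1) s ^+ p *: A (fun i : 'I_j => if (i < k)%N then c s else update w i0 (a p) i).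
  pose W (i : 'I_j) := if (i < k)%N then c s else w i.
  have mW i : vmem X (W i) by rewrite /W; case: ifP.
  have W1 x : (fun i : 'I_j => if (i < k)%N then c s else update w i0 x i) = update W i0 x.
    apply/funext => i; rewrite /update /W; case: eqVneq => [->|//].
    by rewrite ltnn.
  have -> : (fun i : 'I_j => if (i < k.+1)%N then c s else w i) = update W i0 (c s).
    apply/funext => i; rewrite /update /W; case: eqVneq => [->|]; first by rewrite ltnSn.
    by move=> ii; rewrite ltnS leq_eqVlt (_ : (i == k :> nat) = false)//; exact: negbTE.
  under eq_bigr do rewrite W1.
  have lin := update_linear i0 mW.
  rewrite (lin_sum hX lin); last by move=> p; exact: memZ.
  by apply: eq_bigr => p _; rewrite (linZ hX lin).
rewrite (_ : (fun s => _) = fun s => \sum_(p < n.+1) s ^+ p *: A (fun i : 'I_j => if (i < k)%N then c s else update w i0 (a p) i)); last first.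
  by apply/funext => s; exact: E.
apply: polyfun_sum => p.
have := polyfun_mul p (IH (ltnW kj) (update w i0 (a p)) (update_mem i0 mw (ma p))).
by apply: polyfun_widen; rewrite addSn ltnS mulSn addnC leq_add2r -ltnS.
Qed.

Lemma multilinear_homog s d : vmem X d -> A (fun=> s *: d) = s ^+ j *: A (fun=> d).
Proof.
move=> md.
suff H k : (k <= j)%N -> A (fun i : 'I_j => if (i < k)%N then s *: d else d) = s ^+ k *: A (fun=> d).
  rewrite -H//; congr A; apply/funext => i; by rewrite ltn_ord.
elim: k => [_|k IH kj]; first by rewrite expr0 scale1r.
pose i0 := Ordinal kj; pose W (i : 'I_j) := if (i < k)%N then s *: d else d.
have mW (i : 'I_j) : vmem X (W i) by rewrite /W; case: ifP => // _; exact: memZ.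
have -> : (fun i : 'I_j => if (i < k.+1)%N then s *: d else d) = update W i0 (s *: d).
  apply/funext => i; rewrite /update /W; case: eqVneq => [->|]; first by rewrite ltnSn.
  by move=> ii; rewrite ltnS leq_eqVlt (_ : (i == k :> nat) = false)//; exact: negbTE.
rewrite (linZ hX (update_linear i0 mW))// exprS -scalerA -IH ?(ltnW kj)//; congr (_ *: A _).
by apply/funext => i; rewrite /update /W; case: eqVneq => [->|//]; rewrite ltnn.
Qed.

End Multilinear.

Section LineDerivatives.
Variables (R : realType) (X : nspace R) (m l : nat) (G : vcar X -> 'rV[R]_m).
Variable D : forall j, vcar X -> ('I_j -> vcar X) -> 'rV[R]_m.
Hypotheses (hX : normed X) (hD : @is_Ck_family R X (euclid R m) G l D).

Lemma line_hasd u d j : vmem X u -> vmem X d -> (j < l)%N ->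
  has_deriv (fun th : R => D (j := j) (u + th *: d) (fun=> d)) (fun th => D (j := j.+1) (u + th *: d) (fun=> d)).
Proof.
move=> mu md jl; have [_ hm hF _] := hD.
move=> t e e0.
have mut : vmem X (u + t *: d) by apply: memD => //; exact: memZ.
set P := \prod_(i < j) vnorm X d.
have N0 := ns_ge0 hX md.
have P0 : 0 <= P by apply: prodr_ge0.
have k0 : 0 < vnorm X d * P + 1 by rewrite ltr_pwDr// mulr_ge0.
have [del del0 Hd] := hF j _ jl mut (e / (vnorm X d * P + 1)) (divr_gt0 e0 k0).
exists (del / (vnorm X d + 1)); first by rewrite divr_gt0// ltr_pwDr.
move=> h; rewrite ltr_pdivlMr ?ltr_pwDr// => hdel.
have mhd : vmem X (h *: d) by exact: memZ.
have Nhd : vnorm X (h *: d) < del.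
  by rewrite (nsZ hX)//; apply: le_lt_trans hdel; rewrite ler_wpM2l// lerDl.
have := Hd (h *: d) (fun=> d) mhd Nhd (fun=> md).
have -> : u + t *: d + h *: d = u + (t + h) *: d by rewrite scalerDl addrA.
(* The increment enters as slot 0 and all other slots hold d, so the scalar h comes out by linearity
   in that slot. *)
have -> : vcons (h *: d) (fun=> d) = update (fun=> d) ord0 (h *: d) :> ('I_j.+1 -> vcar X).
  apply/funext => i; rewrite /vcons /update.
  by case: unliftP => [i' ->|->]; rewrite ?eqxx// eq_sym (negbTE (neq_lift _ _)).
have mlin := hm j.+1 _ jl mut.
rewrite (linZ hX (update_linear mlin ord0 (fun=> md)))//.
have -> : update (fun=> d) ord0 d = (fun=> d) :> ('I_j.+1 -> vcar X).
  by apply/funext => i; rewrite /update; case: ifP.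
move=> /le_trans; apply; rewrite (nsZ hX)// -/P.
have -> : e / (vnorm X d * P + 1) * (`|h| * vnorm X d) * P =
  e * `|h| * ((vnorm X d * P) / (vnorm X d * P + 1)) by ring.
by rewrite ler_piMr ?mulr_ge0 ?(ltW e0)// ler_pdivrMr// mul1r lerDl.
Qed.

Lemma line_derive1n u d j : vmem X u -> vmem X d -> (j <= l)%N ->
  derive1n j (fun th : R => G (u + th *: d)) = fun th => D (j := j) (u + th *: d) (fun=> d).
Proof.
move=> mu md; elim: j => [_|j IH jl].
  rewrite derive1n0; apply/funext => th; have [-> //] := hD.
  by apply: memD => //; exact: memZ.
by rewrite derive1nS IH ?(ltnW jl)//; apply/hasd_derive1/line_hasd.
Qed.

End LineDerivatives.

Lemma Xsp_dense (R : realType) ny nmu k (u : (R -> 'rV[R]_ny) * 'rV[R]_nmu) (e : R) :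
  vmem (Xsp R ny nmu k) u -> 0 < e ->
  exists2 u', vmem (Xsp R ny nmu k.+1) u' & vnorm (Xsp R ny nmu k) (u' - u) <= e.
Proof.
case: u => v mu [/= mv _] e0; have [d d0 Hd] := steklov_close mv e0.
have h0 : 0 < d / 2 by rewrite divr_gt0.
exists (steklov (d / 2) v, mu).
  by split => //=; have [] := steklov_Cper (d / 2) mv.
rewrite /= subrr normr0 ge_max (ltW e0) andbT; apply: Hd; apply/andP; split=> //; lra.
Qed.

Section Extension.
Variables (R : realType) (ny nmu l : nat).
Local Notation fn := (R -> 'rV[R]_ny).
Local Notation XT := (fn * 'rV[R]_nmu)%type.
Variable G : XT -> 'rV[R]_ny.
Variable D : forall j, XT -> ('I_j -> XT) -> 'rV[R]_ny.
Variable E : XT * XT -> 'rV[R]_ny.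
Local Notation Xl := (Xsp R ny nmu l.+1).
Local Notation Xl1 := (Xsp R ny nmu l).
Hypothesis hD : @is_Ck_family R Xl (euclid R ny) G l.+1 D.
Hypothesis cE : @ns_continuous R (prod_ns Xl Xl1) (euclid R ny) E.
Hypothesis EE : forall u d, vmem Xl u -> vmem Xl d -> E (u, d) = D (j := l.+1) u (fun=> d).

Let nX := normed_Xsp R ny nmu l.+1.
Let nX1 := normed_Xsp R ny nmu l.

Lemma Xsp_sub k (u : XT) : vmem (Xsp R ny nmu k.+1) u -> vmem (Xsp R ny nmu k) u.
Proof. by move=> [mv _]; split => //; exact: Cper_le (leqnSn k) mv. Qed.

Lemma ext_cont2 u d e : vmem Xl u -> vmem Xl1 d -> 0 < e ->
  exists2 eta : R, 0 < eta & forall d', vmem Xl1 d' -> vnorm Xl1 (d' - d) < eta ->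
    `|E (u, d') - E (u, d)| <= e.
Proof.
move=> mu md e0; have [_ c] := cE.
have [eta eta0 H] := c (u, d) (conj mu md) e e0.
exists eta => // d' md' dd; apply/ltW/H; first by split.
change (Num.max (vnorm Xl (u - u)) (vnorm Xl1 (d' - d)) < eta).
by rewrite subrr (ns0 nX) gt_max eta0.
Qed.

(** Directions in the weaker space are limits of smooth ones, for which E is the multilinear
    derivative and hence polynomial along the curve. The degree does not depend on the
    approximation, so the property survives the limit. *)
Lemma ext_polyfun u n (a : nat -> XT) : vmem Xl u -> (forall p, vmem Xl1 (a p)) ->
  polyfun (l.+1 * n).+1 (fun s => E (u, \sum_(p < n.+1) s ^+ p *: a p)).
Proof.
move=> mu ma.
have /choice[b Hb] : forall eta : R, exists b : nat -> XT, 0 < eta ->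
    forall p, vmem Xl (b p) /\ vnorm Xl1 (b p - a p) <= eta.
  move=> eta; have [eta0|_] := ltP 0 eta; last by exists (fun=> 0).
  have /choice[b Hb] : forall p, exists b : XT, vmem Xl b /\ vnorm Xl1 (b - a p) <= eta.
    by move=> p; have [b mb hb] := Xsp_dense (ma p) eta0; exists b.
  by exists b.
apply: (@polyfun_cvg _ _ _ _ (fun eta s => E (u, \sum_(p < n.+1) s ^+ p *: b eta p))).
  move=> eta eta0.
  have mb p : vmem Xl (b eta p) by have [] := Hb eta eta0 p.
  have := @multilinear_poly R Xl ny l.+1 (D (j := l.+1) u) nX _ n (b eta) mb.
  move=> /(_ _)-H; have [_ hm _ _] := hD.
  have := H (hm l.+1 u (leqnn _) mu); congr polyfun; apply/funext => s.
  apply/esym/(EE mu); apply: (mem_sum nX) => p; apply: (memZ nX); exact: mb.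
move=> s e e0.
have ms (c : nat -> XT) : (forall p, vmem Xl1 (c p)) -> vmem Xl1 (\sum_(p < n.+1) s ^+ p *: c p).
  by move=> mc; apply: mem_sum => // p; exact: memZ.
have [eta eta0 H] := ext_cont2 mu (ms a ma) e0.
pose K := \sum_(p < n.+1) `|s ^+ p| + 1.
have K0 : 0 < K by rewrite ltr_pwDr//; apply: sumr_ge0.
exists (eta / 2 / K); first by rewrite !divr_gt0.
move=> x /andP[x0 xK].
have mb p : vmem Xl1 (b x p) by apply: Xsp_sub; have [] := Hb x x0 p.
rewrite distrC; apply: H; first exact: ms.
rewrite -sumrB; under eq_bigr do rewrite -scalerBr.
have mba p : vmem Xl1 (b x p - a p) by exact: memB.
apply: le_lt_trans (ns_sum nX1 _) _; first by move=> p; exact: memZ.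
apply: (@le_lt_trans _ _ (\sum_(p < n.+1) `|s ^+ p| * x)).
  by apply: ler_sum => p _; rewrite (nsZ nX1)// ler_wpM2l//; have [] := Hb x x0 p.
rewrite -mulr_suml; apply: (@le_lt_trans _ _ (K * (eta / 2 / K))).
  by apply: ler_pM; rewrite ?sumr_ge0 ?(ltW x0)// lerDl.
by rewrite mulrC divfK ?gt_eqF//; lra.
Qed.

Lemma ext_homog u d s : vmem Xl u -> vmem Xl1 d -> E (u, s *: d) = s ^+ l.+1 *: E (u, d).
Proof.
move=> mu md; apply/eqP; rewrite -subr_eq0 -normr_le0; apply/ler_addgt0 => e e0; rewrite add0r.
pose K := `|s ^+ l.+1| + 1; have K0 : 0 < K by rewrite ltr_pwDr.
have [eta1 eta10 H1] := ext_cont2 mu (memZ nX1 s md) (half_gt0 e0).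
have [eta2 eta20 H2] := ext_cont2 mu md (divr_gt0 (half_gt0 e0) K0).
pose x := Num.min (eta1 / (`|s| + 1)) eta2 / 2.
have x0 : 0 < x by rewrite divr_gt0// lt_min eta20 divr_gt0// ltr_pwDr.
have x1 : x < eta1 / (`|s| + 1).
  by apply: (@lt_le_trans _ _ (Num.min (eta1 / (`|s| + 1)) eta2)); [rewrite /x in x0 *; lra|rewrite ge_min lexx].
have x2 : x < eta2.
  by apply: (@lt_le_trans _ _ (Num.min (eta1 / (`|s| + 1)) eta2)); [rewrite /x in x0 *; lra|rewrite ge_min lexx orbT].
have [b mb hb] := Xsp_dense md x0.
have mb1 := Xsp_sub mb.
have h2 := H2 b mb1 (le_lt_trans hb x2).
have h1 : `|E (u, s *: b) - E (u, s *: d)| <= e / 2.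
  apply: H1; first exact: memZ.
  rewrite -scalerBr (nsZ nX1); last exact: memB.
  move: x1; rewrite ltr_pdivlMr ?ltr_pwDr// => x1; apply: le_lt_trans x1.
  by rewrite mulrC; apply: ler_pM => //; [apply: (ns_ge0 nX1); exact: memB|rewrite lerDl].
have Eb : E (u, s *: b) = s ^+ l.+1 *: E (u, b).
  rewrite (EE mu (memZ nX s mb)) (EE mu mb).
  have [_ hm _ _] := hD.
  exact: (multilinear_homog nX (hm l.+1 u (leqnn _) mu) s mb).
have -> : E (u, s *: d) - s ^+ l.+1 *: E (u, d) =
  s ^+ l.+1 *: (E (u, b) - E (u, d)) - (E (u, s *: b) - E (u, s *: d)).
  by rewrite Eb scalerBr opprB [in RHS]addrC [in RHS]addrA subrK.
apply: le_trans (ler_normB _ _) _; rewrite [e]splitr lerD// normrZ.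
apply: (@le_trans _ _ (K * (e / 2 / K))); last by rewrite mulrC divfK// gt_eqF.
by apply: ler_pM => //; rewrite lerDl.
Qed.

Lemma ext_line u d th : vmem Xl u -> vmem Xl d ->
  derive1n l.+1 (fun th : R => G (u + th *: d)) th = E (u + th *: d, d).
Proof.
move=> mu md; have mt : vmem Xl (u + th *: d) := memD nX mu (memZ nX th md).
etransitivity; last exact: (esym (EE mt md)).
exact: (congr1 (fun f : R -> 'rV[R]_ny => f th) (line_derive1n nX hD mu md (leqnn l.+1))).
Qed.

Lemma ext_line_hasd u d j : vmem Xl u -> vmem Xl d -> (j < l.+1)%N ->
  has_deriv (derive1n j (fun th : R => G (u + th *: d))) (derive1n j.+1 (fun th : R => G (u + th *: d))).
Proof.
move=> mu md jl.
have E1 := line_derive1n nX hD mu md (ltnW jl).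
have E2 := line_derive1n nX hD mu md jl.
have := line_hasd nX hD mu md jl.
by move=> /hasd_ext; apply => t; [exact: (congr1 (fun f : R -> 'rV[R]_ny => f t) E1)|
  exact: (congr1 (fun f : R -> 'rV[R]_ny => f t) E2)].
Qed.

End Extension.

(* E (u, d) stands for the continuous extension of D^(l+1) G(u) (d, ..., d). The D of mild
   differentiability is not extended itself; being polynomial and homogeneous in d is what
   survives of its multilinearity. *)
Record ext_spec (R : realType) (ny nmu l : nat)
    (G : (R -> 'rV[R]_ny) * 'rV[R]_nmu -> 'rV[R]_ny)
    (E : ((R -> 'rV[R]_ny) * 'rV[R]_nmu) * ((R -> 'rV[R]_ny) * 'rV[R]_nmu) -> 'rV[R]_ny) := ExtSpec {
  es_cont : @ns_continuous R (prod_ns (Xsp R ny nmu l.+1) (Xsp R ny nmu l)) (euclid R ny) E;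
  es_poly : forall u n (a : nat -> (R -> 'rV[R]_ny) * 'rV[R]_nmu),
    vmem (Xsp R ny nmu l.+1) u -> (forall p, vmem (Xsp R ny nmu l) (a p)) ->
    polyfun (l.+1 * n).+1 (fun s => E (u, \sum_(p < n.+1) s ^+ p *: a p));
  es_homog : forall u d s, vmem (Xsp R ny nmu l.+1) u -> vmem (Xsp R ny nmu l) d ->
    E (u, s *: d) = s ^+ l.+1 *: E (u, d);
  es_line : forall u d th, vmem (Xsp R ny nmu l.+1) u -> vmem (Xsp R ny nmu l.+1) d ->
    derive1n l.+1 (fun th : R => G (u + th *: d)) th = E (u + th *: d, d);
  es_hasd : forall u d j, vmem (Xsp R ny nmu l.+1) u -> vmem (Xsp R ny nmu l.+1) d ->
    (j < l.+1)%N ->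
    has_deriv (derive1n j (fun th : R => G (u + th *: d))) (derive1n j.+1 (fun th : R => G (u + th *: d))) }.

Lemma mild_ext (R : realType) ny nmu lmax (G : (R -> 'rV[R]_ny) * 'rV[R]_nmu -> 'rV[R]_ny) l :
  mildly_differentiable lmax G -> (l < lmax)%N -> exists E, ext_spec l G E.
Proof.
move=> hG ll; have [D [hD hE]] := hG l.+1 ll; have [E [cE EE]] := hE isT.
exists E; split=> //.
- exact: ext_polyfun hD cE EE.
- exact: ext_homog hD cE EE.
- exact: ext_line hD EE.
- exact: ext_line_hasd hD.
Qed.

Lemma mild_cont (R : realType) ny nmu lmax (G : (R -> 'rV[R]_ny) * 'rV[R]_nmu -> 'rV[R]_ny) :
  mildly_differentiable lmax G -> @ns_continuous R (Xsp R ny nmu 0) (euclid R ny) G.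
Proof.
move=> hG; have [D [[D0 _ _ cD] _]] := hG 0%N (leq0n _).
split=> // u mu e e0; have [d d0 Hd] := cD u mu (e / 2) (half_gt0 e0).
exists d => // u' mu' ud.
have := Hd u' (fun=> 0) mu' ud; rewrite big_ord0 mulr1 !D0//.
move=> /(_ _)-H; apply: le_lt_trans (H _) _; last by lra.
by case.
Qed.

Lemma nsZ_le (R : realType) (X : nspace R) (hX : normed X) (a : R) u : vmem X u ->
  vnorm X (a *: u) <= `|a| * vnorm X u.
Proof. by move=> mu; rewrite (nsZ hX). Qed.

Lemma ns_lincomb (R : realType) (X : nspace R) (hX : normed X) n (c : nat -> R)
    (a : nat -> vcar X) : (forall p, vmem X (a p)) ->
  vmem X (\sum_(p < n) c p *: a p) /\
  vnorm X (\sum_(p < n) c p *: a p) <= \sum_(p < n) `|c p| * vnorm X (a p).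
Proof.
move=> ma; split; first by apply: (mem_sum hX) => p; exact: memZ.
apply: le_trans (ns_sum hX _) _; first by move=> p; exact: memZ.
by apply: ler_sum => p _; rewrite (nsZ hX).
Qed.

(** * Estimates uniform along the curve t -> v_t *)

Section Curves.
Variables (R : realType) (Z : nspace R).
Hypothesis nZ : normed Z.

Definition ucont (g : R -> vcar Z) := forall e : R, 0 < e ->
  exists2 d : R, 0 < d & forall t h, `|h| < d -> vnorm Z (g (t + h) - g t) <= e.

(** The image of a periodic curve is compact, so one modulus of continuity of F serves all its
    points; z need not lie on the curve. *)
Lemma unif_curve n (F : vcar Z -> 'rV[R]_n) (g : R -> vcar Z) :
  @ns_continuous R Z (euclid R n) F -> (forall t, vmem Z (g t)) -> periodic1 g -> ucont g ->
  forall e, 0 < e -> exists2 d : R, 0 < d &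
    forall t z, vmem Z z -> vnorm Z (z - g t) < d -> `|F z - F (g t)| <= e.
Proof.
move=> [_ cF] mg pg cg e e0.
have [||d d0 H] := @unif_per R (fun d t => forall z, vmem Z z -> vnorm Z (z - g t) < d -> `|F z - F (g t)| <= e).
- by move=> d t; rewrite pg.
- move=> t; have [d1 d10 H1] := cF (g t) (mg t) (e / 2) (half_gt0 e0).
  have d14 : 0 < d1 / 4 by rewrite divr_gt0.
  have [d2 d20 H2] := cg _ d14.
  exists (Num.min (d1 / 2) d2); first by rewrite lt_min d20 divr_gt0.
  move=> t' d'; rewrite !lt_min => /andP[_ tt2] /and3P[d'0 dd1 dd2] z mz zd.
  have gt : vnorm Z (g t' - g t) <= d1 / 4.
    by have := H2 t (t' - t) tt2; rewrite (addrC t) subrK.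
  have h1 : `|F (g t') - F (g t)| < e / 2 by apply: H1 => //; lra.
  have h2 : `|F z - F (g t)| < e / 2.
    apply: H1 => //; apply: le_lt_trans (ns_dist_trans nZ mz (mg t) (mg t')) _; lra.
  rewrite -(subrKA (F (g t))); apply: le_trans (ler_normD _ _) _.
  by rewrite (distrC (F (g t))); lra.
by exists d.
Qed.

End Curves.

Section BaseCurve.
Variables (R : realType) (ny nmu : nat) (mu : 'rV[R]_nmu).
Local Notation V := 'rV[R]_ny.
Implicit Types v : R -> V.

Definition bcurve v (t : R) : (R -> V) * 'rV[R]_nmu := (shift_fun t v, mu).

Lemma bcurve_mem k v t : Cper_mem k v -> vmem (Xsp R ny nmu k) (bcurve v t).
Proof. by move=> mv; exact: (conj (Cper_shift t mv) I). Qed.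

Lemma bcurve_per v : periodic1 v -> periodic1 (bcurve v).
Proof.
move=> pv t; congr pair; apply/funext => s; rewrite /shift_fun.
by rewrite addrAC pv.
Qed.

Lemma bcurve_ucont k v : Cper_mem k v -> @ucont R (Xsp R ny nmu k) (bcurve v).
Proof.
move=> mv e e0; have [d d0 H] := Cper_shift_cont mv e0.
exists d => // t h hd; rewrite /= subrr normr0 ge_max (ltW e0) andbT; exact: H.
Qed.

Lemma prod_ucont (Y Z : nspace R) (g : R -> vcar Y) (h : R -> vcar Z) :
  ucont g -> ucont h -> @ucont R (prod_ns Y Z) (fun t => (g t, h t)).
Proof.
move=> cg ch e e0; have [d1 d10 H1] := cg e e0; have [d2 d20 H2] := ch e e0.
exists (Num.min d1 d2); first by rewrite lt_min d10.
move=> t s; rewrite lt_min => /andP[s1 s2].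
by change (Num.max (vnorm Y (g (t + s) - g t)) (vnorm Z (h (t + s) - h t)) <= e); rewrite ge_max H1 ?H2.
Qed.

Lemma cst_ucont (Y : nspace R) (nY : normed Y) (y : vcar Y) : ucont (fun=> y).
Proof. by move=> e e0; exists 1 => // t h _; rewrite subrr (ns0 nY) ltW. Qed.

Variables (l : nat) (G : (R -> V) * 'rV[R]_nmu -> V).
Variable E : ((R -> V) * 'rV[R]_nmu) * ((R -> V) * 'rV[R]_nmu) -> V.
Hypothesis sE : ext_spec l G E.
Variable v : R -> V.
Hypothesis mv : Cper_mem l.+1 v.
Local Notation X1 := (Xsp R ny nmu l.+1).
Local Notation X0 := (Xsp R ny nmu l).

Let n1 := normed_Xsp R ny nmu l.+1.
Let n0 := normed_Xsp R ny nmu l.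

Lemma ext0 u : vmem X1 u -> E (u, 0) = 0.
Proof.
move=> mu'; have := es_homog sE 0 mu' (mem0 n0).
by rewrite scaler0 expr0n /= scale0r.
Qed.

(** This replaces an operator norm. E vanishes at (v_t, 0), so continuity gives |E| <= 1 for
    directions of norm less than d, uniformly in t; homogeneity of degree l + 1 scales any direction
    to norm d/2, which explains the constant 2/d. *)
Lemma ext_locally_bounded : exists rho M : R, [/\ 0 < rho, 0 <= M &
  forall t u d, vmem X1 u -> vnorm X1 (u - bcurve v t) < rho -> vmem X0 d ->
    `|E (u, d)| <= M * vnorm X0 d ^+ l.+1].
Proof.
have [|||d d0 H] := unif_curve (normed_prod n1 n0) (g := fun t => (bcurve v t, 0)) (es_cont sE) _ _ _ ltr01.
- by move=> t; split; [exact: bcurve_mem|exact: mem0].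
- by move=> t; rewrite (bcurve_per (Cper_periodic mv)).
- exact: (@prod_ucont X1 X0 (bcurve v) (fun=> 0) (bcurve_ucont mv) (cst_ucont n0 _)).
exists d, ((2 / d) ^+ l.+1); split=> //; first by rewrite exprn_ge0// divr_ge0// ltW.
move=> t u x mu' ud mx; have x0 := ns_ge0 n0 mx.
have [xz|xn] := eqVneq (vnorm X0 x) 0.
  by rewrite (ns_eq0 n0 mx xz) ext0// normr0 mulr_ge0// ?exprn_ge0 ?divr_ge0 ?(ltW d0)// (ns_ge0 n0 (mem0 n0)).
have xp : 0 < vnorm X0 x by rewrite lt_def xn.
pose k := d / 2 / vnorm X0 x.
have k0 : 0 < k by rewrite !divr_gt0.
have mkx : vmem X0 (k *: x) by exact: (memZ n0 k mx).
have Nk : vnorm X0 (k *: x) < d.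
  by rewrite (nsZ n0 _ mx) gtr0_norm// divfK//; lra.
have := H t (u, k *: x) (conj mu' mkx) _.
rewrite (_ : vnorm _ _ = Num.max (vnorm X1 (u - bcurve v t)) (vnorm X0 (k *: x - 0)))//.
rewrite subr0 gt_max ud Nk => /(_ isT).
rewrite ext0 ?subr0; last exact: bcurve_mem.
rewrite (es_homog sE k mu' mx) normrZ normrX gtr0_norm// => h.
rewrite -(ler_pM2l (exprn_gt0 l.+1 k0)); apply: le_trans h _.
rewrite -!exprMn (_ : k * (2 / d * vnorm X0 x) = 1) ?expr1n// /k.
by field; rewrite xn gt_eqF.
Qed.

Lemma ext_poly_coef n A : exists2 C : R, 0 <= C &
  forall t (a : nat -> (R -> V) * 'rV[R]_nmu),
    (forall p, vmem X0 (a p)) -> (forall p, vnorm X0 (a p) <= A) ->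
    exists2 c : nat -> V, forall q, `|c q| <= C &
      forall s, E (bcurve v t, \sum_(p < n.+1) s ^+ p *: a p) =
        \sum_(q < (l.+1 * n).+1) s ^+ q *: c q.
Proof.
have [rho [M [rho0 M0 HM]]] := ext_locally_bounded.
set N := (l.+1 * n).+1.
have [C0 C00 HC] := @coef_bound R N _ (@natr_ord_inj R N) ny.
pose S := \sum_(k < N) \sum_(p < n.+1) (k : nat)%:R ^+ p * `|A|.
have S0 : 0 <= S by do 2!apply: sumr_ge0 => ? _; rewrite mulr_ge0// exprn_ge0.
exists (C0 * (M * S ^+ l.+1)); first by rewrite !mulr_ge0// exprn_ge0.
move=> t a ma ha.
have mt := bcurve_mem t mv.
have [c hc] := es_poly sE n mt ma.
(* [es_poly] determines only the first N coefficients; the rest are set to 0 so that the bound holds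
   for every q. *)
exists (fun q => if (q < N)%N then c q else 0); last first.
  by move=> s; rewrite hc; apply: eq_bigr => q _; rewrite ltn_ord.
move=> q; case: ifP => qN; last by rewrite normr0 !mulr_ge0// exprn_ge0.
apply: HC => // k; rewrite -hc.
have [ms hs] := ns_lincomb n0 n.+1 (fun p => (k : nat)%:R ^+ p) ma.
apply: le_trans (HM t _ _ mt _ ms) _.
  by rewrite subrr (ns0 n1).
rewrite ler_wpM2l// lerXn2r ?nnegrE ?(ns_ge0 n0)//.
apply: le_trans hs _.
rewrite /S (bigD1 k)//= -[leLHS]addr0 lerD//; last first.
  by do 2!apply: sumr_ge0 => ? _; rewrite mulr_ge0// exprn_ge0.
apply: ler_sum => p _; rewrite ger0_norm ?exprn_ge0// ler_wpM2l ?exprn_ge0//.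
exact: le_trans (ha p) (ler_norm _).
Qed.

(** For l > 0 the map E (u, .) need not be linear. On the line a + s b with b = r / |r| it is a
    polynomial in s with bounded coefficients, and its values at s = |r| <= 1 and at s = 0 are
    compared. *)
Lemma ext_lipschitz A : exists2 C : R, 0 <= C &
  forall t a r, vmem X0 a -> vmem X0 r -> vnorm X0 a <= A -> vnorm X0 r <= 1 ->
    `|E (bcurve v t, a + r) - E (bcurve v t, a)| <= C * vnorm X0 r.
Proof.
have [C C0 HC] := ext_poly_coef 1 (`|A| + 1).
exists (C *+ (l.+1 * 1)); first by rewrite mulrn_wge0.
move=> t a r ma mr aA r1; have r0 := ns_ge0 n0 mr.
have [rz|rn] := eqVneq (vnorm X0 r) 0.
  by rewrite (ns_eq0 n0 mr rz) addr0 subrr normr0 mulr_ge0 ?mulrn_wge0// (ns_ge0 n0 (mem0 n0)).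
set s := vnorm X0 r in r0 r1 rn *.
pose b := s^-1 *: r.
have mb : vmem X0 b by exact: (memZ n0).
have Nb : vnorm X0 b = 1 by rewrite (nsZ n0)// normfV ger0_norm// mulVf.
have [||c hc ec] := HC t (fun p => if p is 0%N then a else b).
- by move=> [|p].
- move=> [|p]; last by rewrite Nb lerDr.
  by apply: le_trans aA _; apply: le_trans (ler_norm A) _; rewrite lerDl.
have e1 : E (bcurve v t, a + r) = \sum_(q < (l.+1 * 1).+1) s ^+ q *: c q.
  rewrite -ec; congr (E (_, _)).
  by rewrite big_ord_recl big_ord1 expr0 scale1r expr1 /b scalerA divff// scale1r.
have e2 : E (bcurve v t, a) = \sum_(q < (l.+1 * 1).+1) 0 ^+ q *: c q.
  rewrite -ec; congr (E (_, _)).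
  by rewrite big_ord_recl big_ord1 expr0 scale1r expr1 scale0r addr0.
rewrite e1 e2; move: (l.+1 * 1)%N => N.
rewrite !big_ord_recl !expr0 !scale1r [X in _ - (_ + X)]big1 ?addr0; last first.
  by move=> i _; rewrite expr0n /= scale0r.
rewrite addrC addKr.
apply: le_trans (ler_norm_sum _ _ _) _.
apply: (@le_trans _ _ (\sum_(i < N) C * s)).
  apply: ler_sum => i _; rewrite normrZ mulrC; apply: ler_pM => //.
  rewrite normrX ger0_norm// exprS ler_piMr// exprn_ile1//.
by rewrite sumr_const card_ord mulrnAl.
Qed.

End BaseCurve.

(** * Uniform Taylor expansions and regularity *)

Section Expansions.
Variables (R : realType) (n : nat).
Local Notation V := 'rV[R]_n.
Implicit Types f g : R -> R -> V.

(* The coefficients are bounded but not assumed continuous: expands_coef derives their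
   regularity from the uniformity of the expansion. *)
Definition expands j f := exists2 c : nat -> R -> V,
  exists B : R, forall i t, `|c i t| <= B &
  forall e : R, 0 < e -> exists2 d : R, 0 < d & forall t s, `|s| < d ->
    `|f t s - \sum_(i < j.+1) s ^+ i *: c i t| <= e * `|s| ^+ j.

Lemma expands_ext j f g : expands j g -> (forall t s, f t s = g t s) -> expands j f.
Proof. by move=> h E; rewrite (_ : f = g)//; do 2!apply/funext => ?. Qed.

Lemma expands_add j (a : R) f g : expands j f -> expands j g ->
  expands j (fun t s => a *: f t s + g t s).
Proof.
move=> [c [B HB] hc] [c' [B' HB'] hc'].
exists (fun i t => a *: c i t + c' i t).
  exists (`|a| * B + B') => i t; apply: le_trans (ler_normD _ _) _.
  by rewrite normrZ lerD// ler_wpM2l.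
move=> e e0; have a0 : 0 < `|a| + 1 by rewrite ltr_pwDr.
have [d d0 H] := hc _ (divr_gt0 (half_gt0 e0) a0).
have [d' d'0 H'] := hc' _ (half_gt0 e0).
exists (Num.min d d'); first by rewrite lt_min d0.
move=> t s; rewrite lt_min => /andP[/H h /H' h'].
have -> : a *: f t s + g t s - \sum_(i < j.+1) s ^+ i *: (a *: c i t + c' i t) =
  a *: (f t s - \sum_(i < j.+1) s ^+ i *: c i t) + (g t s - \sum_(i < j.+1) s ^+ i *: c' i t).
  rewrite scalerBr addrACA -opprD; congr (_ - _).
  rewrite scaler_sumr -big_split /=; apply: eq_bigr => i _.
  by rewrite scalerDr !scalerA mulrC.
apply: le_trans (ler_normD _ _) _; rewrite normrZ.
have : `|a| * `|f t s - \sum_(i < j.+1) s ^+ i *: c i t| <= e / 2 * `|s| ^+ j.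
  apply: le_trans (ler_wpM2l _ (h t)) _ => //; rewrite mulrA ler_wpM2r ?exprn_ge0//.
  by rewrite mulrA ler_pdivrMr// mulrC ler_wpM2l ?lerDl// ltW// half_gt0.
by have := h' t; move: (`|s| ^+ j) => x; lra.
Qed.

Lemma expands_sum j N (f : 'I_N -> R -> R -> V) : (forall i, expands j (f i)) ->
  expands j (fun t s => \sum_(i < N) f i t s).
Proof.
elim: N f => [|N IH] f H.
  exists (fun _ _ => 0); first by exists 0 => i t; rewrite normr0.
  move=> e e0; exists 1 => // t s _; rewrite big_ord0 big1 ?subrr ?normr0 ?mulr_ge0 ?exprn_ge0 ?(ltW e0)//.
  by move=> i _; rewrite scaler0.
apply: (expands_ext (expands_add 1 (H ord0) (IH (fun i => f (lift ord0 i)) (fun i => H _)))) => t s.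
by rewrite big_ord_recl scale1r.
Qed.

Lemma expands_o j f g : expands j g ->
  (forall e : R, 0 < e -> exists2 d : R, 0 < d & forall t s, `|s| < d ->
    `|f t s - g t s| <= e * `|s| ^+ j) -> expands j f.
Proof.
move=> hg h; apply: (@expands_ext j f (fun t s => 1 *: g t s + (f t s - g t s))); last first.
  by move=> t s; rewrite scale1r addrC subrK.
apply: expands_add => //; exists (fun _ _ => 0); first by exists 0 => i t; rewrite normr0.
move=> e e0; have [d d0 H] := h e e0; exists d => // t s sd.
by rewrite big1 ?subr0 ?H// => i _; rewrite scaler0.
Qed.

(** The terms of degree above j are O(|s|^(j+1)), uniformly because the coefficients are bounded. *)
Lemma expands_poly j N (c : nat -> R -> V) B : (forall q t, `|c q t| <= B) ->
  expands j (fun t s => \sum_(q < N) s ^+ q *: c q t).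
Proof.
move=> HB; have B0 : 0 <= B by apply: le_trans (HB 0%N 0).
exists (fun q t => if (q < N)%N then c q t else 0).
  by exists B => q t; case: ifP => // _; rewrite normr0.
move=> e e0; exists (Num.min 1 (e / (B *+ N + 1))).
  by rewrite lt_min ltr01 divr_gt0// ltr_pwDr// mulrn_wge0.
move=> t s; rewrite lt_min => /andP[s1 sd].
pose F (q : nat) := s ^+ q *: (if (q < N)%N then c q t else 0).
have -> : \sum_(i < j.+1) s ^+ i *: (if (i < N)%N then c i t else 0) = \sum_(0 <= q < j.+1) F q.
  by rewrite big_mkord.
have -> : \sum_(q < N) s ^+ q *: c q t = \sum_(0 <= q < j.+1 + N) F q.
  rewrite (@big_cat_nat _ _ _ N) ?leq_addl//= [X in _ + X]big1_seq ?addr0.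
    by rewrite big_mkord; apply: eq_bigr => q _; rewrite /F ltn_ord.
  move=> q /andP[_]; rewrite mem_index_iota => /andP[Nq _].
  by rewrite /F ltnNge Nq /= scaler0.
rewrite (@big_cat_nat _ _ _ j.+1) ?leq_addr//= addrAC subrr add0r.
apply: (@le_trans _ _ (\sum_(j.+1 <= q < j.+1 + N) `|s| ^+ j.+1 * B)).
  apply: le_trans (ler_norm_sum _ _ _) _.
  rewrite big_nat [leRHS]big_nat; apply: ler_sum => q /andP[jq _].
  rewrite /F normrZ normrX; apply: ler_pM; rewrite ?exprn_ge0//.
    by rewrite -(subnKC jq) exprD ler_piMr ?exprn_ge0// exprn_ile1// ltW.
  by case: ifP => // _; rewrite normr0.
rewrite sumr_const_nat addKn exprSr -mulrnAr -mulrA mulrC ler_wpM2r ?exprn_ge0//.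
have BN : 0 <= B *+ N by rewrite mulrn_wge0.
have BN1 : 0 < B *+ N + 1 by rewrite ltr_pwDr.
apply: (@le_trans _ _ (e / (B *+ N + 1) * (B *+ N))); first by rewrite ler_wpM2r// ltW.
by rewrite mulrAC ler_pdivrMr// ler_pM2l// lerDl.
Qed.

Lemma expands_mul i j f : expands j f -> expands (i + j) (fun t s => s ^+ i *: f t s).
Proof.
move=> [c [B HB] hc].
exists (fun q t => if (i <= q)%N then c (q - i)%N t else 0).
  exists B => q t; case: ifP => // _; rewrite normr0.
  by apply: le_trans (HB 0%N 0).
move=> e e0; have [d d0 H] := hc e e0; exists d => // t s sd.
have -> : \sum_(q < (i + j).+1) s ^+ q *: (if (i <= q)%N then c (q - i)%N t else 0) =
   s ^+ i *: \sum_(q < j.+1) s ^+ q *: c q t.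
  rewrite -addnS big_split_ord /= big1 ?add0r.
    rewrite scaler_sumr; apply: eq_bigr => q _.
    by rewrite leq_addr addKn scalerA exprD.
  by move=> q _; rewrite leqNgt ltn_ord /= scaler0.
rewrite -scalerBr normrZ normrX exprD mulrCA ler_wpM2l ?exprn_ge0//; exact: H.
Qed.

Lemma bin_expand (s q : R) (c : nat -> V) j :
  \sum_(p < j.+1) (s + q * s) ^+ p *: c p =
  \sum_(i < j.+1) q ^+ i *: \sum_(p < j.+1) ('C(p, i)%:R * s ^+ p) *: c p.
Proof.
under [RHS]eq_bigr do rewrite scaler_sumr.
rewrite exchange_big /=; apply: eq_bigr => p _.
under eq_bigr do rewrite scalerA.
rewrite -scaler_suml; congr (_ *: _).
have -> : s + q * s = (1 + q) * s by ring.
rewrite exprMn exprDn.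
have -> : \sum_(i < j.+1) q ^+ i * ('C(p, i)%:R * s ^+ p) =
  (\sum_(i < j.+1) q ^+ i *+ 'C(p, i)) * s ^+ p.
  by rewrite mulr_suml; apply: eq_bigr => i _; rewrite mulrA mulr_natr.
congr (_ * _).
pose F (i : nat) := q ^+ i *+ 'C(p, i).
have -> : \sum_(i < j.+1) q ^+ i *+ 'C(p, i) = \sum_(0 <= i < j.+1) F i by rewrite big_mkord.
rewrite (@big_cat_nat _ _ _ p.+1)//= [X in _ = _ + X]big1_seq ?addr0.
  by rewrite big_mkord; apply: eq_bigr => i _; rewrite expr1n mul1r.
move=> i /andP[_]; rewrite mem_index_iota => /andP[pi _].
by rewrite /F bin_small.
Qed.

(* Expanding w (t + s + q s) at t + s and at t for j + 1 values of q, and comparing the two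
   polynomials in q, shows that each coefficient has the expansion of a Taylor coefficient. *)
Lemma expands_coef (w : R -> V) (c : nat -> R -> V) j :
  (forall e : R, 0 < e -> exists2 d : R, 0 < d & forall t s, `|s| < d ->
    `|w (t + s) - \sum_(i < j.+1) s ^+ i *: c i t| <= e * `|s| ^+ j) ->
  forall e : R, 0 < e -> exists2 d : R, 0 < d & forall t s i, `|s| < d -> (i <= j)%N -> s != 0 ->
    `|c i (t + s) - \sum_(p < j.+1) ('C(p, i)%:R * s ^+ p / s ^+ i) *: c p t| <=
      e * `|s| ^+ (j - i).
Proof.
move=> hc e e0.
have [C C0 HC] := @coef_bound R j.+1 _ (@natr_ord_inj R j.+1) n.
(* Two remainders are compared, each at an argument of size at most (j + 1) |s|; this accounts for 2
   (j + 1)^j, and [C] passes from values to coefficients. *)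
pose K := C * (2 * j.+1%:R ^+ j) + 1.
have K0 : 0 < K by rewrite ltr_pwDr// !mulr_ge0// exprn_ge0.
have [d d0 H] := hc (e / K) (divr_gt0 e0 K0).
exists (d / j.+1%:R); first by rewrite divr_gt0.
move=> t s i; rewrite ltr_pdivlMr// => sd ij sn0.
have bnd (k : 'I_j.+1) : `|s + (k : nat)%:R * s| <= `|s| * j.+1%:R.
  have -> : s + (k : nat)%:R * s = s * k.+1%:R by rewrite -natr1; ring.
  by rewrite normrM normr_nat ler_wpM2l// ler_nat.
(* [b i] is the coefficient of q^i in the difference of the two polynomials; the natural numbers q =
   0, ..., j are the nodes. *)
pose b i := s ^+ i *: c i (t + s) - \sum_(p < j.+1) ('C(p, i)%:R * s ^+ p) *: c p t.
have hb (k : 'I_j.+1) : `|\sum_(i < j.+1) (k : nat)%:R ^+ i *: b i| <=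
    2 * (e / K * (`|s| * j.+1%:R) ^+ j).
  have -> : \sum_(i < j.+1) (k : nat)%:R ^+ i *: b i =
     (w (t + (s + (k : nat)%:R * s)) - \sum_(p < j.+1) (s + (k : nat)%:R * s) ^+ p *: c p t) -
     (w (t + s + (k : nat)%:R * s) - \sum_(i < j.+1) ((k : nat)%:R * s) ^+ i *: c i (t + s)).
    rewrite (bin_expand s _ (fun p => c p t)) (addrA t s); move: (w _) => W.
    rewrite opprB [RHS]addrC [RHS]addrA subrK -sumrB.
    by apply: eq_bigr => i' _; rewrite /b scalerBr scalerA exprMn.
  apply: le_trans (ler_normB _ _) _.
  have eK : 0 <= e / K by rewrite divr_ge0 ?ltW.
  have h1 : `|w (t + (s + (k : nat)%:R * s)) - \sum_(p < j.+1) (s + (k : nat)%:R * s) ^+ p *: c p t| <=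
     e / K * (`|s| * j.+1%:R) ^+ j.
    apply: le_trans (H _ _ _) _; first exact: le_lt_trans (bnd k) sd.
    by rewrite ler_wpM2l// lerXn2r// nnegrE mulr_ge0.
  have b2 : `|(k : nat)%:R * s| <= `|s| * j.+1%:R.
    by rewrite normrM normr_nat mulrC ler_wpM2l// ler_nat ltnW.
  have h2 : `|w (t + s + (k : nat)%:R * s) - \sum_(i < j.+1) ((k : nat)%:R * s) ^+ i *: c i (t + s)| <=
     e / K * (`|s| * j.+1%:R) ^+ j.
    apply: le_trans (H _ _ _) _; first exact: le_lt_trans b2 sd.
    by rewrite ler_wpM2l// lerXn2r// nnegrE mulr_ge0.
  lra.
have hbi := HC b _ hb i ij.
have -> : c i (t + s) - \sum_(p < j.+1) ('C(p, i)%:R * s ^+ p / s ^+ i) *: c p t = (s ^+ i)^-1 *: b i.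
  rewrite /b scalerBr scalerA mulVf ?expf_neq0// scale1r scaler_sumr; congr (_ - _).
  by apply: eq_bigr => p _; rewrite scalerA mulrC.
have si : 0 < `|s| ^+ i by rewrite exprn_gt0// normr_gt0.
rewrite normrZ normfV normrX ler_pdivrMl// mulrCA -exprD subnKC//; apply: le_trans hbi _.
rewrite exprMn.
have -> : C * (2 * (e / K * (`|s| ^+ j * j.+1%:R ^+ j))) =
  (e * `|s| ^+ j) * (C * (2 * j.+1%:R ^+ j) / K) by ring.
by rewrite ler_piMr ?mulr_ge0 ?exprn_ge0 ?(ltW e0)// ler_pdivrMr// mul1r /K lerDl.
Qed.

(** The converse of Taylor's theorem, with i! c_i as the candidate for the i-th derivative. In the
    expansion of c_i(t + s) the binomials kill the terms p < i, the terms p = i and p = i + 1 give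
    the value and the derivative, and the remaining ones are O(s^2). *)
Lemma expands_Cper (w : R -> V) j : periodic1 w -> expands j (fun t s => w (t + s)) -> Cper_mem j w.
Proof.
move=> pw [c [B HB] hc].
have B0 : 0 <= B by apply: le_trans (HB 0%N 0).
have c0 t : w t = c 0%N t.
  apply/eqP; rewrite -subr_eq0 -normr_le0; apply/ler_addgt0 => e e0; rewrite add0r.
  have [d d0 H] := hc e e0; have := H t 0; rewrite normr0 => /(_ d0).
  rewrite addr0 big_ord_recl expr0 scale1r big1 ?addr0; last first.
    by move=> i _; rewrite expr0n /= scale0r.
  move=> /le_trans; apply; rewrite expr0n; case: (j == 0)%N; rewrite ?mulr1 ?mulr0//.
  exact: ltW.
have hco := expands_coef hc.
pose D i t := i`!%:R *: c i t.
refine (proj1 (@Cper_introP R n j w D _ pw _ _)).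
- by apply/funext => t; rewrite /D fact0 scale1r c0.
- move=> i ij t e e0.
  have fi : 0 < i`!%:R :> R by rewrite ltr0n fact_gt0.
  have [d d0 H] := hco _ (divr_gt0 (half_gt0 e0) fi).
  pose S := \sum_(p < j.+1) ('C(p, i)%:R * B).
  have S0 : 0 <= S by apply: sumr_ge0 => p _; rewrite mulr_ge0.
  exists (Num.min (Num.min d 1) (e / 2 / (i`!%:R * (S + 1)))).
    by rewrite !lt_min d0 ltr01 !divr_gt0// mulr_gt0// ltr_pwDr.
  move=> s; rewrite !lt_min => /andP[/andP[sd s1]].
  rewrite ltr_pdivlMr ?mulr_gt0 ?ltr_pwDr// => s2.
  have [->|sn0] := eqVneq s 0.
    by rewrite addr0 subrr scale0r subr0 !normr0 mulr0.
  have := H t s i sd (ltnW ij) sn0.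
  set X := \sum_(p < _) _ => hX.
  have hX' : `|c i (t + s) - X| <= e / 2 / i`!%:R * `|s|.
    apply: le_trans hX _; apply: ler_wpM2l; first by rewrite ltW// divr_gt0// half_gt0.
    have : (0 < j - i)%N by rewrite subn_gt0.
    case: (j - i)%N => // k _. by rewrite exprS ler_piMr// exprn_ile1// ltW.
  have XE : `|X - c i t - (i.+1%:R * s) *: c i.+1 t| <= `|s| ^+ 2 * S.
    have -> : X - c i t - (i.+1%:R * s) *: c i.+1 t = \sum_(p < j.+1 | (i.+1 < p)%N) ('C(p, i)%:R * s ^+ p / s ^+ i) *: c p t.
      rewrite /X (bigID (fun p : 'I_j.+1 => (i.+1 < p)%N)) /= addrC.
      have i1 : (i.+1 < j.+1)%N by [].
      have i2 : (i < j.+1)%N by exact: ltnW.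
      rewrite (bigD1 (Ordinal i2)) ?ltnNge ?leqnSn//= (bigD1 (Ordinal i1))/=; last first.
        by rewrite ltnn /= -val_eqE /= gtn_eqF.
      rewrite big1; last first.
        move=> p /andP[/andP[pi p1] p2]; rewrite -leqNgt in pi.
        rewrite -val_eqE /= in p1; rewrite -val_eqE /= in p2.
        have pi' : (p < i)%N.
          by rewrite ltn_neqAle p1 /= -ltnS ltn_neqAle p2.
        by rewrite bin_small// !mul0r scale0r.
      rewrite addr0 binn mul1r divff ?expf_neq0// scale1r binSn exprS mulrA.
      rewrite mulfK ?expf_neq0//.
      move: (\sum_(_ < _ | _) _) => Y.
      by apply/rowP => k; rewrite !mxE; ring.
    apply: le_trans (ler_norm_sum _ _ _) _.
    rewrite [leLHS]big_mkcond /S mulr_sumr; apply: ler_sum => p _.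
    case: ifP => [ip|_]; last by rewrite !mulr_ge0// exprn_ge0.
    have sp : 0 < `|s| by rewrite normr_gt0.
    have sps : `|s ^+ p / s ^+ i| <= `|s| ^+ 2.
      rewrite normrM normfV !normrX ler_pdivrMr ?exprn_gt0// -exprD ler_wiXn2l//.
      exact: ltW.
    rewrite -mulrA normrZ normrM normr_nat [leRHS]mulrCA -mulrA ler_wpM2l//.
    by apply: ler_pM.
  have -> : D i (t + s) - D i t - s *: D i.+1 t =
      i`!%:R *: ((c i (t + s) - X) + (X - c i t - (i.+1%:R * s) *: c i.+1 t)).
    rewrite /D factS natrM; move: (c i (t + s)) (c i t) (c i.+1 t) X {hX hX' XE} => x1 x2 x3 X.
    by apply/rowP => k; rewrite !mxE; ring.
  rewrite normrZ normr_nat; apply: (@le_trans _ _ (i`!%:R * (e / 2 / i`!%:R * `|s| + `|s| ^+ 2 * S))).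
    by rewrite ler_wpM2l// (le_trans (ler_normD _ _))// lerD.
  rewrite mulrDr [i`!%:R * (_ * `|s|)](_ : _ = e / 2 * `|s|); last by field; rewrite gt_eqF.
  have : i`!%:R * (`|s| ^+ 2 * S) <= e / 2 * `|s|.
    have -> : i`!%:R * (`|s| ^+ 2 * S) = (`|s| * (i`!%:R * S)) * `|s| by ring.
    rewrite ler_wpM2r//; apply: le_trans (ltW s2).
    by rewrite ler_wpM2l// ler_wpM2l ?(ltW fi)// lerDl.
  lra.
(* For i = j only the term p = j survives and the error is e |s|^0, which is continuity of the last
   coefficient. *)
- apply/continuous_epsP => t e e0.
  have fj : 0 < j`!%:R :> R by rewrite ltr0n fact_gt0.
  have [d d0 H] := hco _ (divr_gt0 e0 fj).
  exists d => // s sd.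
  have [->|sn0] := eqVneq s 0; first by rewrite addr0 subrr normr0 ltW.
  have := H t s j sd (leqnn j) sn0.
  rewrite subnn expr0 mulr1 big_ord_recr /= big1 ?add0r; last first.
    by move=> p _; rewrite bin_small// !mul0r scale0r.
  rewrite binn mul1r divff ?expf_neq0// scale1r => h.
  by rewrite /D -scalerBr normrZ normr_nat mulrC -ler_pdivlMr.
Qed.

End Expansions.

(** * Expansion and regularity of t -> G (v_t, mu) *)

Section TaylorQuotient.
Variables (R : realType) (n : nat).
Local Notation V := 'rV[R]_n.
Implicit Types v : R -> V.

Lemma derive1n_linear k j : (j <= k)%N ->
  @ns_linear R (Cper R n k) (Cper R n 0) (@derive1n R V j).
Proof. by move=> jk a u v mu mv; have [_ ->] := Cper_linP a mu mv. Qed.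

(** Taylor's formula is applied to each derivative of order at most l. Measuring the difference
    quotient of v_t only in C^l leaves the other N + 1 derivatives of v for the expansion in s. *)
Lemma Cper_taylor_quot l N v : Cper_mem (l + N.+1) v -> forall e, 0 < e ->
  exists2 d : R, 0 < d & forall t s, `|s| < d -> s != 0 ->
   Cper_norm l (s^-1 *: (shift_fun (t + s) v - shift_fun t v) -
     \sum_(q < N.+1) s ^+ q *: (q.+1`!%:R^-1 *: shift_fun t (derive1n q.+1 v))) <= e * `|s| ^+ N.
Proof.
move=> mv e e0.
have /choice[d Hd] : forall i : 'I_l.+1, exists d : R, 0 < d /\ forall t s, `|s| < d ->
    `|derive1n i v (t + s) - \sum_(p < N.+2) (s ^+ p / p`!%:R) *: derive1n (p + i) v t| <= e * `|s| ^+ N.+1.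
  move=> i; have il : (N.+1 + i <= l + N.+1)%N by rewrite addnC leq_add2r -ltnS.
  have [mi Ei] := Cper_derive il mv.
  have [d d0 H] := Cper_taylor mi e0; exists d; split=> // t s sd.
  have := H t s sd; under eq_bigr do rewrite Ei.
  by [].
exists (\big[Num.min/1]_i d i).
  by apply: lt_bigmin => // j _; have [] := Hd j.
move=> t s sd sn0.
have X := normed_Cper R n l.
have m1 x : Cper_mem l (shift_fun x v) by apply/Cper_shift/(Cper_le _ mv)/leq_addr.
have m3 q : (q < N.+1)%N -> Cper_mem l (derive1n q.+1 v).
  by move=> qN; have [] := @Cper_derive R n (l + N.+1) q.+1 l v _ mv; rewrite ?leq_add2l.
have m2 (q : 'I_N.+1) : Cper_mem l (q.+1`!%:R^-1 *: shift_fun t (derive1n q.+1 v)).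
  by apply: (@memZ _ (Cper R n l) X); apply: Cper_shift; exact: m3.
have m4 : Cper_mem l (shift_fun (t + s) v - shift_fun t v).
  exact: (@memB _ (Cper R n l) X _ _ (m1 _) (m1 _)).
have m5 : Cper_mem l (s^-1 *: (shift_fun (t + s) v - shift_fun t v)).
  exact: (@memZ _ (Cper R n l) X _ _ m4).
have m6 (q : 'I_N.+1) : Cper_mem l (s ^+ q *: (q.+1`!%:R^-1 *: shift_fun t (derive1n q.+1 v))).
  exact: (@memZ _ (Cper R n l) X _ _ (m2 q)).
have m7 : Cper_mem l (\sum_(q < N.+1) s ^+ q *: (q.+1`!%:R^-1 *: shift_fun t (derive1n q.+1 v))).
  exact: (@mem_sum _ (Cper R n l) X _ _ m6).
apply: Cper_norm_le => j x jl.
have lin := derive1n_linear jl.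
rewrite (linB X lin m5 m7) (linZ X lin _ m4) (linB X lin (m1 _) (m1 _)) (lin_sum X lin m6).
rewrite !derive1n_shift.
have E (q : 'I_N.+1) : derive1n j (s ^+ q *: (q.+1`!%:R^-1 *: shift_fun t (derive1n q.+1 v))) =
    (s ^+ q / q.+1`!%:R) *: shift_fun t (derive1n (q.+1 + j) v).
  rewrite (linZ X lin _ (m2 q)) (linZ X lin); last by apply: Cper_shift; exact: m3.
  rewrite derive1n_shift scalerA; congr (_ *: shift_fun t _).
  have ql : (l + q.+1 <= l + N.+1)%N by rewrite leq_add2l.
  by have [_ ->] := Cper_derive ql mv; rewrite addnC.
rewrite (eq_bigr _ (fun q _ => E q)) !fctE fct_sumE /shift_fun.
have sp : 0 < `|s| by rewrite normr_gt0.
rewrite -ltnS in jl.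
have sdj : `|s| < d (Ordinal jl) by apply: lt_le_trans sd _; exact: bigmin_le.
have := (Hd (Ordinal jl)).2 (t + x) s sdj; rewrite /=.
rewrite big_ord_recl /= expr0 fact0 divr1 scale1r add0n => h.
rewrite (_ : t + s + x = t + x + s); last by ring.
rewrite (_ : _ - _ = s^-1 *: (derive1n j v (t + x + s) - (derive1n j v (t + x) +
   \sum_(i < N.+1) (s ^+ (bump 0 i) / (bump 0 i)`!%:R) *: derive1n (bump 0 i + j) v (t + x)))).
  rewrite normrZ normfV ler_pdivrMl//; apply: le_trans h _.
  by rewrite exprS mulrCA.
rewrite [in RHS]opprD addrA [RHS]scalerBr; congr (_ - _).
rewrite scaler_sumr; apply: eq_bigr => i _; rewrite /bump /= add1n !fctE scalerA; congr (_ *: _).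
by rewrite exprS [RHS]mulrA mulKf.
Qed.

End TaylorQuotient.

Section Regularity.
Variables (R : realType) (ny nmu : nat) (mu : 'rV[R]_nmu).
Local Notation V := 'rV[R]_ny.
Local Notation XT := ((R -> V) * 'rV[R]_nmu)%type.
Variables (G : XT -> V) (v : R -> V).

Lemma pair_sum N (c : nat -> R) (f : nat -> R -> V) :
  \sum_(q < N) c q *: ((f q, 0) : XT) = (\sum_(q < N) c q *: f q, 0).
Proof.
by elim/big_rec2: _ => // q x y _ ->; rewrite pair_lin scaler0 addr0.
Qed.

(** Homogeneity extracts s^(p+1); the remaining direction is a polynomial in s plus o(s^N) in C^p.
    The first part gives a polynomial in s, the second is absorbed by [ext_lipschitz]. With
    directions measured in C^(p+1) one order would be lost; here the order p + 1 + N uses every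
    derivative of v. *)
Lemma ext_term_expands p N E : ext_spec p G E -> Cper_mem (p + N.+1) v ->
  expands (p.+1 + N) (fun t s => E (bcurve mu v t, bcurve mu v (t + s) - bcurve mu v t)).
Proof.
move=> sE mv.
have mv1 : Cper_mem p.+1 v by apply: Cper_le mv; rewrite -addn1 leq_add2l.
have nX := normed_Xsp R ny nmu p.
pose b t q := q.+1`!%:R^-1 *: shift_fun t (derive1n q.+1 v).
pose a t q : XT := if (q < N.+1)%N then (b t q, 0) else 0.
pose A := \sum_(q < N.+1) (q.+1`!%:R^-1 * Cper_norm p (derive1n q.+1 v)).
have mD q : (q < N.+1)%N -> Cper_mem p (derive1n q.+1 v).
  by move=> qN; have [] := @Cper_derive R ny (p + N.+1) q.+1 p v _ mv; rewrite ?leq_add2l.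
have mb t q : (q < N.+1)%N -> Cper_mem p (b t q).
  move=> qN; apply: (@memZ _ (Cper R ny p) (normed_Cper R ny p)); apply: Cper_shift; exact: mD.
have A0 : 0 <= A.
  apply: sumr_ge0 => q _; rewrite mulr_ge0 ?invr_ge0//.
  exact: (ns_ge0 (normed_Cper R ny p) (mD q (ltn_ord q))).
have ma t q : vmem (Xsp R ny nmu p) (a t q).
  rewrite /a; case: ifP => [qN|_]; last exact: (mem0 nX).
  exact: (conj (mb t q qN) I).
have Na t q : vnorm (Xsp R ny nmu p) (a t q) <= A.
  rewrite /a; case: ifP => [qN|_]; last by rewrite (ns0 nX).
  rewrite /= normr0 ge_max A0 andbT.
  apply: le_trans (nsZ_le (normed_Cper R ny p) _ (Cper_shift t (mD q qN))) _.
  rewrite ger0_norm ?invr_ge0// /= Cper_norm_shift; last exact: mD.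
  rewrite /A (bigD1 (Ordinal qN))//= lerDl; apply: sumr_ge0 => i _; rewrite mulr_ge0 ?invr_ge0//.
  exact: (ns_ge0 (normed_Cper R ny p) (mD i (ltn_ord i))).
pose Q t s : XT := \sum_(q < N.+1) s ^+ q *: a t q.
have QE t s : Q t s = (\sum_(q < N.+1) s ^+ q *: b t q, 0).
  rewrite -(pair_sum N.+1 (fun q => s ^+ q) (b t)); apply: eq_bigr => q _.
  by rewrite /a ltn_ord.
pose del t s : XT := bcurve mu v (t + s) - bcurve mu v t.
(* The value 0 at s = 0 keeps the factorization [delE] valid there. *)
pose rho t s : XT := if s == 0 then 0 else s^-1 *: del t s - Q t s.
have mdel t s : vmem (Xsp R ny nmu p) (del t s).
  have mvp : Cper_mem p v := Cper_le (leqnSn p) mv1.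
  exact: (memB nX (bcurve_mem mu (t + s) mvp) (bcurve_mem mu t mvp)).
have mQ t s : vmem (Xsp R ny nmu p) (Q t s).
  by have [] := ns_lincomb nX N.+1 (fun q => s ^+ q) (ma t).
have mrho t s : vmem (Xsp R ny nmu p) (rho t s).
  rewrite /rho; case: ifP => _; first exact: (mem0 nX).
  exact: (memB nX (memZ nX _ (mdel t s)) (mQ t s)).
have delE t s : del t s = s *: (Q t s + rho t s).
  rewrite /rho; case: eqVneq => [->|s0].
    by rewrite scale0r /del addr0 subrr.
  by rewrite addrC subrK scalerA divff// scale1r.
have hrho e : 0 < e -> exists2 d : R, 0 < d & forall t s, `|s| < d ->
    vnorm (Xsp R ny nmu p) (rho t s) <= e * `|s| ^+ N.
  move=> e0; have [d d0 H] := Cper_taylor_quot mv e0; exists d => // t s sd.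
  rewrite /rho; case: eqVneq => [_|s0].
    by rewrite (ns0 nX) mulr_ge0 ?exprn_ge0// ltW.
  rewrite QE /del /bcurve /= subrr scaler0 subrr normr0 ge_max mulr_ge0 ?exprn_ge0 ?(ltW e0)// andbT.
  exact: H.
have mt t := bcurve_mem mu t mv1.
apply: (@expands_ext _ _ _ _ (fun t s => s ^+ p.+1 *: E (bcurve mu v t, Q t s + rho t s))); last first.
  by move=> t s; rewrite -/(del t s) delE (es_homog sE)//; exact: (memD nX (mQ t s) (mrho t s)).
apply: expands_mul; apply: (@expands_o _ _ _ _ (fun t s => E (bcurve mu v t, Q t s))).
  have [C C0 HC] := ext_poly_coef mu sE mv1 N A.
  have /choice[c Hc] : forall t, exists c : nat -> V, (forall q, `|c q| <= C) /\
      forall s, E (bcurve mu v t, Q t s) = \sum_(q < (p.+1 * N).+1) s ^+ q *: c q.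
    by move=> t; have [c h1 h2] := HC t (a t) (ma t) (Na t); exists c.
  apply: (expands_ext (expands_poly N (p.+1 * N).+1 (c := fun q t => c t q) (B := C) _)).
    by move=> q t; have [h _] := Hc t.
  by move=> t s; have [_ h] := Hc t.
pose A' := A *+ N.+1.
have [C C0 HC] := ext_lipschitz mu sE mv1 A'.
move=> e e0; have C1 : 0 < C + 1 by rewrite ltr_pwDr.
have e1 : 0 < Num.min 1 (e / (C + 1)) by rewrite lt_min ltr01 divr_gt0.
have [d d0 H] := hrho _ e1.
exists (Num.min d 1); first by rewrite lt_min d0 ltr01.
move=> t s; rewrite lt_min => /andP[sd s1].
have sN : `|s| ^+ N <= 1 by rewrite exprn_ile1// ltW.
have hr := H t s sd.
have r1 : vnorm (Xsp R ny nmu p) (rho t s) <= 1.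
  apply: le_trans hr _; rewrite -[leRHS]mulr1; apply: ler_pM => //; first exact: ltW.
  by rewrite ge_min lexx.
apply: le_trans (HC t _ _ (mQ t s) (mrho t s) _ r1) _.
  have [_ h] := ns_lincomb nX N.+1 (fun q => s ^+ q) (ma t); apply: le_trans h _.
  apply: (@le_trans _ _ (\sum_(q < N.+1) A)); last by rewrite sumr_const card_ord.
  apply: ler_sum => q _; rewrite normrX -[leRHS]mul1r; apply: ler_pM => //.
    exact: (ns_ge0 nX).
  by rewrite exprn_ile1// ltW.
apply: (@le_trans _ _ (C * (e / (C + 1) * `|s| ^+ N))).
  rewrite ler_wpM2l// (le_trans hr)// ler_wpM2r ?exprn_ge0//.
  by rewrite ge_min lexx orbT.
rewrite mulrA ler_wpM2r ?exprn_ge0// mulrA ler_pdivrMr// mulrC ler_wpM2l ?(ltW e0)//.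
by rewrite lerDl.
Qed.

Hypothesis cG : @ns_continuous R (Xsp R ny nmu 0) (euclid R ny) G.

Lemma G_curve_Cper : Cper_mem 0 v -> Cper_mem 0 (fun t => G (bcurve mu v t)).
Proof.
move=> mv; refine (proj1 (@Cper_introP _ _ 0 _ (fun=> _) erefl _ _ _)) => //.
  by move=> t; rewrite (bcurve_per mu (Cper_periodic mv)).
have n0 := normed_Xsp R ny nmu 0.
apply/continuous_epsP => t e e0.
have [d d0 H] := unif_curve n0 cG (fun t => bcurve_mem mu t mv) (bcurve_per mu (Cper_periodic mv)) (bcurve_ucont mu mv) e0.
have [d' d'0 H'] := bcurve_ucont mu mv (half_gt0 d0).
exists d' => // h hd; apply: H; first exact: bcurve_mem.
by apply: le_lt_trans (H' t h hd) _; lra.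
Qed.

(** Taylor's formula on the segment from v_t to v_(t+s), with J + 1 = j. Its terms expand by
    [ext_term_expands]. In the remainder the difference divided by s tends to v_t' only in C^J,
    which is the norm in which E of order J + 1 is continuous in its direction. *)
Lemma G_curve_expands j : (forall l, (l < j)%N -> exists E, ext_spec l G E) ->
  Cper_mem j v -> expands j (fun t s => G (bcurve mu v (t + s))).
Proof.
move=> hE mv; have mv0 := Cper_le (leq0n j) mv.
have mw := G_curve_Cper mv0.
case: j hE mv => [|J] hE mv.
  have [B B0 HB] := periodic_bounded (Cper_periodic mw) (Cper_continuous mw (leqnn 0)).
  exists (fun _ t => G (bcurve mu v t)); first by exists B.
  move=> e e0; have [d d0 H] := periodic_unif (Cper_periodic mw) (Cper_continuous mw (leqnn 0)) e0.
  by exists d => // t s sd; rewrite big_ord1 expr0 scale1r mulr1; exact: H.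
have /choice[E HE] : forall l : 'I_J.+1, exists E, ext_spec l G E by move=> l; exact: hE.
pose del t s : XT := bcurve mu v (t + s) - bcurve mu v t.
have nX := normed_Xsp R ny nmu J.+1; have nX' := normed_Xsp R ny nmu J.
have mt t := bcurve_mem mu t mv.
have mdel t s : vmem (Xsp R ny nmu J.+1) (del t s) := memB nX (mt (t + s)) (mt t).
pose phi t s th := G (bcurve mu v t + th *: del t s).
have phi1 t s : phi t s 1 = G (bcurve mu v (t + s)).
  by rewrite /phi scale1r /del addrC subrK.
have phi0 t s : phi t s 0 = G (bcurve mu v t) by rewrite /phi scale0r addr0.
have down l u : (l <= J)%N -> vmem (Xsp R ny nmu J.+1) u -> vmem (Xsp R ny nmu l.+1) u.
  by move=> lJ mu'; exact: (conj (Cper_le (lJ : (l.+1 <= J.+1)%N) mu'.1) I).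
(* The data given for different orders are unrelated; they are identified as derivatives of the same
   function [phi] of one real variable. *)
have dphi (l : 'I_J.+1) t s th : derive1n l.+1 (phi t s) th = E l (bcurve mu v t + th *: del t s, del t s).
  have lJ : (l <= J)%N by rewrite -ltnS.
  exact: (es_line (HE l) th (down _ _ lJ (mt t)) (down _ _ lJ (mdel t s))).
apply: (@expands_o _ _ _ _ (fun t s => \sum_(p < J.+2) (1 ^+ p / p`!%:R) *: derive1n p (phi t s) 0)).
  apply: expands_sum => p; case: p => -[|p] pJ.
    apply: (@expands_ext _ _ _ _ (fun t s => \sum_(q < 1) s ^+ q *: G (bcurve mu v t))).
      have [B B0 HB] := periodic_bounded (Cper_periodic mw) (Cper_continuous mw (leqnn 0)).
      by apply: (expands_poly _ _ (c := fun _ t => G (bcurve mu v t)) (B := B)).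
    by move=> t s; rewrite big_ord1 !expr0 fact0 divr1 !scale1r /= phi0.
  have pJ' : (p < J.+1)%N by rewrite -ltnS.
  have EJ : (p.+1 + (J - p))%N = J.+1 by rewrite addSn subnKC.
  have mvp : Cper_mem (p + (J - p).+1) v by rewrite addnS subnKC.
  have := ext_term_expands (HE (Ordinal pJ')) mvp; rewrite EJ => h.
  have h0 : @expands R ny J.+1 (fun t s => 0).
    by apply: (expands_ext (@expands_sum R ny J.+1 0 (fun _ _ _ => 0) _)) => [[]//|t s]; rewrite big_ord0.
  apply: (expands_ext (expands_add (1 ^+ p.+1 / p.+1`!%:R) h h0)) => t s.
  by rewrite addr0 (dphi (Ordinal pJ')) scale0r addr0.
pose l := @ord_max J.
have sE : ext_spec J G (E l) := HE l.
have mv1 : Cper_mem (J + 0.+1) v by rewrite addn1.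
have md : Cper_mem J (derive1n 1 v).
  by have [] := @Cper_derive R ny J.+1 1 J v _ mv; rewrite ?addn1.
move=> e e0.
(* The limit, as s tends to 0, of the pair of a point on the segment and the direction divided by
   s. *)
pose gam t := (bcurve mu v t, (shift_fun t (derive1n 1 v), 0 : 'rV[R]_nmu)).
have cgam : @ucont R (prod_ns (Xsp R ny nmu J.+1) (Xsp R ny nmu J)) gam.
  apply: (@prod_ucont R (Xsp R ny nmu J.+1) (Xsp R ny nmu J)); first exact: bcurve_ucont.
  exact: (bcurve_ucont 0 md).
have [||d1 d10 H1] := unif_curve (normed_prod nX nX') (es_cont sE) (g := gam) _ _ cgam (half_gt0 e0).
- by move=> t; split; [exact: mt|exact: (conj (Cper_shift t md) I)].
- move=> t; rewrite /gam (bcurve_per mu (Cper_periodic mv)).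
  congr (_, (_, _)); apply/funext => x; rewrite /shift_fun addrAC.
  by rewrite (Cper_periodic md).
have [d2 d20 H2] := bcurve_ucont mu mv (half_gt0 d10).
have [d3 d30 H3] := Cper_taylor_quot mv1 (half_gt0 d10).
exists (Num.min d2 d3); first by rewrite lt_min d20.
move=> t s; rewrite lt_min => /andP[s2 s3].
rewrite -phi1; apply: (@taylor_le R ny J.+1 (fun j => derive1n j (phi t s))); last first.
- move=> th /andP[th0 th1].
  have E1 x : derive1n J.+1 (phi t s) x = E l (bcurve mu v t + x *: del t s, del t s) := dphi l t s x.
  change (`|derive1n J.+1 (phi t s) th - derive1n J.+1 (phi t s) 0| <= e * `|s| ^+ J.+1).
  rewrite (E1 th) (E1 0) scale0r addr0.
  have [->|sn0] := eqVneq s 0.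
    have -> : del t 0 = 0 by rewrite /del addr0 subrr.
    by rewrite scaler0 addr0 subrr normr0 mulr_ge0 ?exprn_ge0// ltW.
  pose y : XT := s^-1 *: del t s.
  have my : vmem (Xsp R ny nmu J) y.
    have mdJ : vmem (Xsp R ny nmu J) (del t s) := conj (Cper_le (leqnSn J) (mdel t s).1) I.
    exact: (memZ nX' s^-1 mdJ).
  have dE : del t s = s *: y by rewrite /y scalerA divff// scale1r.
  have mth : vmem (Xsp R ny nmu J.+1) (bcurve mu v t + th *: del t s) := memD nX (mt t) (memZ nX th (mdel t s)).
  rewrite [X in (_, X)]dE [in X in _ - X]dE.
  rewrite (es_homog sE s mth my) (es_homog sE s (mt t) my) -scalerBr normrZ normrX mulrC.
  rewrite ler_wpM2r ?exprn_ge0//.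
  have ny2 : vnorm (Xsp R ny nmu J) (y - (shift_fun t (derive1n 1 v), 0)) <= d1 / 2.
    rewrite /= subrr scaler0 subrr normr0 ge_max (ltW (half_gt0 d10)) andbT.
    have := H3 t s s3 sn0; rewrite big_ord1 [nat_of_ord _]/= !expr0 mulr1 (_ : 1`! = 1)%N//.
    by rewrite invr1 !scale1r.
  have k1 : `|E l (bcurve mu v t + th *: del t s, y) - E l (gam t)| <= e / 2.
    apply: H1; first exact: (conj mth my).
    change (Num.max (vnorm (Xsp R ny nmu J.+1) (bcurve mu v t + th *: del t s - bcurve mu v t))
      (vnorm (Xsp R ny nmu J) (y - (shift_fun t (derive1n 1 v), 0))) < d1).
    have -> : bcurve mu v t + th *: del t s - bcurve mu v t = th *: del t s by rewrite addrAC subrr add0r.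
    rewrite gt_max; apply/andP; split; last by lra.
    apply: le_lt_trans (nsZ_le nX _ (mdel t s)) _.
    rewrite ger0_norm//; apply: (@le_lt_trans _ _ (vnorm (Xsp R ny nmu J.+1) (del t s))).
      exact: (ler_piMl (ns_ge0 nX (mdel t s)) th1).
    by apply: le_lt_trans (H2 t s s2) _; lra.
  have k2 : `|E l (bcurve mu v t, y) - E l (gam t)| <= e / 2.
    apply: H1; first exact: (conj (mt t) my).
    change (Num.max (vnorm (Xsp R ny nmu J.+1) (bcurve mu v t - bcurve mu v t))
      (vnorm (Xsp R ny nmu J) (y - (shift_fun t (derive1n 1 v), 0))) < d1).
    rewrite subrr (ns0 nX) gt_max d10 andTb; apply: le_lt_trans ny2 _; lra.
  rewrite -(subrKA (E l (gam t))); apply: le_trans (ler_normD _ _) _.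
  rewrite [e]splitr lerD//.
  by rewrite distrC.
- by rewrite ler01 lexx.
- move=> j jJ; exact: (es_hasd sE (mt t) (mdel t s) jJ).
Qed.

Lemma G_curve_reg j : (forall l, (l < j)%N -> exists E, ext_spec l G E) ->
  Cper_mem j v -> Cper_mem j (fun t => G (bcurve mu v t)).
Proof.
move=> hE mv; apply: expands_Cper; last exact: G_curve_expands.
by move=> t; rewrite (bcurve_per mu (Cper_periodic mv)).
Qed.

End Regularity.

(** * Linearization on C^{0,1} *)

Definition XLip (R : realType) (ny nmu : nat) : nspace R :=
  prod_ns (CperLip R ny 0) (euclid R nmu).

Lemma lt_of_half (R : realType) (x d : R) : 0 < d -> x <= d / 2 -> x < d.
Proof. by move=> d0 h; apply: le_lt_trans h _; rewrite ltr_pdivrMr// mulr2n mulrDr mulr1 ltrDl. Qed.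

Section LipschitzEstimates.
Variables (R : realType) (ny nmu : nat).
Local Notation V := 'rV[R]_ny.
Local Notation XT := ((R -> V) * 'rV[R]_nmu)%type.
Local Notation X1 := (Xsp R ny nmu 1).
Local Notation X0 := (Xsp R ny nmu 0).
Local Notation XL := (XLip R ny nmu).
Variables (G : XT -> V) (E : XT * XT -> V).
Hypothesis sE : ext_spec 0 G E.

Let n1 := normed_Xsp R ny nmu 1.
Let n0 := normed_Xsp R ny nmu 0.

Lemma normed_XLip : normed XL.
Proof. exact: (normed_prod (normed_CperLip R ny) (normed_euclid R nmu)). Qed.

Let nL := normed_XLip.

Lemma XLip_X0 u : vmem XL u -> vmem X0 u /\ vnorm X0 u <= vnorm XL u.
Proof.
move=> [[mv _] _]; split; first exact: (conj mv I).
have M (a b c : R) : a <= b -> Num.max a c <= Num.max b c.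
  by move=> ab; rewrite !ge_max !le_max ab !lexx ?orbT.
by apply: M; rewrite le_max lexx.
Qed.

Lemma X1_XLip u : vmem X1 u -> vmem XL u /\ vnorm XL u <= vnorm X1 u.
Proof.
move=> [mv _]; have [ml hl] := Cper1_lip mv; split; first exact: (conj ml I).
have M (a b c : R) : a <= b -> Num.max a c <= Num.max b c.
  by move=> ab; rewrite !ge_max !le_max ab !lexx ?orbT.
exact: M.
Qed.

Lemma ext_linear u : vmem X1 u -> @ns_linear R X0 (euclid R ny) (fun d => E (u, d)).
Proof.
move=> mu a x y mx my.
have H x' y' : vmem X0 x' -> vmem X0 y' -> E (u, x' + y') = E (u, x') + E (u, y').
  move=> mx' my'.
  have [|c hc] := es_poly sE 1 mu (a := fun p => if p is 0%N then x' else y' - x').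
    by move=> [|p] //; exact: (memB n0 my' mx').
  have hs (s : R) : E (u, x' + s *: (y' - x')) = c 0%N + s *: c 1%N.
    have := hc s; rewrite mul1n !big_ord_recl !big_ord0 /= !expr0 !scale1r !addr0.
    by rewrite /bump /= ?add0n ?addn0 expr1.
  have e0 := hs 0; have e1 := hs 1; have e2 := hs 2^-1.
  rewrite scale0r addr0 scale0r addr0 in e0.
  rewrite scale1r addrC subrK scale1r in e1.
  have -> : x' + y' = 2 *: (x' + 2^-1 *: (y' - x')).
    rewrite scalerDr scalerA divff ?pnatr_eq0// scale1r scaler_nat mulr2n.
    by rewrite -addrA (addrC x' (y' - x')) subrK.
  have mm : vmem X0 (x' + 2^-1 *: (y' - x')).
    exact: (memD n0 mx' (memZ n0 _ (memB n0 my' mx'))).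
  rewrite (es_homog sE _ mu mm) e2 e0 e1.
  by apply/rowP => i; rewrite !mxE; field.
have max := memZ n0 a mx.
by rewrite (H _ _ max my) (es_homog sE a mu mx).
Qed.

Variables (v : R -> V) (mu : 'rV[R]_nmu).
Hypothesis mv : Cper_mem 1 v.

Let mt t := bcurve_mem mu t mv.

Lemma ext_curve_bounded : exists rho M : R, [/\ 0 < rho, 0 <= M &
  forall t u d, vmem X1 u -> vnorm X1 (u - bcurve mu v t) < rho -> vmem X0 d ->
    `|E (u, d)| <= M * vnorm X0 d].
Proof.
have [rho [M [r0 M0 H]]] := ext_locally_bounded mu sE mv.
by exists rho, M; split => // t u d m1 m2 m3; have := H t u d m1 m2 m3; rewrite expr1.
Qed.

Lemma fin_approx_XLip : @fin_approx R XL X0 id.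
Proof.
have := fin_approx_prod (normed_CperLip R ny) (normed_euclid R nmu) (normed_Cper R ny 0)
  (normed_euclid R nmu) (@fin_approx_lip R ny) (@fin_approx_euclid R nmu).
by congr fin_approx; apply/funext => -[].
Qed.

(* E (u, d) is only jointly continuous. Closeness of E (u, d) and E (u', d) uniformly in d holds
   for d in the unit ball of XLip because that ball is precompact in X0. *)
Lemma ext_close e : 0 < e -> exists2 r : R, 0 < r &
  forall t u d, vmem X1 u -> vnorm X1 (u - bcurve mu v t) < r -> vmem XL d ->
    `|E (u, d) - E (bcurve mu v t, d)| <= e * vnorm XL d.
Proof.
move=> e0; have [rho [M [rho0 M0 HM]]] := ext_curve_bounded.
(* The error is split into e/4 for each of the two remainders of the finite-rank approximation and
   e/2 for its finite part, distributed over the index set. *)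
have M1 : 0 < 4 * (M + 1) by rewrite mulr_gt0// ltr_pwDr.
have [I [f [b [mb lf bf ef]]]] := fin_approx_XLip (divr_gt0 e0 M1).
have N1 : 0 < 2 * (#|I|%:R + 1) :> R by rewrite mulr_gt0// ltr_pwDr.
have /choice[del Hdel] : forall q : I, exists del : R, 0 < del /\ forall t u, vmem X1 u ->
    vnorm X1 (u - bcurve mu v t) < del -> `|E (u, b q) - E (bcurve mu v t, b q)| <= e / (2 * (#|I|%:R + 1)).
  move=> q; have [||d d0 H] := unif_curve (normed_prod n1 n0) (es_cont sE)
    (g := fun t => (bcurve mu v t, b q)) _ _
    (@prod_ucont R X1 X0 _ _ (bcurve_ucont mu mv) (cst_ucont n0 (b q))) (divr_gt0 e0 N1).
  - by move=> t; exact: (conj (mt t) (mb q)).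
  - by move=> t; rewrite (bcurve_per mu (Cper_periodic mv)).
  exists d; split => // t u mu' ud; apply: (H t (u, b q)); first exact: (conj mu' (mb q)).
  change (Num.max (vnorm X1 (u - bcurve mu v t)) (vnorm X0 (b q - b q)) < d).
  by rewrite subrr (ns0 n0) gt_max ud.
pose r := Num.min rho (\big[Num.min/1]_q del q).
have r0 : 0 < r.
  by rewrite lt_min rho0; apply: lt_bigmin => // q _; have [] := Hdel q.
exists r => // t u d mu' ud md.
have [md0 hd0] := XLip_X0 md.
have u1 : vnorm X1 (u - bcurve mu v t) < rho by apply: lt_le_trans ud _; rewrite ge_min lexx.
have u2 q : vnorm X1 (u - bcurve mu v t) < del q.
  by apply: lt_le_trans ud _; rewrite ge_min bigmin_le ?orbT.
have t1 : vnorm X1 (bcurve mu v t - bcurve mu v t) < rho by rewrite subrr (ns0 n1).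
have mq q : vmem X0 (f q d *: b q) by exact: (memZ n0).
have mS : vmem X0 (\sum_q f q d *: b q) by exact: (mem_sum n0).
set S := \sum_q f q d *: b q in mS.
have mR : vmem X0 (d - S) by exact: (memB n0).
have dE w : vmem X1 w -> E (w, d) = E (w, d - S) + \sum_q f q d *: E (w, b q).
  move=> mw; have lin := ext_linear mw.
  have -> : E (w, d) = E (w, (d - S) + S) by rewrite subrK.
  rewrite (linD lin mR mS); congr (_ + _).
  rewrite (lin_sum n0 lin mq); apply: eq_bigr => q _.
  by rewrite (linZ n0 lin _ (mb q)).
rewrite (dE u mu') (dE _ (mt t)) opprD addrACA -sumrB.
have d0 := ns_ge0 nL md.
have hR : vnorm X0 (d - S) <= e / (4 * (M + 1)) * vnorm XL d by exact: ef.
have hR2 : M * vnorm X0 (d - S) <= e / 4 * vnorm XL d.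
  apply: (@le_trans _ _ (M * (e / (4 * (M + 1)) * vnorm XL d))); first exact: ler_wpM2l.
  rewrite mulrA ler_wpM2r// mulrCA ler_wpM2l ?(ltW e0)//.
  rewrite invfM mulrCA ler_piMr// ler_pdivrMr ?mul1r ?lerDl// ltr_pwDr//.
have k1 := HM t u _ mu' u1 mR; have k2 := HM t _ _ (mt t) t1 mR.
have k3 : `|\sum_q (f q d *: E (u, b q) - f q d *: E (bcurve mu v t, b q))| <= e / 2 * vnorm XL d.
  apply: le_trans (ler_norm_sum _ _ _) _.
  apply: (@le_trans _ _ (\sum_(q : I) e / (2 * (#|I|%:R + 1)) * vnorm XL d)).
    apply: ler_sum => q _; rewrite -scalerBr normrZ mulrC; apply: ler_pM => //.
      exact: (Hdel q).2.
    exact: bf.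
  rewrite -mulr_suml; apply: ler_wpM2r => //.
  rewrite sumr_const [#|_|](_ : _ = #|I|)// -[leLHS]mulr_natr.
  have -> : e / (2 * (#|I|%:R + 1)) * #|I|%:R = e / 2 * (#|I|%:R / (#|I|%:R + 1)).
    by rewrite invfM; move: (_ + 1)^-1 => z; ring.
  apply: ler_piMr; first exact: ltW (half_gt0 e0).
  by rewrite ler_pdivrMr ?mul1r ?lerDl// ltr_pwDr.
apply: le_trans (ler_normD _ _) _.
have := ler_normB (E (u, d - S)) (E (bcurve mu v t, d - S)).
move: (vnorm XL d) (vnorm X0 (d - S)) d0 hR2 k1 k2 k3 {hR hd0} => x y d0 hR2 k1 k2 k3 k4.
by have := lerD (le_trans k4 (lerD k1 k2)) k3; lra.
Qed.

Lemma X1_convex u x y r th : vmem X1 u -> vmem X1 x -> vmem X1 y -> 0 <= th <= 1 ->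
  vnorm X1 (x - u) < r -> vnorm X1 (y - u) < r -> vnorm X1 (y + th *: (x - y) - u) < r.
Proof.
move=> mu' mx my /andP[t0 t1] hx hy.
have -> : y + th *: (x - y) - u = (1 - th) *: (y - u) + th *: (x - u).
  have -> : x - y = (x - u) - (y - u) by rewrite opprB addrA subrK.
  by rewrite addrAC (scalerBr th) scalerBl scale1r -[RHS]addrA [- _ + _]addrC.
have mxu := memB n1 mx mu'; have myu := memB n1 my mu'.
have h1 := nsZ_le n1 (1 - th) myu; have h2 := nsZ_le n1 th mxu.
have := nsD n1 (memZ n1 (1 - th) myu) (memZ n1 th mxu).
rewrite (ger0_norm t0) in h2; rewrite ger0_norm ?subr_ge0// in h1.
move: (vnorm X1 (x - u)) (vnorm X1 (y - u)) hx hy h1 h2 => a b hx hy h1 h2 h3.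
apply: le_lt_trans h3 _; apply: le_lt_trans (lerD h1 h2) _.
have [t00|t00] := eqVneq th 0; first by rewrite t00 subr0 mul1r mul0r addr0.
have tp : 0 < th by rewrite lt_def t00.
have hb : (1 - th) * b <= (1 - th) * r by rewrite ler_wpM2l ?subr_ge0// ltW.
have ha : th * a < th * r by rewrite ltr_pM2l.
by apply: lt_le_trans (ler_ltD hb ha) _; rewrite -mulrDl subrK mul1r.
Qed.

(** The mean value inequality on the segment from y to x, where the derivative is E at an
    intermediate base point. [ext_close] replaces that base point by v_t at a cost measured in the
    C^{0,1} norm of x - y alone. *)
Lemma G_diff_smooth e : 0 < e -> exists2 r : R, 0 < r &
  forall t x y, vmem X1 x -> vmem X1 y -> vnorm X1 (x - bcurve mu v t) < r ->
    vnorm X1 (y - bcurve mu v t) < r ->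
    `|G x - G y - E (bcurve mu v t, x - y)| <= e * vnorm XL (x - y).
Proof.
move=> e0; have [r r0 H] := ext_close e0; exists r => // t x y mx my hx hy.
have mxy := memB n1 mx my.
have [mL _] := X1_XLip mxy.
have hd := es_hasd sE my mxy (ltn0Sn 0).
have := @mvt_le R ny _ _ 0 1 (E (bcurve mu v t, x - y)) (e * vnorm XL (x - y)) hd.
rewrite add0r normr1 mulr1 scale1r => /(_ _ _)-K.
have -> : G x - G y = derive1n 0 (fun th : R => G (y + th *: (x - y))) 1 -
    derive1n 0 (fun th : R => G (y + th *: (x - y))) 0.
  by rewrite derive1n0 scale1r scale0r addr0 (addrC y) subrK.
apply: K; first by rewrite mulr_ge0 ?(ltW e0)// (ns_ge0 nL mL).
move=> th th01; rewrite mulr1 add0r (es_line sE _ my mxy).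
exact: (H t _ _ (memD n1 my (memZ n1 th mxy)) (X1_convex (mt t) mx my th01 hx hy) mL).
Qed.

Hypothesis cG : @ns_continuous R X0 (euclid R ny) G.

(* Steklov averages map C^{0,1} to C^1 without increasing the norm, which reduces difference
   estimates on C^{0,1} to smooth arguments. *)
Definition steklovX (h : R) (x : XT) : XT := (steklov h x.1, x.2).

Lemma steklovX_lim x e : vmem X0 x -> 0 < e -> exists2 d : R, 0 < d &
  forall h, 0 < h < d -> vmem X1 (steklovX h x) /\ vnorm X0 (steklovX h x - x) <= e.
Proof.
move=> [mx _] e0; have [d d0 H] := steklov_close mx e0.
exists d; first exact: d0.
move=> h hd; have [mS _] := steklov_Cper h mx.
have mS' : vmem X1 (steklovX h x) := conj mS I.
split; first exact: mS'.
by rewrite /= subrr normr0 ge_max (ltW e0) andbT H.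
Qed.

Lemma steklovX_lip x h : vmem XL x -> 0 < h -> vnorm X1 (steklovX h x) <= vnorm XL x.
Proof.
move=> [ml _] h0; have := steklov_lip h0 ml.
have M (a b c : R) : a <= b -> Num.max a c <= Num.max b c.
  by move=> ab; rewrite !ge_max !le_max ab !lexx ?orbT.
exact: M.
Qed.

Lemma steklovXB x y h : vmem X0 x -> vmem X0 y ->
  steklovX h (x - y) = steklovX h x - steklovX h y.
Proof.
move=> [mx _] [my _]; rewrite /steklovX; congr pair.
have -> : (x - y).1 = -1 *: y.1 + x.1 by rewrite scaleN1r addrC.
by rewrite steklov_lin// scaleN1r addrC.
Qed.

(** The averages of x and y need not converge in C^{0,1}. The limit h -> 0 only uses that they
    converge in C^0, where G and E (u, .) are continuous, while their C^1 norms stay bounded by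
    C^{0,1} norms. *)
Lemma G_diff_lip e : 0 < e -> exists2 r : R, 0 < r &
  forall t x y, vmem XL x -> vmem XL y -> vnorm XL (x - bcurve mu v t) <= r ->
    vnorm XL (y - bcurve mu v t) <= r ->
    `|G x - G y - E (bcurve mu v t, x - y)| <= e * vnorm XL (x - y).
Proof.
move=> e0; have [r r0 H] := G_diff_smooth e0.
(* The average of x is within r/4 of the average of v_t, which is within r/4 of v_t in C^1 for small
   h. *)
exists (r / 4); first by rewrite divr_gt0.
move=> t x y mx my hx hy; apply/ler_addgt0 => k k0.
have k4 : 0 < k / 4 by rewrite divr_gt0.
have [mx0 _] := XLip_X0 mx; have [my0 _] := XLip_X0 my.
have mxy0 := memB n0 mx0 my0; have mxy := memB nL mx my.
have [_ cG'] := cG.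
have [d1 d10 H1] := cG' x mx0 _ k4.
have [d2 d20 H2] := cG' y my0 _ k4.
have [d3 d30 H3] := ext_cont2 (es_cont sE) (mt t) mxy0 k4.
have [a1 a10 S1] := steklovX_lim mx0 (half_gt0 d10).
have [a2 a20 S2] := steklovX_lim my0 (half_gt0 d20).
have [a3 a30 S3] := steklovX_lim mxy0 (half_gt0 d30).
have r4 : 0 < r / 4 by rewrite divr_gt0.
have [a4 a40 S4] := steklov_close (Cper_shift t mv) r4.
pose h := Num.min (Num.min a1 a2) (Num.min a3 a4) / 2.
have m0 : 0 < Num.min (Num.min a1 a2) (Num.min a3 a4) by rewrite !lt_min a10 a20 a30.
have h0 : 0 < h by rewrite divr_gt0.
have hm : h < Num.min (Num.min a1 a2) (Num.min a3 a4) by exact: lt_of_half.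
move: (hm); rewrite !lt_min => /andP[/andP[hh1 hh2] /andP[hh3 hh4]].
have [sx nx] : vmem X1 (steklovX h x) /\ vnorm X0 (steklovX h x - x) <= d1 / 2 by apply: S1; rewrite h0.
have [sy ny'] : vmem X1 (steklovX h y) /\ vnorm X0 (steklovX h y - y) <= d2 / 2 by apply: S2; rewrite h0.
have [sxy nxy] : vmem X1 (steklovX h (x - y)) /\ vnorm X0 (steklovX h (x - y) - (x - y)) <= d3 / 2 by apply: S3; rewrite h0.
have [mtL _] := X1_XLip (mt t).
have [mt0 _] := XLip_X0 mtL.
have close z : vmem XL z -> vmem X1 (steklovX h z) -> vnorm XL (z - bcurve mu v t) <= r / 4 ->
    vnorm X1 (steklovX h z - bcurve mu v t) < r.
  move=> mz sz hz; have [mz0 _] := XLip_X0 mz.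
  have mzt := memB nL mz mtL.
  have [mSt _] := steklov_Cper h (Cper_le (leqnSn 0) (Cper_shift t mv)).
  have mSt' : vmem X1 (steklovX h (bcurve mu v t)) := conj mSt I.
  apply: le_lt_trans (ns_dist_trans n1 sz (mt t) mSt') _.
  have q1 : vnorm X1 (steklovX h z - steklovX h (bcurve mu v t)) <= r / 4.
    rewrite -(steklovXB h mz0 mt0); apply: le_trans (steklovX_lip mzt h0) hz.
  have q2 : vnorm X1 (steklovX h (bcurve mu v t) - bcurve mu v t) <= r / 4.
    rewrite /= subrr normr0 ge_max (ltW r4) andbT; apply: S4; by rewrite h0.
  apply: lt_of_half => //; apply: le_trans (lerD q1 q2) _.
  by rewrite (_ : r / 4 + r / 4 = r / 2)//; field.
have K := H t _ _ sx sy (close x mx sx hx) (close y my sy hy).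
have K' : vnorm XL (steklovX h x - steklovX h y) <= vnorm XL (x - y).
  rewrite -steklovXB//; have [_ b] := X1_XLip sxy; apply: le_trans b _; exact: steklovX_lip.
have G1 : `|G (steklovX h x) - G x| < k / 4.
  exact: (H1 _ (XLip_X0 (X1_XLip sx).1).1 (lt_of_half d10 nx)).
have G2 : `|G (steklovX h y) - G y| < k / 4.
  exact: (H2 _ (XLip_X0 (X1_XLip sy).1).1 (lt_of_half d20 ny')).
have G3 : `|E (bcurve mu v t, steklovX h (x - y)) - E (bcurve mu v t, x - y)| <= k / 4.
  exact: (H3 _ (XLip_X0 (X1_XLip sxy).1).1 (lt_of_half d30 nxy)).
rewrite -steklovXB// in K.
have -> : G x - G y - E (bcurve mu v t, x - y) =
   (G (steklovX h x) - G (steklovX h y) - E (bcurve mu v t, steklovX h (x - y)))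
   - (G (steklovX h x) - G x) + (G (steklovX h y) - G y)
   + (E (bcurve mu v t, steklovX h (x - y)) - E (bcurve mu v t, x - y)).
  move: (G x) (G y) (G (steklovX h x)) (G (steklovX h y)) (E _) (E _) => A1 A2 A3 A4 A5 A6.
  by apply/rowP => i; rewrite !mxE; ring.
have K2 : `|G (steklovX h x) - G (steklovX h y) - E (bcurve mu v t, steklovX h (x - y))| <= e * vnorm XL (x - y).
  by apply: le_trans K _; rewrite ler_wpM2l ?(ltW e0)// steklovXB.
move: (_ - E (bcurve mu v t, steklovX h (x - y))) (G (steklovX h x) - G x) (G (steklovX h y) - G y)
  (_ - E (bcurve mu v t, x - y)) K2 G1 G2 G3 => B1 B2 B3 B4 K2 G1 G2 G3.
have t1 := ler_normD (B1 - B2 + B3) B4.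
have t2 := ler_normD (B1 - B2) B3.
have t3 := ler_normB B1 B2.
move: (e * _) K2 => N K2.
clear -t1 t2 t3 K2 G1 G2 G3 k0; lra.
Qed.

Definition shiftX (t : R) (x : XT) : XT := (shift_fun t x.1, x.2).

Lemma shiftX_XLip t x : vmem XL x -> vmem XL (shiftX t x) /\ vnorm XL (shiftX t x) <= vnorm XL x.
Proof.
move=> [ml _]; have ms : vmem (CperLip R ny 0) (shift_fun t x.1).
  apply/lip_memP; split; first by apply: Cper_periodic; apply: Cper_shift; case: ml => mc _; exact: mc.
  exists (vnorm (CperLip R ny 0) x.1) => s s'.
  by apply: le_trans (lip_norm2 _ _ ml) _; rewrite opprD addrACA subrr add0r.
split; first exact: (conj ms I).
have M (a b c : R) : a <= b -> Num.max a c <= Num.max b c.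
  by move=> ab; rewrite !ge_max !le_max ab !lexx ?orbT.
suff b1 : vnorm (CperLip R ny 0) (shift_fun t x.1) <= vnorm (CperLip R ny 0) x.1 by exact: M b1.
apply: lip_norm_le => [s|s s']; first exact: (lip_norm1 (t + s) ml).
by apply: le_trans (lip_norm2 _ _ ml) _; rewrite opprD addrACA subrr add0r.
Qed.

Lemma shiftX_X0 t x : vmem X0 x -> vmem X0 (shiftX t x) /\ vnorm X0 (shiftX t x) = vnorm X0 x.
Proof.
move=> [mx _]; split; first exact: (conj (Cper_shift t mx) I).
by rewrite /= Cper_norm_shift.
Qed.

Lemma G_diff e : 0 < e -> exists2 r : R, 0 < r &
  forall t x y, vmem XL x -> vmem XL y -> vnorm XL (x - (v, mu)) <= r ->
    vnorm XL (y - (v, mu)) <= r ->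
    `|G (shiftX t x) - G (shiftX t y) - E (bcurve mu v t, shiftX t (x - y))| <= e * vnorm XL (x - y).
Proof.
move=> e0; have [r r0 H] := G_diff_lip e0; exists r => // t x y mx my hx hy.
have mvm : vmem XL (v, mu) by apply: (X1_XLip _).1; exact: (conj mv I).
have [mxt _] := shiftX_XLip t mx; have [myt _] := shiftX_XLip t my.
have q z : vmem XL z -> vnorm XL (z - (v, mu)) <= r -> vnorm XL (shiftX t z - bcurve mu v t) <= r.
  move=> mz hz; have [_ b] := shiftX_XLip t (memB nL mz mvm).
  exact: le_trans b hz.
apply: le_trans (H t _ _ mxt myt (q _ mx hx) (q _ my hy)) _.
rewrite ler_wpM2l ?(ltW e0)//.
have [_ b] := shiftX_XLip t (memB nL mx my).
exact: b.
Qed.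

Lemma ext_curve_Cper z : vmem X0 z -> Cper_mem 0 (fun t => E (bcurve mu v t, shiftX t z)).
Proof.
move=> mz; have [mz1 _] := mz.
have pz t : shiftX (t + 1) z = shiftX t z := bcurve_per z.2 (Cper_periodic mz1) t.
refine (proj1 (@Cper_introP _ _ 0 _ (fun=> _) erefl _ _ _)) => //.
  by move=> t; rewrite (bcurve_per mu (Cper_periodic mv)) pz.
apply/continuous_epsP => t e e0.
have cg : @ucont R (prod_ns X1 X0) (fun t => (bcurve mu v t, shiftX t z)).
  exact: (@prod_ucont R X1 X0 _ _ (bcurve_ucont mu mv) (bcurve_ucont z.2 mz1)).
have [||d d0 H] := unif_curve (normed_prod n1 n0) (es_cont sE) (g := fun t => (bcurve mu v t, shiftX t z)) _ _ cg e0.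
- by move=> s; exact: (conj (mt s) (shiftX_X0 s mz).1).
- by move=> s; rewrite (bcurve_per mu (Cper_periodic mv)) pz.
have [d' d'0 H'] := cg _ (half_gt0 d0).
exists d' => // h hd; apply: (H t (bcurve mu v (t + h), shiftX (t + h) z)).
  exact: (conj (mt (t + h)) (shiftX_X0 (t + h) mz).1).
by apply: le_lt_trans (H' t h hd) _; lra.
Qed.

(** Equicontinuity over the unit ball of C^{0,1}: the change of base point is handled by
    [ext_close], the change of direction by its Lipschitz bound. It makes piecewise interpolation of
    the linearized function accurate relative to the norm of z. *)
Lemma ext_curve_equi e : 0 < e -> exists2 d : R, 0 < d & forall z t s, vmem XL z -> `|s| < d ->
  `|E (bcurve mu v (t + s), shiftX (t + s) z) - E (bcurve mu v t, shiftX t z)| <= e * vnorm XL z.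
Proof.
move=> e0; have [rho [M [rho0 M0 HM]]] := ext_curve_bounded.
have [r r0 H] := ext_close (half_gt0 e0).
have [d d0 Hd] := bcurve_ucont mu mv (half_gt0 r0).
have M1 : 0 < 2 * (M + 1) by rewrite mulr_gt0// ltr_pwDr.
exists (Num.min d (e / (2 * (M + 1)))); first by rewrite lt_min d0 divr_gt0.
move=> z t s mz; rewrite lt_min => /andP[sd se].
have [mts _] := shiftX_XLip (t + s) mz; have z0 := ns_ge0 nL mz.
have [mz0 _] := XLip_X0 mz.
have m1 := (shiftX_X0 (t + s) mz0).1; have m2 := (shiftX_X0 t mz0).1.
have k1 : `|E (bcurve mu v (t + s), shiftX (t + s) z) - E (bcurve mu v t, shiftX (t + s) z)| <= e / 2 * vnorm XL z.
  apply: le_trans (H t _ _ (mt (t + s)) _ mts) _; first by apply: le_lt_trans (Hd t s sd) _; lra.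
  by rewrite ler_wpM2l ?(ltW (half_gt0 e0))//; have [] := shiftX_XLip (t + s) mz.
have k2 : `|E (bcurve mu v t, shiftX (t + s) z) - E (bcurve mu v t, shiftX t z)| <= e / 2 * vnorm XL z.
  rewrite -(linB n0 (ext_linear (mt t)) m1 m2).
  apply: le_trans (HM t _ _ (mt t) _ (memB n0 m1 m2)) _; first by rewrite subrr (ns0 n1).
  have hn : vnorm X0 (shiftX (t + s) z - shiftX t z) <= `|s| * vnorm XL z.
    rewrite /= subrr normr0 ge_max mulr_ge0// andbT; apply: Cper_norm_le => j x.
    rewrite leqn0 => /eqP ->; rewrite derive1n0 !fctE /shift_fun.
    have [ml _] := mz; apply: le_trans (lip_norm2 _ _ ml) _.
    rewrite (_ : t + s + x - (t + x) = s); last by ring.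
    rewrite mulrC ler_wpM2l//.
    change (vnorm (CperLip R ny 0) z.1 <= Num.max (vnorm (CperLip R ny 0) z.1) `|z.2|).
    by rewrite le_max lexx.
  apply: (@le_trans _ _ (M * (`|s| * vnorm XL z))); first exact: ler_wpM2l.
  rewrite mulrA ler_wpM2r//; apply: (@le_trans _ _ (M * (e / (2 * (M + 1))))).
    by rewrite ler_wpM2l// ltW.
  rewrite (_ : M * (e / (2 * (M + 1))) = e / 2 * (M / (M + 1))); last first.
    by rewrite invfM; move: (M + 1)^-1 => w; ring.
  by apply: ler_piMr; [exact: ltW (half_gt0 e0)|rewrite ler_pdivrMr ?mul1r ?lerDl// ltr_pwDr].
rewrite -(subrKA (E (bcurve mu v t, shiftX (t + s) z))).
apply: le_trans (ler_normD _ _) _; lra.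
Qed.

End LipschitzEstimates.

(** * The operator g and its extended derivative *)

Section NonlinearOperator.
Variables (R : realType) (ny nmu : nat).
Local Notation V := 'rV[R]_ny.
Local Notation XT := ((R -> V) * 'rV[R]_nmu)%type.
Local Notation ext := ((R -> V) * 'rV[R]_ny * 'rV[R]_nmu)%type.
Local Notation X1 := (Xsp R ny nmu 1).
Local Notation X0 := (Xsp R ny nmu 0).
Local Notation XL := (XLip R ny nmu).
Local Notation C0 := (Ce R ny nmu 0).
Local Notation C1 := (Ce R ny nmu 1).
Local Notation CL := (CeLip R ny nmu 0).
Variables (G : XT -> V) (E : XT * XT -> V) (Raff : XT -> 'rV[R]_nmu).
Variables (v : R -> V) (alpha : 'rV[R]_ny) (mu : 'rV[R]_nmu).
Hypotheses (sE : ext_spec 0 G E) (cG : @ns_continuous R X0 (euclid R ny) G).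
Hypothesis hRaff : @ns_affine R X0 (euclid R nmu) Raff.
Hypothesis hRcont : @ns_continuous R X0 (euclid R nmu) Raff.
Hypothesis mv : Cper_mem 1 v.

Let nX0 := normed_Xsp R ny nmu 0.
Let nX1 := normed_Xsp R ny nmu 1.
Let nC0 := normed_Ce R ny nmu 0.
Let nC1 := normed_Ce R ny nmu 1.
Let nCL := normed_CeLip R ny nmu.

Definition Rlin (d : XT) := Raff d - Raff 0.

(** Affine combinations with 0 give homogeneity; the midpoint of two vectors then gives
    additivity. *)
Lemma Rlin_linear : @ns_linear R X0 (euclid R nmu) Rlin.
Proof.
have m0 := mem0 nX0.
have Z a u : vmem X0 u -> Rlin (a *: u) = a *: Rlin u.
  move=> mu'; have := hRaff a mu' m0; rewrite scaler0 addr0 /Rlin => ->.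
  by rewrite scalerBl scale1r scalerBr addrCA -addrA addrC -!addrA addNr addr0 addrC.
move=> a u w mu' mw; have mau := memZ nX0 a mu'.
have half := hRaff 2^-1 mau mw.
have h1 : 1 - 2^-1 = 2^-1 :> R by field.
rewrite h1 in half.
have -> : a *: u + w = 2 *: (2^-1 *: (a *: u) + 2^-1 *: w).
  have D (x : XT) : 2 *: (2^-1 *: x) = x by rewrite scalerA divff ?scale1r// pnatr_eq0.
  by rewrite scalerDr !D.
rewrite Z; last exact: (memD nX0 (memZ nX0 _ mau) (memZ nX0 _ mw)).
rewrite -(Z a u mu') {1}/Rlin half /Rlin.
by apply/rowP => i; rewrite !mxE; field.
Qed.

Lemma Rlin_bounded : exists2 K, 0 <= K & forall d, vmem X0 d -> `|Rlin d| <= K * vnorm X0 d.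
Proof.
apply: (lin_bounded nX0 (normed_euclid R nmu) Rlin_linear).
split=> // u mu' e e0; have [_ c] := hRcont; have [d d0 H] := c u mu' e e0.
exists d => // u' mu'' ud; have := H u' mu'' ud; rewrite /Rlin /=.
by rewrite opprB addrA subrK.
Qed.

Definition pr (x : ext) : XT := (x.1.1, x.2).

Lemma pr_C0 x : vmem C0 x -> vmem X0 (pr x) /\ vnorm X0 (pr x) <= vnorm C0 x.
Proof.
move=> [[m1 _] _]; split; first exact: (conj m1 I).
by rewrite /= !ge_max !le_max !lexx !orbT.
Qed.

Lemma pr_CL x : vmem CL x -> vmem XL (pr x) /\ vnorm XL (pr x) <= vnorm CL x.
Proof.
move=> [[m1 _] _]; split; first exact: (conj m1 I).
have M (a b c : R) : Num.max a c <= Num.max (Num.max a b) c.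
  by rewrite !ge_max !le_max !lexx !orbT.
exact: M.
Qed.

Lemma gopE x : gop G Raff x = (fun t => G (bcurve x.2 x.1.1 t), x.1.2, x.2 + Raff (pr x)).
Proof. by case: x => -[]. Qed.

Lemma gop_Ce k x : (forall l, (l < k)%N -> exists E, ext_spec l G E) ->
  vmem (Ce R ny nmu k) x -> vmem (Ce R ny nmu k) (gop G Raff x).
Proof.
move=> hE [[m1 _] _]; rewrite gopE.
have m2 : Cper_mem k (fun t => G (bcurve x.2 x.1.1 t)) by exact: G_curve_reg.
exact: (conj (conj m2 I) I).
Qed.

(** The explicit candidate for the extended derivative of [gop] at xs, defined on all of C^0. *)
Definition Aop (z : ext) : ext :=
  (fun t => E (bcurve mu v t, shiftX t (pr z)), z.1.2, z.2 + Rlin (pr z)).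

Lemma Aop_mem z : vmem C0 z -> vmem C0 (Aop z).
Proof.
move=> mz; have [m1 _] := pr_C0 mz.
exact: (conj (conj (ext_curve_Cper sE mu mv m1) I) I).
Qed.

Lemma Aop_linear : @ns_linear R C0 C0 Aop.
Proof.
move=> a u w mu' mw; have [m1 _] := pr_C0 mu'; have [m2 _] := pr_C0 mw.
have prl : pr (a *: u + w) = a *: pr u + pr w by [].
have E1 : (fun t => E (bcurve mu v t, shiftX t (pr (a *: u + w)))) =
   a *: (fun t => E (bcurve mu v t, shiftX t (pr u))) + (fun t => E (bcurve mu v t, shiftX t (pr w))).
  apply/funext => t; have mt := bcurve_mem mu t mv.
  exact: (ext_linear sE mt a (shiftX_X0 t m1).1 (shiftX_X0 t m2).1).
have E2 : (a *: u + w).2 + Rlin (pr (a *: u + w)) = a *: (u.2 + Rlin (pr u)) + (w.2 + Rlin (pr w)).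
  have -> : Rlin (pr (a *: u + w)) = a *: Rlin (pr u) + Rlin (pr w) := Rlin_linear a m1 m2.
  by rewrite [(a *: u + w).2](_ : _ = a *: u.2 + w.2)// addrACA -scalerDr.
by rewrite /Aop E1 E2.
Qed.

Lemma Aop_bounded : exists2 K, 0 <= K & forall z, vmem C0 z -> vnorm C0 (Aop z) <= K * vnorm C0 z.
Proof.
have [rho [M [rho0 M0 HM]]] := ext_curve_bounded sE mu mv.
have [K K0 HK] := Rlin_bounded.
exists (M + (1 + K)); first by rewrite !addr_ge0.
move=> z mz; have [m1 h1] := pr_C0 mz; have z0 := ns_ge0 nC0 mz.
have [_ z2 z3] := Ce_norm1 mz.
have MN : M * vnorm C0 z <= (M + (1 + K)) * vnorm C0 z by rewrite ler_wpM2r// lerDl addr_ge0.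
have KN : (1 + K) * vnorm C0 z <= (M + (1 + K)) * vnorm C0 z by rewrite ler_wpM2r// lerDr.
have N1 : vnorm C0 z <= (1 + K) * vnorm C0 z by rewrite -{1}[vnorm C0 z]mul1r ler_wpM2r// lerDl.
rewrite {1}/vnorm /= !ge_max; apply/andP; split; first (apply/andP; split).
- apply: Cper_norm_le => j t; rewrite leqn0 => /eqP ->; rewrite derive1n0.
  have mt := bcurve_mem mu t mv; have [m2 h2] := shiftX_X0 t m1.
  apply: le_trans (HM t _ _ mt _ m2) _; first by rewrite subrr (ns0 nX1).
  by apply: le_trans MN; rewrite h2 ler_wpM2l.
- exact: le_trans z2 (le_trans N1 KN).
- apply: le_trans KN; apply: le_trans (ler_normD _ _) _; rewrite mulrDl mul1r lerD//.
  by apply: le_trans (HK _ m1) _; rewrite ler_wpM2l.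
Qed.

Lemma bounded_continuous (X Y : nspace R) (T : vcar X -> vcar Y) K : normed X ->
  (forall x, vmem X x -> vmem Y (T x)) -> ns_linear T -> 0 <= K ->
  (forall x, vmem X x -> vnorm Y (T x) <= K * vnorm X x) -> ns_continuous T.
Proof.
move=> nX mT lT K0 hT; split=> // u mu' e e0.
have K1 : 0 < K + 1 by rewrite ltr_pwDr.
exists (e / (K + 1)); first by rewrite divr_gt0.
move=> u' mu'' ud; rewrite -(linB nX lT mu'' mu').
have md := memB nX mu'' mu'.
apply: le_lt_trans (hT _ md) _; move: ud; rewrite ltr_pdivlMr// => ud.
by apply: le_lt_trans ud; rewrite mulrC ler_wpM2l ?lerDl// (ns_ge0 nX md).
Qed.

Let xs : ext := (v, alpha, mu).

Lemma xs_C1 : vmem C1 xs.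
Proof. exact: (conj (conj mv I) I). Qed.

(* The parameter components of gop are affine, so only the first component of the remainder
   survives. *)
Lemma gop_diff e : 0 < e -> exists2 r : R, 0 < r & forall x y, vmem CL x -> vmem CL y ->
  vnorm CL (x - xs) <= r -> vnorm CL (y - xs) <= r ->
  exists om : R -> V, [/\ gop G Raff x - gop G Raff y - Aop (x - y) = (om, 0, 0) &
     forall t, `|om t| <= e * vnorm CL (x - y)].
Proof.
move=> e0; have [r r0 H] := G_diff sE mu mv cG e0; exists r => // x y mx my hx hy.
have mxs : vmem CL xs := (Ce1_CeLip xs_C1).1.
have [px _] := pr_CL mx; have [py _] := pr_CL my.
have [_ qx] := pr_CL (memB nCL mx mxs); have [_ qy] := pr_CL (memB nCL my mxs).
have [_ qxy] := pr_CL (memB nCL mx my).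
exists (fun t => G (shiftX t (pr x)) - G (shiftX t (pr y)) - E (bcurve mu v t, shiftX t (pr x - pr y))).
split; last first.
  move=> t; apply: le_trans (H t _ _ px py (le_trans qx hx) (le_trans qy hy)) _.
  by rewrite ler_wpM2l// ltW.
rewrite !gopE /Aop.
have -> : x.2 + Raff (pr x) = (x.2 - y.2) + (Raff (pr x) - Raff (pr y)) + (y.2 + Raff (pr y)).
  by rewrite addrACA !subrK.
have -> : Rlin (pr (x - y)) = Raff (pr x) - Raff (pr y).
  have -> : pr (x - y) = pr x - pr y by [].
  rewrite (linB nX0 Rlin_linear (XLip_X0 px).1 (XLip_X0 py).1) /Rlin.
  by rewrite opprB addrA subrK.
rewrite !pairB addrK subrr; congr (_, _, _).
by rewrite subrr.
Qed.

Lemma gop_frechet : @is_frechet R C1 C0 (gop G Raff) xs Aop.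
Proof.
have [K K0 HK] := Aop_bounded.
have sub z : vmem C1 z -> vmem C0 z /\ vnorm C0 z <= vnorm C1 z.
  move=> mz; have [ml hl] := Ce1_CeLip mz; have [m0 h0] := CeLip_Ce0 ml.
  by split => //; exact: le_trans h0 hl.
have linA : @ns_linear R C1 C0 Aop.
  by move=> a u w mu' mw; apply: Aop_linear; [exact: (sub _ mu').1|exact: (sub _ mw).1].
split=> //.
  apply: (bounded_continuous (K := K) nC1 _ linA K0) => x mx; have [m0 h0] := sub x mx.
    exact: Aop_mem.
  by apply: le_trans (HK x m0) _; rewrite ler_wpM2l.
move=> e e0; have [r r0 H] := gop_diff e0; exists r => // h mh hr.
have [mhl hl] := Ce1_CeLip mh.
have mxs : vmem CL xs := (Ce1_CeLip xs_C1).1.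
have E1 : xs + h - xs = h by rewrite addrAC subrr add0r.
have h1 : vnorm CL (xs + h - xs) <= r by rewrite E1; apply: le_trans hl (ltW hr).
have h2 : vnorm CL (xs - xs) <= r by rewrite subrr (ns0 nCL) ltW.
have [om [Eom Hom]] := H (xs + h) xs (memD nCL mxs mhl) mxs h1 h2.
rewrite E1 in Eom Hom.
have -> : gop G Raff (xs + h) - gop G Raff xs - Aop h = (om, 0, 0) := Eom.
have b0 : 0 <= e * vnorm C1 h by rewrite mulr_ge0 ?(ltW e0)// (ns_ge0 nC1 mh).
rewrite {1}/vnorm /= !normr0 !ge_max b0 !andbT; apply: Cper_norm_le => j t.
rewrite leqn0 => /eqP ->; rewrite derive1n0; apply: le_trans (Hom t) _.
by rewrite ler_wpM2l// ltW.
Qed.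

Lemma Aop_ext_deriv : is_ext_deriv (gop G Raff) xs Aop.
Proof.
have [K K0 HK] := Aop_bounded; split; [exact: Aop_linear| |exact: gop_frechet].
exact: (bounded_continuous nC0 Aop_mem Aop_linear K0 HK).
Qed.

Lemma Ce_dense z e : vmem C0 z -> 0 < e ->
  exists2 z', vmem C1 z' & vnorm C0 (z' - z) <= e.
Proof.
move=> mz e0; have [m1 _] := pr_C0 mz.
have [u [mu1 _] hu] := Xsp_dense m1 e0.
exists (u.1, z.1.2, z.2); first exact: (conj (conj mu1 I) I).
move: hu; rewrite /= ge_max => /andP[h1 _].
by rewrite !subrr !normr0 !ge_max h1 (ltW e0).
Qed.

(** Two Frechet derivatives on C^1 differ by a linear map that is o(|w|), hence 0 by scaling. Both
    operators are continuous on C^0, in which C^1 is dense. *)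
Lemma ext_derivE z : vmem C0 z -> ext_deriv (gop G Raff) xs z = Aop z.
Proof.
move=> mz.
have hP : is_ext_deriv (gop G Raff) xs (ext_deriv (gop G Raff) xs).
  by apply: (@xgetPex _ _ (is_ext_deriv (gop G Raff) xs)); exists Aop; exact: Aop_ext_deriv.
move: (ext_deriv _ _) hP => B [linB' cB [_ _ fB]].
have [_ cA [_ _ fA]] := Aop_ext_deriv.
have [mB _] := cB.
have sub w : vmem C1 w -> vmem C0 w.
  by move=> mw; have [ml _] := Ce1_CeLip mw; exact: (CeLip_Ce0 ml).1.
have mBA w : vmem C0 w -> vmem C0 (B w - Aop w).
  by move=> mw; exact: (memB nC0 (mB w mw) (Aop_mem mw)).
have E1 w : vmem C1 w -> B w = Aop w.
  move=> mw; have mw0 := sub w mw; have w0 := ns_ge0 nC1 mw.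
  apply: (ns_dist_le0 nC0 (mB w mw0) (Aop_mem mw0)) => e e0.
  have k0 : 0 < 2 * (vnorm C1 w + 1) by rewrite mulr_gt0// ltr_pwDr.
  have [d1 d10 H1] := fB _ (divr_gt0 e0 k0).
  have [d2 d20 H2] := fA _ (divr_gt0 e0 k0).
  (* Scaling by s puts w inside both radii of differentiability. *)
  pose s := Num.min d1 d2 / 2 / (vnorm C1 w + 1).
  have m0 : 0 < Num.min d1 d2 by rewrite lt_min d10.
  have w1 : 0 < vnorm C1 w + 1 by rewrite ltr_pwDr.
  have s0 : 0 < s by rewrite !divr_gt0.
  have msw := memZ nC1 s mw; have msw0 := memZ nC0 s mw0.
  have Ns : vnorm C1 (s *: w) < Num.min d1 d2.
    apply: lt_of_half => //; rewrite (nsZ nC1 s mw) gtr0_norm// /s.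
    rewrite mulrAC ler_pdivrMr//; apply: ler_wpM2l; last by rewrite lerDl.
    exact: ltW (half_gt0 m0).
  move: (Ns); rewrite lt_min => /andP[N1 N2].
  have h1 := H1 _ msw N1; have h2 := H2 _ msw N2.
  have mF : vmem C0 (gop G Raff (xs + s *: w) - gop G Raff xs).
    have g0 x : vmem C0 x -> vmem C0 (gop G Raff x) by move=> mx; apply: gop_Ce.
    have mxs0 := sub _ xs_C1.
    exact: (memB nC0 (g0 _ (memD nC0 mxs0 msw0)) (g0 _ mxs0)).
  have h3 := ns_dist_trans nC0 (mB _ msw0) (Aop_mem msw0) mF.
  rewrite (ns_distC nC0 (mB _ msw0) mF) in h3.
  have {h3}h3 := le_trans h3 (lerD h1 h2).
  have Es : B (s *: w) - Aop (s *: w) = s *: (B w - Aop w).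
    by rewrite (linZ nC0 linB' s mw0) (linZ nC0 Aop_linear s mw0) scalerBr.
  rewrite Es (nsZ nC0 s (mBA w mw0)) (nsZ nC1 s mw) (gtr0_norm s0) in h3.
  rewrite -(ler_pM2l s0); apply: le_trans h3 _.
  rewrite (_ : e / (2 * (vnorm C1 w + 1)) * (s * vnorm C1 w) + e / (2 * (vnorm C1 w + 1)) * (s * vnorm C1 w) =
    s * (e * (vnorm C1 w / (vnorm C1 w + 1)))); last by field; rewrite gt_eqF.
  rewrite ler_pM2l// ler_piMr ?(ltW e0)// ler_pdivrMr// mul1r lerDl//.
apply: (ns_dist_le0 nC0 (mB z mz) (Aop_mem mz)) => e e0.
have [d1 d10 H1] := (proj2 cB) z mz _ (half_gt0 e0).
have [d2 d20 H2] := (proj2 cA) z mz _ (half_gt0 e0).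
have m0 : 0 < Num.min d1 d2 by rewrite lt_min d10.
have [w mw hw] := Ce_dense mz (half_gt0 m0).
have mw0 := sub w mw.
have := lt_of_half m0 hw; rewrite lt_min => /andP[N1 N2].
have h1 := H1 w mw0 N1; have h2 := H2 w mw0 N2; rewrite (E1 w mw) in h1.
apply: le_trans (ns_dist_trans nC0 (mB z mz) (Aop_mem mz) (Aop_mem mw0)) _.
rewrite (ns_distC nC0 (mB z mz) (Aop_mem mw0)) [e]splitr.
by apply: lerD; exact: ltW.
Qed.

Lemma DPhiE z : vmem C0 z -> DPhi G Raff xs z = Lop (Aop z).
Proof. by move=> mz; rewrite /DPhi ext_derivE. Qed.

End NonlinearOperator.

(** * The discretized fixed point problem *)

Section DiscretizedProblem.
Variables (R : realType) (ny nmu lmax m : nat).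
Local Notation V := 'rV[R]_ny.
Local Notation XT := ((R -> V) * 'rV[R]_nmu)%type.
Local Notation ext := ((R -> V) * 'rV[R]_ny * 'rV[R]_nmu)%type.
Local Notation X0 := (Xsp R ny nmu 0).
Local Notation C0 := (Ce R ny nmu 0).
Local Notation C1 := (Ce R ny nmu 1).
Local Notation CL := (CeLip R ny nmu 0).
Variables (G : XT -> V) (Raff : XT -> 'rV[R]_nmu).
Variables (tc : 'I_m -> R) (Cmsh : R) (tm : nat -> nat -> R) (xs : ext).
Hypotheses (hlmax : (1 <= lmax)%N) (hm : (1 <= m)%N).
Hypothesis hG : mildly_differentiable lmax G.
Hypothesis hRaff : @ns_affine R X0 (euclid R nmu) Raff.
Hypothesis hRcont : @ns_continuous R X0 (euclid R nmu) Raff.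
Hypotheses (htc : injective tc) (htc01 : forall j, 0 < tc j < 1).
Hypothesis htm : forall L, (1 <= L)%N -> is_mesh L Cmsh (tm L).
Hypotheses (hxs : vmem CL xs) (hfix : xs = Phi G Raff xs).

Let nC0 := normed_Ce R ny nmu 0.
Let nCL := normed_CeLip R ny nmu.
Let cCL := @complete_CeLip R ny nmu.
Let cG := mild_cont hG.

(** Bootstrap along xs = Lop (g xs): g preserves C^j for j <= lmax and [Lop] adds one derivative. *)
Lemma fixed_point_regular j : (j <= lmax.+1)%N -> vmem (Ce R ny nmu j) xs.
Proof.
elim: j => [_|j IH jl]; first exact: (CeLip_Ce0 hxs).1.
rewrite hfix /Phi; apply: Lop_Ce; apply: gop_Ce => //; last exact: IH (ltnW jl).
by move=> l lj; apply: mild_ext hG _; exact: leq_trans lj _.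
Qed.

Let mv : Cper_mem 1 xs.1.1 := (fixed_point_regular (leqW hlmax)).1.1.

Lemma meshwidth_lt d : 0 < d -> exists L0 : nat, forall L, (L0 <= L)%N -> (1 <= L)%N ->
  forall i, (i < L)%N -> tm L i.+1 - tm L i < d.
Proof.
move=> d0; exists (Num.truncn `|Cmsh / d|).+1 => L L0L L1 i iL.
have [_ _ h] := htm L1; have [_ hi] := h i iL; apply: le_lt_trans hi _.
have Lp : 0 < L%:R :> R by rewrite ltr0n.
rewrite ltr_pdivrMr// mulrC -ltr_pdivrMr//; apply: le_lt_trans (ler_norm _) _.
by apply: lt_le_trans (truncnS_gt _) _; rewrite ler_nat.
Qed.

Lemma Cmsh_ge0 : 0 <= Cmsh.
Proof.
have [_ _ h] := htm (leqnn 1); have [h1] := h 0%N isT; rewrite divr1.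
by apply: le_trans; rewrite subr_ge0 ltW.
Qed.

Let Lam := lebesgue_cst tc.

Lemma nodes_countable L : countable (range (tm L)).
Proof. exact: card_image_le. Qed.

Lemma PhiL_mem L x : (1 <= L)%N -> vmem CL x -> vmem CL (PhiL tc G Raff L (tm L) x).
Proof.
move=> L1 mx; have mesh := htm L1.
have mx0 := (CeLip_Ce0 mx).1.
have mg : vmem C0 (gop G Raff x) by apply: gop_Ce.
have [h1 h2 h3] := Ce_norm1 mg.
set N0 := vnorm C0 _ in h1 h2 h3.
have N00 : 0 <= N0 := ns_ge0 nC0 mg.
have L0 : 0 <= Lam := lebesgue_cst_ge0 tc.
have k1 : Lam * N0 <= Lam * N0 + N0 by rewrite lerDl.
have k2 : N0 <= Lam * N0 + N0 by rewrite lerDr mulr_ge0.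
refine (proj1 (@Lop_bound R ny nmu (PLe tc L (tm L) (gop G Raff x)) (Lam * N0 + N0) (range (tm L)) _ _ _ _ _ _)).
- exact: (PL_vintegrable tc mesh (gop G Raff x).1.1).
- exact: le_trans N00 k2.
- exact: nodes_countable.
- by move=> t t01 nt; exact: (le_trans (PL_bound tc mesh t01 nt h1) k1).
- exact: le_trans h2 k2.
- exact: le_trans h3 k2.
Qed.

Lemma Lop_first_bound (om : R -> V) M (N : set R) : vintegrable om -> 0 <= M -> countable N ->
  (forall t, 0 <= t <= 1 -> ~ N t -> `|om t| <= M) ->
  vmem CL (Lop ((om, 0, 0) : ext)) /\ vnorm CL (Lop ((om, 0, 0) : ext)) <= 3 * M.
Proof.
move=> io M0 cN H; apply: (@Lop_bound R ny nmu (om, 0, 0) M N) => //=; by rewrite normr0.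
Qed.

Section WithExtension.
Variable E : XT * XT -> V.
Hypothesis sE : ext_spec 0 G E.

Let A := Aop E Raff xs.1.1 xs.2.

Lemma xs_eta : xs = (xs.1.1, xs.1.2, xs.2).
Proof. by case: xs => -[]. Qed.

Let T := DPhi G Raff xs.

Lemma DPhi_Lop z : vmem C0 z -> T z = Lop (A z).
Proof.
by move=> mz; rewrite /T {1}xs_eta; exact: (DPhiE xs.1.2 xs.2 sE cG hRaff hRcont mv mz).
Qed.

Let mA z (mz : vmem C0 z) : vmem C0 (A z) := Aop_mem Raff xs.2 sE mv mz.
Let lA : @ns_linear R C0 C0 A := Aop_linear xs.2 sE hRaff mv.

Lemma DPhi_linear : @ns_linear R C0 CL T.
Proof.
move=> a u w mu' mw; have muw : vmem C0 (a *: u + w) := mem_lin nC0 a mu' mw.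
have iu := Ce_vintegrable (mA mu'); have iw := Ce_vintegrable (mA mw).
rewrite (DPhi_Lop muw) (DPhi_Lop mu') (DPhi_Lop mw) -(Lop_lin a iu iw).
by congr Lop; exact: lA.
Qed.

Lemma DPhi_bounded : exists2 K, 0 <= K & forall z, vmem C0 z ->
  vmem CL (T z) /\ vnorm CL (T z) <= K * vnorm C0 z.
Proof.
have [K K0 HK] := Aop_bounded xs.2 sE hRaff hRcont mv.
exists (3 * K); first by rewrite mulr_ge0.
move=> z mz; have [m1 h1] := Lop_Ce_bound (mA mz); rewrite (DPhi_Lop mz); split; first exact: m1.
by apply: le_trans h1 _; rewrite -mulrA ler_wpM2l//; exact: HK.
Qed.

Lemma DPhi_C1 z : vmem C0 z -> vmem C1 (T z).
Proof. by move=> mz; rewrite (DPhi_Lop mz); apply: Lop_Ce; exact: mA. Qed.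

Lemma fin_approx_CeLip : @fin_approx R CL C0 id.
Proof.
have h1 := fin_approx_prod (normed_CperLip R ny) (normed_euclid R ny) (normed_Cper R ny 0)
  (normed_euclid R ny) (@fin_approx_lip R ny) (@fin_approx_euclid R ny).
have := fin_approx_prod (normed_prod (normed_CperLip R ny) (normed_euclid R ny)) (normed_euclid R nmu)
  (normed_prod (normed_Cper R ny 0) (normed_euclid R ny)) (normed_euclid R nmu) h1 (@fin_approx_euclid R nmu).
by congr fin_approx; apply/funext => -[[]].
Qed.

(** T is bounded from C^0 to C^{0,1}, so a finite-rank approximation of the embedding, composed with
    T, approximates T in C^{0,1}. Injectivity on C^1 is enough because a solution of x = T x lies in
    C^1. *)
Lemma injective_bounded_inverse :
  {in vmem C1 &, injective (fun x => x - T x)} -> @has_bounded_inverse R CL (fun x => x - T x).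
Proof.
move=> inj; have [K K0 HK] := DPhi_bounded.
(* The accuracy 1 / (2 (K + 1)), multiplied by the bound K of T, stays below the factor 1/2 that
   [fredholm] requires. *)
have K6 : 0 < 2 * (K + 1) by rewrite mulr_gt0// ltr_pwDr.
have [I [f [b [mb lf bf ef]]]] := fin_approx_CeLip (divr_gt0 ltr01 K6).
have sub x : vmem CL x -> vmem C0 x by move=> mx; exact: (CeLip_Ce0 mx).1.
have mT x : vmem CL x -> vmem CL (T x) by move=> mx; exact: (HK x (sub x mx)).1.
have lT : @ns_linear R CL CL T by move=> a u w mu' mw; exact: DPhi_linear (sub _ mu') (sub _ mw).
have mTb q : vmem CL (T (b q)) := (HK _ (mb q)).1.
apply: (@fredholm R CL nCL cCL T #|I| (fun q => f (enum_val q)) (fun q => T (b (enum_val q))) 1).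
- exact: mT.
- exact: lT.
- by move=> q; exact: mTb.
- by move=> q a u w mu' mw; exact: lf.
- by move=> q u mu'; rewrite mul1r; exact: bf.
- move=> x mx; have mx0 := sub x mx.
  have -> : \sum_(q < #|I|) f (enum_val q) x *: T (b (enum_val q)) = \sum_q f q x *: T (b q).
    by rewrite [RHS](reindex _ (onW_bij _ (@enum_val_bij I))).
  have mfb q : vmem C0 (f q x *: b q) := memZ nC0 _ (mb q).
  have mS : vmem C0 (\sum_q f q x *: b q) := mem_sum nC0 mfb.
  have -> : T x - \sum_q f q x *: T (b q) = T (x - \sum_q f q x *: b q).
    rewrite (linB nC0 DPhi_linear mx0 mS) (lin_sum nC0 DPhi_linear mfb); congr (_ - _).
    by apply: eq_bigr => q _; rewrite (linZ nC0 DPhi_linear _ (mb q)).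
  apply: le_trans (HK _ (memB nC0 mx0 mS)).2 _.
  apply: (@le_trans _ _ (K * (1 / (2 * (K + 1)) * vnorm CL x))).
    by apply: ler_wpM2l => //; exact: ef.
  rewrite mulrA ler_wpM2r ?(ns_ge0 nCL mx)// mul1r invfM mulrCA.
  by rewrite ler_piMr ?invr_ge0// ler_pdivrMr ?mul1r ?lerDl// ltr_pwDr.
- move=> x mx x0; have mx0 := sub x mx.
  have xT : x = T x by apply/eqP; rewrite -subr_eq0 x0.
  have mx1 : vmem C1 x by rewrite xT; exact: DPhi_C1.
  have m01 : vmem C1 0 := mem0 (normed_Ce R ny nmu 1).
  apply: inj; rewrite ?inE//.
  by rewrite x0 (lin0 nC0 DPhi_linear) subrr.
Qed.

Lemma bounded_inverse_injective :
  @has_bounded_inverse R CL (fun x => x - T x) -> {in vmem C1 &, injective (fun x => x - T x)}.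
Proof.
move=> [B [_ h _]] x y /set_mem mx /set_mem my exy.
have [_ ex] := h x (Ce1_CeLip mx).1; have [_ ey] := h y (Ce1_CeLip my).1.
exact: (etrans (esym ex) (etrans (congr1 B exy) ey)).
Qed.

Lemma PLeE L x : PLe tc L (tm L) x = (PL tc L (tm L) x.1.1, x.1.2, x.2) :> ext.
Proof. by []. Qed.

(** The difference is [Lop] of the interpolated linearization error plus the interpolation error of
    the linearized function. The former is small for x and y near xs, the latter for a fine mesh,
    both relative to the norm of x - y. *)
Lemma PhiL_diff e : 0 < e -> exists r : R, [/\ 0 < r & exists L0 : nat, forall L, (L0 <= L)%N -> (1 <= L)%N ->
  forall x y, ns_ball (X := CL) xs r x -> ns_ball (X := CL) xs r y ->
  vnorm CL (PhiL tc G Raff L (tm L) x - PhiL tc G Raff L (tm L) y - T (x - y)) <=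
    e * vnorm CL (x - y)].
Proof.
move=> e0.
have L0 : 0 <= Lam := lebesgue_cst_ge0 tc.
(* The 3 comes from [Lop]; 2 Lam + 1 is Lam for the interpolated linearization error plus Lam + 1
   for the interpolation error. *)
have k0 : 0 < 3 * (2 * Lam + 1) by rewrite mulr_gt0// ltr_pwDr// mulr_ge0.
pose e1 := e / (3 * (2 * Lam + 1)).
have e10 : 0 < e1 by rewrite divr_gt0.
have [r r0 Hr] := gop_diff xs.1.2 xs.2 sE cG hRaff mv e10.
rewrite -xs_eta -/A in Hr.
have [d d0 Hd] := ext_curve_equi sE xs.2 mv e10.
have [N0 HN] := meshwidth_lt d0.
exists r; split=> //; exists N0 => L N0L L1 x y [mx hx] [my hy].
have mesh := htm L1.
have [om [Eom Hom]] := Hr x y mx my hx hy.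
have mxy := memB nCL mx my; have mxy0 := (CeLip_Ce0 mxy).1.
have n0 : 0 <= vnorm CL (x - y) := ns_ge0 nCL mxy.
have mgx : vmem C0 (gop G Raff x) by apply: gop_Ce => //; exact: (CeLip_Ce0 mx).1.
have mgy : vmem C0 (gop G Raff y) by apply: gop_Ce => //; exact: (CeLip_Ce0 my).1.
set z := x - y in Eom Hom mxy mxy0 n0 *; set n := vnorm CL z in Hom n0 *.
have iAz := Ce_vintegrable (mA mxy0).
have ipx := PL_vintegrable tc mesh (gop G Raff x).1.1.
have ipy := PL_vintegrable tc mesh (gop G Raff y).1.1.
pose P (w : R -> V) := PL tc L (tm L) w.
(* Written in the form a *: u + w in which linearity of the integral and of [Lop] is stated. *)
pose om' : R -> V := (-1) *: (A z).1.1 + ((-1) *: P (gop G Raff y).1.1 + P (gop G Raff x).1.1).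
have om'E : om' = P om + (P (A z).1.1 - (A z).1.1).
  have -> : om = (-1) *: (A z).1.1 + ((-1) *: (gop G Raff y).1.1 + (gop G Raff x).1.1).
    have := congr1 (fun q : ext => q.1.1) Eom => /= <-.
    by rewrite !scaleN1r [RHS]addrC [- _ + _]addrC.
  rewrite /om' /P !PL_lin !scaleN1r.
  by rewrite [RHS]addrACA addNr add0r [RHS]addrC.
have EL : PhiL tc G Raff L (tm L) x - PhiL tc G Raff L (tm L) y - T z = Lop ((om', 0, 0) : ext).
  rewrite (DPhi_Lop mxy0) /PhiL !PLeE.
  pose px : ext := (P (gop G Raff x).1.1, (gop G Raff x).1.2, (gop G Raff x).2).
  pose py : ext := (P (gop G Raff y).1.1, (gop G Raff y).1.2, (gop G Raff y).2).
  have i1 : vintegrable ((-1) *: py + px : ext).1.1 := vintegrable_lin (-1) ipy ipx.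
  have -> : Lop px - Lop py - Lop (A z) = (-1) *: Lop (A z) + ((-1) *: Lop py + Lop px).
    by rewrite !scaleN1r [RHS]addrC [- Lop py + _]addrC.
  rewrite -(@Lop_lin R ny nmu (-1) py px ipy ipx) -(@Lop_lin R ny nmu (-1) (A z) _ iAz i1).
  congr Lop.
  have h1 := congr1 (fun q : ext => q.1.2) Eom; have h2 := congr1 (fun q : ext => q.2) Eom.
  have h1' : ((-1) *: A z + ((-1) *: py + px)).1.2 = 0.
    rewrite -[RHS]h1 /= !scaleN1r [LHS]addrC [- _ + _]addrC; exact: erefl.
  have h2' : ((-1) *: A z + ((-1) *: py + px)).2 = 0.
    rewrite -[RHS]h2 /= !scaleN1r [LHS]addrC [- _ + _]addrC; exact: erefl.
  rewrite [LHS](_ : _ = (om', ((-1) *: A z + ((-1) *: py + px)).1.2, ((-1) *: A z + ((-1) *: py + px)).2))//.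
  by rewrite h1' h2'.
rewrite EL.
have iom : vintegrable om' := vintegrable_lin (-1) iAz (vintegrable_lin (-1) ipy ipx).
have bnd t : 0 <= t <= 1 -> ~ range (tm L) t -> `|om' t| <= (2 * Lam + 1) * (e1 * n).
  move=> t01 nt; rewrite om'E; apply: (le_trans (ler_normD (P om t) ((P (A z).1.1 - (A z).1.1) t))).
  have -> : (2 * Lam + 1) * (e1 * n) = Lam * (e1 * n) + (Lam + 1) * (e1 * n) by ring.
  apply: lerD; first exact: (PL_bound tc mesh t01 nt Hom).
  apply: (PL_error htc htc01 mesh t01 nt) => i iL.
  (* A constant is compared with on each mesh interval; this is admissible since m >= 1. *)
  exists (fun p => if p == 0%N then (A z).1.1 (tm L i) else 0) => s /andP[s0 sh].
  have -> : \sum_(p < m) s ^+ p *: (if (p : nat) == 0%N then (A z).1.1 (tm L i) else 0) = (A z).1.1 (tm L i).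
    case: (m) hm => // m' _; rewrite big_ord_recl expr0 scale1r big1 ?addr0// => p _.
    by rewrite scaler0.
  have [mprz hprz] := pr_CL mxy.
  apply: le_trans (Hd (pr z) (tm L i) s mprz _) _.
    by rewrite ger0_norm//; apply: le_lt_trans sh _; exact: HN.
  by rewrite ler_wpM2l// ltW.
have M0 : 0 <= (2 * Lam + 1) * (e1 * n).
  by apply: mulr_ge0; [rewrite addr_ge0 ?mulr_ge0|exact: mulr_ge0 (ltW e10) n0].
have [_ h] := Lop_first_bound iom M0 (nodes_countable L) bnd.
apply: le_trans h _.
have -> : 3 * ((2 * Lam + 1) * (e1 * n)) = e1 * (3 * (2 * Lam + 1)) * n by ring.
by rewrite /e1 divfK// gt_eqF.
Qed.

(** With k = min(lmax, m), the expansion of G (v_t, mu) at each left mesh point is cut below degree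
    k <= m. The dropped term costs B |s|^k and the remainder, taken with e = 1, costs |s|^k; the
    mesh condition turns |s|^k into (Cmsh / L)^k. *)
Lemma PhiL_residual : exists K : R, [/\ 0 <= K & exists L0 : nat, forall L, (L0 <= L)%N -> (1 <= L)%N ->
  vnorm CL (PhiL tc G Raff L (tm L) xs - xs) <= K * L%:R ^- minn lmax m].
Proof.
set k := minn lmax m.
have kl : (k <= lmax)%N by exact: geq_minl.
have km : (k <= m)%N by exact: geq_minr.
have mxk : vmem (Ce R ny nmu k) xs by apply: fixed_point_regular; exact: leqW.
have hE l : (l < k)%N -> exists E, ext_spec l G E.
  by move=> lk; apply: mild_ext hG _; exact: leq_trans lk kl.
have [c [B HB] hc] := G_curve_expands xs.2 cG hE mxk.1.1.
have B0 : 0 <= B by apply: le_trans (HB 0%N 0).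
have [d d0 Hd] := hc 1 ltr01.
have [N0 HN] := meshwidth_lt d0.
have L0 : 0 <= Lam := lebesgue_cst_ge0 tc.
exists (3 * ((Lam + 1) * ((1 + B) * Cmsh ^+ k))).
have C0' := Cmsh_ge0.
split; first by rewrite !mulr_ge0 ?addr_ge0 ?exprn_ge0.
exists N0 => L N0L L1; have mesh := htm L1.
have Lp : 0 < L%:R :> R by rewrite ltr0n.
pose w := (gop G Raff xs).1.1.
have wE t : w t = G (bcurve xs.2 xs.1.1 t) by rewrite /w gopE.
have mg : vmem C0 (gop G Raff xs) by apply: gop_Ce => //; exact: (CeLip_Ce0 hxs).1.
have iw := Ce_vintegrable mg.
have ipw := PL_vintegrable tc mesh w.
pose om : R -> V := (-1) *: w + PL tc L (tm L) w.
have iom : vintegrable om := vintegrable_lin (-1) iw ipw.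
have EL : PhiL tc G Raff L (tm L) xs - xs = Lop ((om, 0, 0) : ext).
  rewrite {2}hfix /Phi /PhiL PLeE -/w.
  pose px : ext := (PL tc L (tm L) w, (gop G Raff xs).1.2, (gop G Raff xs).2).
  have -> : Lop px - Lop (gop G Raff xs) = (-1) *: Lop (gop G Raff xs) + Lop px.
    by rewrite scaleN1r addrC.
  rewrite -(@Lop_lin R ny nmu (-1) (gop G Raff xs) px iw ipw); congr Lop.
  rewrite [LHS](_ : _ = (om, (-1) *: (gop G Raff xs).1.2 + (gop G Raff xs).1.2, (-1) *: (gop G Raff xs).2 + (gop G Raff xs).2))//.
  by rewrite !scaleN1r !addNr.
pose M := (1 + B) * (Cmsh / L%:R) ^+ k.
have M0 : 0 <= M by rewrite mulr_ge0 ?addr_ge0// exprn_ge0// divr_ge0// ltW.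
have bnd t : 0 <= t <= 1 -> ~ range (tm L) t -> `|om t| <= (Lam + 1) * M.
  move=> t01 nt; have -> : om t = PL tc L (tm L) w t - w t by rewrite /om scaleN1r addrC.
  apply: (PL_error htc htc01 mesh t01 nt) => i iL.
  exists (fun p => if (p < k)%N then c p (tm L i) else 0) => s /andP[s0 sh].
  have [_ _ hmesh] := mesh; have [_ hw] := hmesh i iL.
  have sd : `|s| < d by rewrite ger0_norm//; apply: le_lt_trans sh _; exact: HN.
  have := Hd (tm L i) s sd; rewrite -wE big_ord_recr /= mul1r => h.
  have -> : \sum_(p < m) s ^+ p *: (if (p < k)%N then c p (tm L i) else 0) = \sum_(p < k) s ^+ p *: c p (tm L i).
    rewrite (big_ord_widen m (fun p => s ^+ p *: c p (tm L i)) km) [RHS]big_mkcond /=.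
    by apply: eq_bigr => p _; case: ifP => // _; rewrite scaler0.
  have sk : `|s| ^+ k <= (Cmsh / L%:R) ^+ k.
    rewrite lerXn2r ?nnegrE// ?(ger0_norm s0)//; last exact: le_trans sh hw.
    exact: le_trans s0 (le_trans sh hw).
  rewrite opprD addrA in h.
  rewrite -[X in `|X|](subrK (s ^+ k *: c k (tm L i))).
  apply: le_trans (ler_normD _ _) _; rewrite /M mulrDl mul1r; apply: lerD.
    exact: le_trans h sk.
  rewrite normrZ normrX mulrC; apply: ler_pM => //.
have MM0 : 0 <= (Lam + 1) * M by rewrite mulr_ge0// addr_ge0.
have [_ h] := Lop_first_bound iom MM0 (nodes_countable L) bnd.
rewrite EL; apply: le_trans h _; rewrite /M expr_div_n.
by rewrite !mulrA.
Qed.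

(** Applying B to the identity S = I - T shows F x - F y = B (Phi_L x - Phi_L y - T (x - y)), so
    [PhiL_diff] with e = 1 / (2 M) gives the factor 1/2. The radius is that of [PhiL_diff] and does
    not depend on L. *)
Lemma discretized_solution : @has_bounded_inverse R CL (fun x => x - T x) ->
  exists r : R, 0 < r /\ exists xL : nat -> ext, exists K : R, 0 <= K /\
    exists L0 : nat, forall L, (L0 <= L)%N ->
     unique (fun x => ns_ball (X := CL) xs r x /\ x = PhiL tc G Raff L (tm L) x) (xL L) /\
     vnorm CL (xL L - xs) <= K * L%:R ^- minn lmax m.
Proof.
move=> [B [hB1 hB2 [MB HB]]].
have [K0 K00 HK0] := DPhi_bounded.
have sub x : vmem CL x -> vmem C0 x by move=> mx; exact: (CeLip_Ce0 mx).1.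
have mT x : vmem CL x -> vmem CL (T x) by move=> mx; exact: (HK0 x (sub x mx)).1.
have lT : @ns_linear R CL CL T by move=> a u w mu' mw; exact: DPhi_linear (sub _ mu') (sub _ mw).
pose S (x : ext) := x - T x.
have lS : @ns_linear R CL CL S.
  by move=> a u w mu' mw; rewrite /S lT// scalerBr opprD addrACA.
have lB : @ns_linear R CL CL B.
  move=> a u w mu' mw; have [mBu Su] := hB1 u mu'; have [mBw Sw] := hB1 w mw.
  have mm : vmem CL (a *: B u + B w) := mem_lin nCL a mBu mBw.
  rewrite -[RHS](hB2 _ mm).2; congr B.
  by have := lS a _ _ mBu mBw; rewrite /S Su Sw => ->.
pose M := `|MB| + 1.
have M0 : 0 < M by rewrite ltr_pwDr.
have HM y : vmem CL y -> vnorm CL (B y) <= M * vnorm CL y.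
  move=> my; apply: le_trans (HB y my) _; rewrite ler_wpM2r ?(ns_ge0 nCL my)//.
  by apply: le_trans (ler_norm _) _; rewrite lerDl.
have e0 : 0 < (2 * M)^-1 by rewrite invr_gt0 mulr_gt0.
have [r [r0 [N1 H1]]] := PhiL_diff e0.
have [K [K1 [N2 H2]]] := PhiL_residual.
have kpos : (0 < minn lmax m)%N by rewrite leq_min hlmax hm.
(* Since L^-k <= 1/L, this makes the displacement M K L^-k at most r/2. *)
pose N3 := (Num.truncn (2 * M * K / r)).+1.
pose F L (x : ext) := x - B (x - PhiL tc G Raff L (tm L) x).
have step L : (N1 + N2 + N3 <= L)%N -> exists x,
    unique (fun x => ns_ball (X := CL) xs r x /\ x = PhiL tc G Raff L (tm L) x) x /\
    vnorm CL (x - xs) <= 2 * M * K * L%:R ^- minn lmax m.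
  move=> NL.
  have L1 : (1 <= L)%N by apply: leq_trans NL; rewrite /N3 addnS.
  have NL1 : (N1 <= L)%N by apply: leq_trans NL; rewrite -addnA leq_addr.
  have NL2 : (N2 <= L)%N by apply: leq_trans NL; rewrite addnAC leq_addl.
  have NL3 : (N3 <= L)%N by apply: leq_trans NL; rewrite leq_addl.
  have mPL x : vmem CL x -> vmem CL (PhiL tc G Raff L (tm L) x) by exact: PhiL_mem.
  have mxP x (mx : vmem CL x) : vmem CL (x - PhiL tc G Raff L (tm L) x) := memB nCL mx (mPL x mx).
  have mF x : vmem CL x -> vmem CL (F L x).
    by move=> mx; apply: (memB nCL mx); exact: (hB1 _ (mxP x mx)).1.
  have res : vnorm CL (F L xs - xs) <= M * (K * L%:R ^- minn lmax m).
    have -> : F L xs - xs = B (PhiL tc G Raff L (tm L) xs - xs).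
      rewrite /F addrAC subrr add0r -(linN nCL lB (mxP _ hxs)).
      by rewrite opprB.
    apply: le_trans (HM _ (memB nCL (mPL _ hxs) hxs)) _.
    by apply: ler_wpM2l; [exact: ltW|exact: H2].
  have Lp : 0 < L%:R :> R by rewrite ltr0n.
  have small : M * (K * L%:R ^- minn lmax m) <= r / 2.
    have L1' : L%:R ^- minn lmax m <= (L%:R : R)^-1.
      rewrite -[X in _ <= X^-1]expr1 lef_pV2 ?posrE ?exprn_gt0// ler_weXn2l// ler1n//.
    apply: (@le_trans _ _ (M * (K * L%:R^-1))).
      by apply: ler_wpM2l; [exact: ltW|exact: ler_wpM2l].
    rewrite mulrA ler_pdivrMr// mulrAC ler_pdivlMr//.
    have : 2 * M * K / r < L%:R.
      by apply: lt_le_trans (truncnS_gt _) _; rewrite ler_nat.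
    rewrite ltr_pdivrMr// => h; apply: ltW.
    by rewrite (mulrC r) (mulrC (M * K)) mulrA.
  have contr x y : ns_ball (X := CL) xs r x -> ns_ball (X := CL) xs r y ->
      vnorm CL (F L x - F L y) <= 2^-1 * vnorm CL (x - y).
    move=> bx by_; have [mx _] := bx; have [my _] := by_.
    have mxy := memB nCL mx my.
    set D := PhiL tc G Raff L (tm L) x - PhiL tc G Raff L (tm L) y - T (x - y).
    have mD : vmem CL D := memB nCL (memB nCL (mPL x mx) (mPL y my)) (mT _ mxy).
    have -> : F L x - F L y = B D.
      have E1 : x - y = B (x - y - T (x - y)) := esym (hB2 _ mxy).2.
      have mS := (hB2 _ mxy).1.
      rewrite /F opprD addrACA {1}E1 -opprD.
      rewrite -[X in _ - X](linB nCL lB (mxP x mx) (mxP y my)) -(linB nCL lB mS (memB nCL (mxP x mx) (mxP y my))).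
      congr B; rewrite /D -/(T (x - y)); set q := T (x - y).
      set px := PhiL _ _ _ _ _ x; set py := PhiL _ _ _ _ _ y.
      have -> : x - px - (y - py) = x - y - (px - py) by rewrite opprD addrACA -opprD.
      by rewrite opprB addrC subrKA.
    apply: le_trans (HM D mD) _.
    apply: (@le_trans _ _ (M * ((2 * M)^-1 * vnorm CL (x - y)))).
      by apply: ler_wpM2l; [exact: ltW|exact: H1].
    by rewrite mulrA invfM mulrCA divff ?mulr1// gt_eqF.
  have [x [bx Fx hx ux]] := ns_contraction nCL cCL hxs
    (fun x bx => mF x bx.1) contr (ltW r0) (le_trans res small).
  (* The fixed points of F are those of Phi_L because B is injective, so uniqueness carries over. *)
  have fixP y : vmem CL y -> F L y = y <-> y = PhiL tc G Raff L (tm L) y.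
    move=> my; have mm := mxP y my; split=> [E1|E1].
      have B0 : B (y - PhiL tc G Raff L (tm L) y) = 0.
        by apply/oppr_inj/(addrI y); rewrite oppr0 addr0.
      have [_] := hB1 _ mm; rewrite B0 (lin0 nCL lT) subrr => /esym/eqP.
      by rewrite subr_eq0 => /eqP.
    by rewrite /F -E1 subrr (lin0 nCL lB) subr0.
  exists x; split.
    split; first by split => //; exact/(fixP x bx.1).
    by move=> y [by_ Ey]; apply: ux => //; exact/(fixP y by_.1).
  apply: le_trans hx _; rewrite -!mulrA; apply: ler_wpM2l => //.
exists r; split => //.
have /choice[xL HxL] : forall L : nat, exists x : ext, (N1 + N2 + N3 <= L)%N ->
    unique (fun x => ns_ball (X := CL) xs r x /\ x = PhiL tc G Raff L (tm L) x) x /\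
    vnorm CL (x - xs) <= 2 * M * K * L%:R ^- minn lmax m.
  (* For small L the value xs is a placeholder; nothing is claimed there. *)
  move=> L; have [h|h] := boolP (N1 + N2 + N3 <= L)%N; last by exists xs.
  by have [x hx] := step L h; exists x.
exists xL, (2 * M * K); split; first by rewrite !mulr_ge0// ltW.
by exists (N1 + N2 + N3)%N.
Qed.

End WithExtension.

End DiscretizedProblem.

Unset Implicit Arguments.
Set Strict Implicit.

Theorem theorem6p6 (R : realType) (ny nmu lmax m : nat)
    (G : (R -> 'rV[R]_ny) * 'rV[R]_nmu -> 'rV[R]_ny)
    (Raff : (R -> 'rV[R]_ny) * 'rV[R]_nmu -> 'rV[R]_nmu)
    (tc : 'I_m -> R) (Cmsh : R) (tm : nat -> nat -> R)
    (xs : (R -> 'rV[R]_ny) * 'rV[R]_ny * 'rV[R]_nmu)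
    (hlmax : (1 <= lmax)%N) (hm : (1 <= m)%N)
    (hG : mildly_differentiable lmax G)
    (hRaff : @ns_affine R (Xsp R ny nmu 0) (euclid R nmu) Raff)
    (hRcont : @ns_continuous R (Xsp R ny nmu 0) (euclid R nmu) Raff)
    (htc : injective tc) (htc01 : forall j, 0 < tc j < 1)
    (htm : forall L, (1 <= L)%N -> is_mesh L Cmsh (tm L))
    (hxs : vmem (CeLip R ny nmu 0) xs) (hfix : xs = Phi G Raff xs) :
  (@has_bounded_inverse R (CeLip R ny nmu 0) (fun x => x - DPhi G Raff xs x) <->
   {in vmem (Ce R ny nmu 1) &, injective (fun x => x - DPhi G Raff xs x)}) /\
  (@has_bounded_inverse R (CeLip R ny nmu 0) (fun x => x - DPhi G Raff xs x) ->
   exists r : R, 0 < r /\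
   exists xL : nat -> (R -> 'rV[R]_ny) * 'rV[R]_ny * 'rV[R]_nmu,
     (\forall L \near \oo, unique
        (fun x => @ns_ball R (CeLip R ny nmu 0) xs r x /\
                  x = PhiL tc G Raff L (tm L) x) (xL L)) /\
     (fun L => vnorm (CeLip R ny nmu 0) (xL L - xs) : R^o) =O_\oo
       (fun L => L%:R ^- minn lmax m : R^o)).
Proof.
have [E sE] := mild_ext hG hlmax; split.
  split; first exact: bounded_inverse_injective.
  exact: (injective_bounded_inverse hlmax hG hRaff hRcont hxs hfix sE).
move=> hB.
have [r [r0 [xL [K [K0 [L0 H]]]]]] :=
  discretized_solution hlmax hm hG hRaff hRcont htc htc01 htm hxs hfix sE hB.
have nearL0 (P : nat -> Prop) : (forall L, (L0 <= L)%N -> P L) -> \forall L \near \oo, P L.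
  by move=> HP; exists L0.
exists r; split=> //; exists xL; split; first by apply: nearL0 => L /H[].
(* The big-O characterization asks for a positive constant, while K is only nonnegative. *)
apply/eqO_exP; exists (K + 1); first by rewrite ltr_pwDr.
apply: nearL0 => L /H[[[[mx _] _] _] h].
rewrite ger0_norm; last exact: (ns_ge0 (normed_CeLip R ny nmu) (memB (normed_CeLip R ny nmu) mx hxs)).
have p0 : 0 <= L%:R ^- minn lmax m :> R by rewrite invr_ge0 exprn_ge0.
by rewrite (ger0_norm p0); apply: le_trans h _; rewrite ler_wpM2r// lerDl.
Qed.
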